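(* Consider the two-stage sampled distribution regression setting and standing assumptions described in the context (no assumption that $f_\rho\in\mathcal{H}$ is made). Let the bag size be $N=l^{1/h}\log(l)$ (rounded up to an integer), and let $\lambda=\lambda_l>0$ satisfy $\lambda\to0$ and $\lambda\sqrt l\to\infty$ as $l\to\infty$. Then the estimator attains the best approximation error from $\mathcal{H}$: $$\mathcal{E}\big(f^\lambda_{\hat z},f_\rho\big)-D_{\mathcal{H}}^2\to0\quad\text{in probability as } l\to\infty,\qquad\text{where } D_{\mathcal{H}}^2=\inf_{q\in\mathcal{H}}\|f_\rho-S_K^*q\|_\rho^2 .$$
   Context: Setting and standing assumptions. $(\mathcal{X},\tau)$ is a separable topological space; $\mathcal{M}_1^+(\mathcal{X})$ is the set of Borel probability measures on $\mathcal{X}$, equipped with the Borel $\sigma$-algebra of the weak topology (the weakest topology making $x\mapsto\int h\,dx$ continuous for all bounded continuous $h:\mathcal{X}\to\mathbb{R}$). $Y$ is a separable Hilbert space. $k:\mathcal{X}\times\mathcal{X}\to\mathbb{R}$ is a continuous reproducing kernel with RKHS $H=H(k)$, bounded: $\sup_{u\in\mathcal{X}}k(u,u)\le B_k<\infty$. The mean embedding of $x\in\mathcal{M}_1^+(\mathcal{X})$ is $\mu_x=\int_{\mathcal{X}}k(\cdot,u)\,dx(u)\in H$, and $X=\{\mu_x:x\in\mathcal{M}_1^+(\mathcal{X})\}\subseteq H$. $\mathcal{H}=\mathcal{H}(K)$ is the $Y$-valued RKHS of functions $X\to Y$ with operator-valued reproducing kernel $K:X\times X\to\mathcal{L}(Y)$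 ($\mathcal{L}(\cdot,\cdot)$ denotes bounded linear operators, $\mathcal{L}(\cdot)$ those from a space to itself, with operator norm). For $\mu_a\in X$, $K_{\mu_a}\in\mathcal{L}(Y,\mathcal{H})$ is given by $(K_{\mu_a}y)(\mu_x)=K(\mu_x,\mu_a)(y)$, so that $f(\mu_a)=K_{\mu_a}^*f$ for $f\in\mathcal{H}$. Assume there are $B_K<\infty$, $L>0$, $h\in(0,1]$ with $\mathrm{Tr}(K_{\mu_a}^*K_{\mu_a})\le B_K$ for all $\mu_a\in X$, and $\|K_{\mu_a}-K_{\mu_b}\|_{\mathcal{L}(Y,\mathcal{H})}\le L\|\mu_a-\mu_b\|_H^h$ for all $\mu_a,\mu_b\in X$. Data: $(x_i,y_i)$, $i=1,\dots,l$, are i.i.d. from a meta distribution on $\mathcal{M}_1^+(\mathcal{X})\times Y$ (product $\sigma$-algebra) with $\|y\|_Y\le C<\infty$ almost surely; the $x_i$ are not observed, but for each $i$ one observes $x_{i,1},\dots,x_{i,N}$ i.i.d. from $x_i$. Write $\hat z=\{(\{x_{i,n}\}_{n=1}^N,y_i)\}_{i=1}^l$ and $\hat x_i=\frac1N\sum_{n=1}^N\delta_{x_{i,n}}$. The estimator is $$f^\lambda_{\hat z}=\arg\min_{f\in\mathcal{H}}\frac1l\sum_{i=1}^l\|f(\mu_{\hat x_i})-y_i\|_Y^2+\lambda\|f\|_{\mathcal{H}}^2 .$$ $\rho$ is the law of $(\mu_x,y)$ on $X\times Y$, $\rho_X$ its marginal on $X$, $\rho(y|\mu_a)$ its conditional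 distribution, and $f_\rho(\mu_a)=\int_Y y\,d\rho(y|\mu_a)$ the regression function. The expected risk is $\mathcal{R}[f]=\mathbb{E}\|f(\mu_x)-y\|_Y^2$ and the excess risk is $\mathcal{E}(f,f_\rho)=\mathcal{R}[f]-\mathcal{R}[f_\rho]$. Further notation: $L^2_{\rho_X}$ is the space of $\rho_X$-square-integrable functions $X\to Y$ with norm $\|f\|_\rho=\big(\int_X\|f(\mu_a)\|_Y^2\,d\rho_X(\mu_a)\big)^{1/2}$, and $S_K^*:\mathcal{H}\hookrightarrow L^2_{\rho_X}$ is the (bounded) inclusion. *)

(* Defs.v *)
From HB Require Import structures.
From mathcomp Require Import all_boot all_order all_algebra.
From mathcomp Require Import all_classical all_reals all_analysis.
From mathcomp Require Import measurable_realfun.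

Set Implicit Arguments.
Unset Strict Implicit.
Unset Printing Implicit Defensive.

Import Order.TTheory GRing.Theory Num.Theory.
Import numFieldNormedType.Exports.
Local Open Scope classical_set_scope.
Local Open Scope ring_scope.

HB.mixin Record CompleteNormedModule_isHilbert (R : realType) V
    & CompleteNormedModule R V := {
  dot : V -> V -> R ;
  dotC : forall u v, dot u v = dot v u ;
  dot_linearl : forall c u v w, dot (c *: u + v) w = c * dot u w + dot v w ;
  dot_norm : forall u, dot u u = `|u| ^+ 2 }.

#[short(type="hilbertType")]
HB.structure Definition Hilbert (R : realType) :=
  {V of CompleteNormedModule R V & CompleteNormedModule_isHilbert R V}.

Definition separable (T : topologicalType) :=
  exists2 D : set T, countable D & dense D.

Notation borel T := (g_sigma_algebraType (@open T)).

Section operators.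
Context {R : realType}.

Definition opnorm (V W : normedModType R) (A : V -> W) : R :=
  sup [set `|A v| | v in [set v | `|v| <= 1]].

(* The value is unique, and for bounded linear A it exists by Riesz *)
Definition adjoint (V W : hilbertType R) (A : V -> W) (w : W) : V :=
  xget 0 [set v | forall u, dot (A u) w = dot u v].

Definition orthonormal_basis (V : hilbertType R) (E : set V) :=
  [/\ forall e, E e -> dot e e = 1,
      forall e e', E e -> E e' -> e <> e' -> dot e e' = 0
    & forall v, (forall e, E e -> dot v e = 0) -> v = 0].

(* Trace of a positive operator; it is in [0, +oo] and does not depend on the
   basis. [esum] is a supremum of finite sums, hence the restriction to positive
   operators. *)
Definition trace (V : hilbertType R) (A : V -> V) : \bar R :=
  \esum_(e in xget set0 (@orthonormal_basis V)) (dot (A e) e)%:E.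

End operators.

Section bochner.
Context d (T : measurableType d) (R : realType) (V : normedModType R).
Implicit Types (P : {measure set T -> \bar R}) (s f : T -> V).

Definition simple_function P s :=
  [/\ finite_set (range s), forall v, measurable (s @^-1` [set v])
    & forall v, v != 0 -> (P (s @^-1` [set v]) < +oo)%E].

Definition simple_integral P s : V :=
  \sum_(v \in range s) fine (P (s @^-1` [set v])) *: v.

(* Integrability of |f - s n| includes its measurability, so that with the
   convergence in mean f is almost everywhere a limit of simple functions *)
Definition is_bochner_integral P f (v : V) := exists s : nat -> T -> V,
  [/\ forall n, simple_function P (s n),
      forall n, P.-integrable setT (fun t => `|f t - s n t|%:E),
      (fun n => \int[P]_t `|f t - s n t|%:E)%E @ \oo --> 0%E
    & (fun n => simple_integral P (s n)) @ \oo --> v].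

Definition bochner P f : V := xget 0 (is_bochner_integral P f).

End bochner.

(* The space of Borel probability measures with its weak topology *)
Section weak_topology_on_measures.
Context (R : realType) (T : ptopologicalType).

Definition bounded_continuous := {h : T -> R | continuous h /\ bounded_fun h}.

Definition integrals (x : probability (borel T) R) :
    {ptws bounded_continuous -> R} :=
  fun h => \int[x]_u (sval h u).

Definition measures := initial_topology integrals.
HB.instance Definition _ := PointedTopological.on measures.

Definition evaluation (B : set (borel T)) (x : measures) : \bar R :=
  (x : probability (borel T) R) B.

End weak_topology_on_measures.

(* A real Hilbert space of functions T -> R with reproducing kernel k: an
   element f is identified with the function [rkhs_fun f] *)
Record rkhs (R : realType) (T : Type) (k : T -> T -> R) := Rkhs {
  rkhs_space :> hilbertType R ;
  rkhs_fun : rkhs_space -> T -> R ;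
  rkhs_linear : forall c f g u,
    rkhs_fun (c *: f + g) u = c * rkhs_fun f u + rkhs_fun g u ;
  rkhs_inj : injective rkhs_fun ;
  rkhs_section : T -> rkhs_space ;
  rkhs_sectionE : forall u v, rkhs_fun (rkhs_section u) v = k v u ;
  rkhs_reproducing : forall f u, dot f (rkhs_section u) = rkhs_fun f u }.

Arguments rkhs_section {R T k} r u.

(* The Y-valued analogue; [vrkhs_section a] is the operator written K_a *)
Record vrkhs (R : realType) (X : Type) (Y : hilbertType R)
    (K : X -> X -> {linear Y -> Y}) := Vrkhs {
  vrkhs_space :> hilbertType R ;
  vrkhs_fun : vrkhs_space -> X -> Y ;
  vrkhs_linear : forall c f g a,
    vrkhs_fun (c *: f + g) a = c *: vrkhs_fun f a + vrkhs_fun g a ;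
  vrkhs_inj : injective vrkhs_fun ;
  vrkhs_section : X -> Y -> vrkhs_space ;
  vrkhs_sectionE : forall a y b, vrkhs_fun (vrkhs_section a y) b = K b a y ;
  vrkhs_reproducing : forall f a y,
    dot f (vrkhs_section a y) = dot (vrkhs_fun f a) y }.

Arguments vrkhs_fun {R X Y K v} _ _.
Arguments vrkhs_section {R X Y K} v a y.

Section mean_embedding.
Context (R : realType) (T : ptopologicalType) (k : T -> T -> R) (H : rkhs k).

Definition mean_embedding (x : probability (borel T) R) : H :=
  bochner x (rkhs_section H).

Definition embeddings := set_type (range mean_embedding).
HB.instance Definition _ := Topological.on embeddings.

Definition embed (x : probability (borel T) R) : embeddings :=
  SigSub (mem_set (imageT mean_embedding x)).

HB.instance Definition _ := isPointed.Build embeddings (embed point).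

End mean_embedding.

(* (1/N) (\d_(s 0) + ... + \d_(s N.-1)); the second argument of [mnormalize] is
   only a default value for N = 0 *)
Definition empirical (R : realType) (T : ptopologicalType) (N : nat)
    (s : nat -> T) : probability (borel T) R :=
  mnormalize (msum (fun n => \d_(s n : borel T)) N) (\d_(point : borel T)).

(* l bags of N points: the pairs (dist i, label i) are i.i.d. with law M and,
   given these pairs, the points of the i-th bag are i.i.d. with law dist i,
   independently of the other bags. Only the indices i < l and n < N are used.
   When T is not metrizable, x |-> x B may fail to be measurable for the Borel
   sigma-algebra of the weak topology; the law is prescribed on the sets B for
   which the integral makes sense, which include all Baire sets. *)
Record two_stage_sample (R : realType) (T : ptopologicalType)
    (Y : hilbertType R)
    (M : probability (borel (measures R T) * borel Y)%type R) (l N : nat) :=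
  TwoStageSample {
  sample_disp : measure_display ;
  sample_space : measurableType sample_disp ;
  sample_prob : probability sample_space R ;
  dist : nat -> sample_space -> borel (measures R T) ;
  label : nat -> sample_space -> borel Y ;
  bag : nat -> nat -> sample_space -> borel T ;
  dist_measurable : forall i, (i < l)%N -> measurable_fun setT (dist i) ;
  label_measurable : forall i, (i < l)%N -> measurable_fun setT (label i) ;
  bag_measurable : forall i n, (i < l)%N -> (n < N)%N ->
    measurable_fun setT (bag i n) ;
  sample_law : forall (A : nat -> set (borel (measures R T) * borel Y))
      (B : nat -> nat -> set (borel T)),
    (forall i, measurable (A i)) ->
    (forall i n, measurable (B i n)) ->
    (forall i n, measurable_fun [set: borel (measures R T)]
      (evaluation (B i n))) ->
    sample_prob [set w | forall i, (i < l)%N ->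
        A i (dist i w, label i w) /\
        forall n, (n < N)%N -> B i n (bag i n w)] =
    (\big[mule/1]_(i < l) \int[M]_(p in A i)
       \big[mule/1]_(n < N) evaluation (B i n) p.1)%E }.

Arguments sample_space {R T Y M l N} t.
Arguments sample_prob {R T Y M l N} t.
Arguments label {R T Y M l N} t _ _.
Arguments bag {R T Y M l N} t _ _ _.

Definition bag_size (R : realType) (h : R) (l : nat) : nat :=
  `|Num.ceil ((l%:R : R) `^ h^-1 * ln (l%:R : R))|%N.

Definition is_law d d' (S : measurableType d) (S' : measurableType d')
    (R : realType) (Q : probability S' R) (P : probability S R) (f : S -> S') :=
  forall A, measurable A -> Q A = pushforward P f A.

Definition is_conditional d d' (X : measurableType d) (Y : measurableType d')
    (R : realType) (rho : probability (X * Y)%type R) (rhoX : probability X R)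
    (kappa : R.-pker X ~> Y) :=
  forall A B, measurable A -> measurable B ->
    rho (A `*` B) = (\int[rhoX]_(a in A) kappa a B)%E.

Section regression.
Context (R : realType) (X : ptopologicalType) (Y : hilbertType R).

Definition regression (kappa : R.-pker (borel X) ~> (borel Y)) (a : X) : Y :=
  bochner (kappa a) (fun y => y).

Definition risk (rho : probability (borel X * borel Y)%type R) (f : X -> Y) :
    \bar R :=
  (\int[rho]_p (`|f p.1 - p.2| ^+ 2)%:E)%E.

Definition excess_risk rho (f g : X -> Y) : \bar R :=
  (risk rho f - risk rho g)%E.

Definition sqnormL2 (rhoX : probability (borel X) R) (f : X -> Y) : \bar R :=
  (\int[rhoX]_a (`|f a| ^+ 2)%:E)%E.

Context (K : X -> X -> {linear Y -> Y}) (HK : vrkhs K).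

Definition sq_approx_error rhoX (g : X -> Y) : \bar R :=
  ereal_inf [set sqnormL2 rhoX (fun a => g a - vrkhs_fun q a) | q in [set: HK]].

Definition objective (lambda : R) (l : nat) (a : nat -> X) (y : nat -> Y)
    (f : HK) : R :=
  l%:R^-1 * (\sum_(i < l) `|vrkhs_fun f (a i) - y i| ^+ 2)
  + lambda * `|f| ^+ 2.

(* For lambda > 0 the minimizer exists and is unique *)
Definition ridge lambda l a y : HK :=
  xget 0 [set f | forall g, objective lambda l a y f <= objective lambda l a y g].

End regression.

Section estimator.
Context (R : realType) (T : ptopologicalType) (k : T -> T -> R) (H : rkhs k)
  (Y : hilbertType R)
  (K : embeddings H -> embeddings H -> {linear Y -> Y}) (HK : vrkhs K)
  (M : probability (borel (measures R T) * borel Y)%type R).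

Definition estimator (lambda : R) l N (S : two_stage_sample M l N)
    (w : sample_space S) : HK :=
  ridge HK lambda l (fun i => embed H (empirical R N (fun n => bag S i n w)))
    (fun i => label S i w).

End estimator.

(* Main.v *)
Require Import Defs.
From HB Require Import structures.
From mathcomp Require Import all_boot all_order all_algebra.
From mathcomp Require Import all_classical all_reals all_analysis.
From mathcomp Require Import measurable_realfun.
From mathcomp Require Import ring lra.
From mathcomp Require Import giry.

Set Implicit Arguments.
Unset Strict Implicit.
Unset Printing Implicit Defensive.

Import Order.TTheory GRing.Theory Num.Theory.
Import numFieldNormedType.Exports.
Local Open Scope classical_set_scope.
Local Open Scope ring_scope.

(** The risk of a function exceeds that of the regression function by the squared
    distance between the two ([risk_decomposition]). Hence the excess risk of the
    estimator minus the squared approximation error is the gap between its risk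
    and [iota], the infimum of the risk over the hypothesis space
    ([excess_risk_gap]). This gap is nonnegative, so by Markov's inequality
    ([probability_gap_le]) convergence in probability follows once the expected
    risk of the estimator is bounded, for each fixed [q] of the hypothesis space,
    by the risk of [q] up to terms that vanish ([expected_risk_le]); then [q] is
    chosen with a risk close to [iota].

    The bound on the expected risk rests on the stability of ridge regression.
    The objective is strongly convex, so that replacing one observation out of
    [l] moves its minimizer by [O(1/l)] ([ridge_stability]) and changes the risk
    and the losses of the fit by [O(1/(lambda^2 l))]. The fit obtained when the
    [i]-th observation is replaced by a constant is independent of that
    observation, so its expected risk is its expected loss there
    ([integral_sample_independent]). Averaging over [i], the expected risk of the
    estimator is its expected empirical error up to the stability terms. The
    empirical error is at most the minimum of the objective, hence at most the
    value of the objective at [q], whose expectation is the risk of [q] plus the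
    penalty [lambda |q|^2].

    In the last steps empirical mean embeddings take the place of true ones, or
    conversely. The functions of the hypothesis space are Hoelder continuous
    ([vrkhs_fun_holder]), and the squared distance between the two embeddings has
    expectation at most [4 Bk / N] ([bag_mean_variance]). For the given bag size,
    the total error is [lambda |q|^2] plus terms of order [u] and [u^2] where
    [u = 1 / (lambda sqrt l)] ([excess_bound]).

    The space of points carries no metric, so measurability needs care.
    Functions with values in the separable Hilbert spaces are handled through
    their distances to fixed vectors ([norm_measurable]), and the bags through the
    Baire sets: the probability of a Baire set is a measurable function of the
    measure for the weak topology ([evaluation_baire_measurable]), and continuous
    functions are measurable for the Baire sigma-algebra. *)

(** * Hilbert space geometry *)

Section hilbert.
Context {R : realType} {V : hilbertType R}.
Implicit Types (u v w : V) (c : R).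

Lemma dotDl u v w : dot (u + v) w = dot u w + dot v w :> R.
Proof. by rewrite -{1}(scale1r u) dot_linearl mul1r. Qed.

Lemma dot0l w : dot 0 w = 0 :> R.
Proof. by have := dotDl 0 0 w; rewrite addr0 => /eqP; rewrite -subr_eq0 opprD addNKr oppr_eq0 => /eqP. Qed.

Lemma dotZl c u w : dot (c *: u) w = c * dot u w.
Proof. by rewrite -(addr0 (c *: u)) dot_linearl dot0l addr0. Qed.

Lemma dotNl u w : dot (- u) w = - dot u w :> R.
Proof. by rewrite -scaleN1r dotZl mulN1r. Qed.

Lemma dotBl u v w : dot (u - v) w = dot u w - dot v w :> R.
Proof. by rewrite dotDl dotNl. Qed.

Lemma dotDr u v w : dot u (v + w) = dot u v + dot u w :> R.
Proof. by rewrite dotC dotDl !(dotC u). Qed.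

Lemma dot0r u : dot u 0 = 0 :> R.
Proof. by rewrite dotC dot0l. Qed.

Lemma dotZr c u w : dot u (c *: w) = c * dot u w.
Proof. by rewrite dotC dotZl (dotC u). Qed.

Lemma dotBr u v w : dot u (v - w) = dot u v - dot u w :> R.
Proof. by rewrite dotC dotBl !(dotC u). Qed.

Lemma dot_suml n (F : nat -> V) w :
  dot (\sum_(i < n) F i) w = \sum_(i < n) dot (F i) w :> R.
Proof.
elim: n => [|n IH]; first by rewrite !big_ord0 dot0l.
by rewrite !big_ord_recr/= dotDl IH.
Qed.

Lemma sqnormD u v : `|u + v| ^+ 2 = `|u| ^+ 2 + 2 * dot u v + `|v| ^+ 2 :> R.
Proof. by rewrite -!dot_norm dotDl !dotDr (dotC v u); ring. Qed.

Lemma sqnormB u v : `|u - v| ^+ 2 = `|u| ^+ 2 - 2 * dot u v + `|v| ^+ 2 :> R.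
Proof. by rewrite -!dot_norm dotBl !dotBr (dotC v u); ring. Qed.

Lemma cauchy_schwarz u v : `|dot u v| <= `|u| * `|v| :> R.
Proof.
have [->|v0] := eqVneq v 0; first by rewrite dot0r !normr0 mulr0.
have nv : 0 < `|v| ^+ 2 :> R by rewrite exprn_gt0// normr_gt0.
rewrite -(@ler_pXn2r _ 2)// ?nnegrE ?mulr_ge0// exprMn real_normK ?num_real//.
have := sqr_ge0 `|u - (dot u v / `|v| ^+ 2) *: v|.
rewrite sqnormB dotZr normrZ exprMn real_normK ?num_real//.
set a := `|u| ^+ 2; set b := `|v| ^+ 2 in nv *; set d := dot u v => h.
have {}h : 0 <= a - d ^+ 2 / b.
  apply: le_trans h _; rewrite le_eqVlt; apply/orP; left; apply/eqP.
  by field; rewrite gt_eqF.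
by move: h; rewrite subr_ge0 ler_pdivrMr.
Qed.

Lemma dot_le u v : dot u v <= `|u| * `|v| :> R.
Proof. exact: le_trans (ler_norm _) (cauchy_schwarz _ _). Qed.

Lemma norm_le_dot u (b : R) : 0 <= b -> (forall v, dot u v <= b * `|v|) ->
  `|u| <= b.
Proof.
move=> b0 /(_ u); rewrite dot_norm expr2.
have [->|u0] := eqVneq u 0; first by rewrite normr0.
by rewrite ler_pM2r// normr_gt0.
Qed.

Lemma dot_inj u v : (forall w, dot u w = dot v w :> R) -> u = v.
Proof.
move=> uv; apply/eqP; rewrite -subr_eq0 -normr_eq0 -sqrf_eq0 -dot_norm.
by rewrite dotBl uv subrr.
Qed.

Lemma parallelogram_mid u v w :
  `|w - 2^-1 *: (u + v)| ^+ 2 =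
  (`|w - u| ^+ 2 + `|w - v| ^+ 2) / 2 - 4^-1 * `|u - v| ^+ 2 :> R.
Proof.
rewrite !sqnormB dotZr dotDr normrZ exprMn ger0_norm// sqnormD.
by field.
Qed.

Lemma cauchy_seq_cvg (u : nat -> V) :
  (forall e : R, 0 < e -> exists N, forall m n, (N <= m)%N -> (N <= n)%N ->
     `|u m - u n| < e) -> exists p : V, u @ \oo --> p.
Proof.
move=> hu; suff /cauchy_cvgP : @cauchy V (u @ \oo) by move=> cu; eexists; exact: cu.
apply: cauchy_exP => e e0; have [N hN] := hu _ e0.
exists (u N); exists N => // n /= Nn.
by rewrite -ball_normE /ball_/=; exact: hN.
Qed.

(** A minimizing sequence is Cauchy: the value at the midpoint of two
    near-minimizers cannot undercut the infimum, so they are close. *)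
Lemma midpoint_convex_minimizer (J : V -> R) (C : set V) (c : R) :
  0 < c -> C !=set0 ->
  (forall u v, C u -> C v -> C (2^-1 *: (u + v))) ->
  (forall v, 0 <= J v) ->
  (forall u v, J (2^-1 *: (u + v)) <= (J u + J v) / 2 - c * `|u - v| ^+ 2) ->
  continuous J ->
  exists2 p, closure C p & forall v, C v -> J p <= J v.
Proof.
move=> c0 [v0 Cv0] Cmid J0 Jmid Jc.
pose A := [set J v | v in C]; pose i := inf A.
have A0 : A !=set0 by exists (J v0); exists v0.
have hiA : has_inf A by split=> //; exists 0 => _ [v _ <-].
have ile v : C v -> i <= J v by move=> Cv; apply: ge_inf; [case: hiA|exists v].
have uP n : exists v, C v /\ J v < i + n.+1%:R^-1.
  have [_ [v Cv <-] lt] := @inf_adherent _ A n.+1%:R^-1 ltac:(by []) hiA.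
  by exists v.
pose u n := projT1 (cid (uP n)).
have uC n : C (u n) by rewrite /u; case: cid => v /= [].
have uJ n : J (u n) < i + n.+1%:R^-1 by rewrite /u; case: cid => v /= [].
have du m n : c * `|u m - u n| ^+ 2 <= m.+1%:R^-1 + n.+1%:R^-1.
  have := Jmid (u m) (u n); have := ile _ (Cmid _ _ (uC m) (uC n)).
  have := uJ m; have := uJ n.
  have : 0 < m.+1%:R^-1 :> R by [].
  have : 0 < n.+1%:R^-1 :> R by [].
  move: (n.+1%:R^-1) (m.+1%:R^-1) (`|u m - u n| ^+ 2) => a b d.
  lra.
have [p up] : exists p : V, u @ \oo --> p.
  apply: cauchy_seq_cvg => e e0.
  have k0 : 0 < c * e ^+ 2 / 2 by rewrite !divr_gt0 ?mulr_gt0 ?exprn_gt0.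
  have [N _ hN] := near_infty_natSinv_lt (PosNum k0).
  exists N => m n Nm Nn; rewrite -(@ltr_pXn2r _ 2)// ?nnegrE ?(ltW e0)//.
  rewrite -(ltr_pM2l c0); apply: le_lt_trans (du m n) _.
  have hm : m.+1%:R^-1 < c * e ^+ 2 / 2 := hN m Nm.
  have hn : n.+1%:R^-1 < c * e ^+ 2 / 2 := hN n Nn.
  by rewrite [ltRHS]splitr; exact: ltrD.
exists p.
  have Cu : \forall n \near \oo, closure C (u n).
    by near=> n; apply: subset_closure.
  exact: (@closed_cvg _ _ _ _ u (closure C) (@closed_closure _ C) Cu _ up).
have Ju : (J \o u) @ \oo --> J p by apply: continuous_cvg => //; exact: Jc.
suff Ji : (J \o u) @ \oo --> i.
  by move=> v Cv; have -> : J p = i; [exact: cvg_unique Ju Ji|exact: ile].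
apply: (@squeeze_cvgr _ _ _ _ (cst i) (fun n => i + n.+1%:R^-1)).
- near=> n; apply/andP; split; [exact/ile/uC|exact/ltW/uJ].
- exact: cvg_cst.
- rewrite -[X in _ --> X]addr0; apply: cvgD; first exact: cvg_cst.
  exact: cvg_harmonic.
Unshelve. all: by end_near. Qed.

End hilbert.

(** * Measurability for maps into separable spaces *)

Section dense_sequences.
Context {R : realType}.

Definition dense_seq (V : normedModType R) (e : nat -> V) :=
  forall v (r : R), 0 < r -> exists j, `|v - e j| < r.

Lemma separable_dense_seq (V : normedModType R) : separable V ->
  exists e : nat -> V, dense_seq e.
Proof.
move=> [D cD dD].
have [D0|[f]] := pfcard_geP cD.
  have [x []] := dD setT (ex_intro _ 0 I) openT.
  by rewrite D0.
exists f => v r r0.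
have [||x [vx Dx]] := dD (ball v r).
- by exists v; exact: ballxx.
- exact: ball_open.
- have [j _ jx] := 'surj_f Dx; exists j.
  by rewrite jx; move: vx; rewrite -ball_normE.
Qed.

End dense_sequences.

Section strong_measurability.
Context {R : realType} d {Om : measurableType d}.

(** Strong measurability, in the form that makes sense for every target: when
    the target is separable it is equivalent to Borel measurability. *)
Definition norm_measurable (V : normedModType R) (F : Om -> V) :=
  forall v, measurable_fun [set: Om] (fun w => `|F w - v|).

(** The countably many functions [delta j], to be thought of as the distances to
    the points of a countable dense set, generate a sigma-algebra for which
    every function that is continuous for the corresponding topology is
    measurable. *)
Lemma measurable_continuous_of_dense (Z : Type) (J : countType)
    (delta : J -> Z -> R) (F : Om -> Z) (Psi : Z -> R) :
  (forall j, measurable_fun [set: Om] (delta j \o F)) ->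
  (forall z (r : R), 0 < r -> exists j, delta j z < r) ->
  (forall z (r : R), 0 < r -> exists2 s : R, 0 < s & forall z' j,
     delta j z < s -> delta j z' < s -> `|Psi z - Psi z'| < r) ->
  measurable_fun [set: Om] (Psi \o F).
Proof.
move=> mdelta ddelta Psic _.
apply: (measurability _ (RGenOInfty.measurableE R)) => //.
move=> /= _ [_ [t ->] <-]; rewrite setTI.
pose A (jn : J * nat) := if `[< forall z', delta jn.1 z' < jn.2.+1%:R^-1 -> t < Psi z' >]
  then [set w | delta jn.1 (F w) < jn.2.+1%:R^-1] else set0.
rewrite (_ : _ @^-1` _ = \bigcup_jn A jn); last first.
  apply/seteqP; split => w /=; rewrite in_itv/= andbT.
    move=> tw; have pw : 0 < Psi (F w) - t by rewrite subr_gt0.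
    have [s s0 hs] := Psic (F w) _ pw.
    have [N _ hN] := near_infty_natSinv_lt (PosNum s0).
    have sN : N.+1%:R^-1 < s := hN N (leqnn N).
    have [//|j jw] := ddelta (F w) N.+1%:R^-1.
    exists (j, N) => //; rewrite /A /=.
    case: asboolP => // -[] z' jz'.
    have := hs z' j (lt_trans jw sN) (lt_trans jz' sN).
    by have := ler_norm (Psi (F w) - Psi z'); lra.
  by move=> [[j n] _]; rewrite /A /=; case: asboolP => // h /= /h.
apply: countable_bigcupT_measurable => // -[j n]; rewrite /A /=.
case: asboolP => // _.
rewrite (_ : [set _ | _] = (delta j \o F) @^-1` `]-oo, n.+1%:R^-1[%classic).
  by rewrite -[X in measurable X]setTI; apply: mdelta => //; exact: measurable_itv.
by apply/seteqP; split => w /=; rewrite in_itv.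
Qed.

Lemma norm_measurable_cst (V : normedModType R) (v : V) :
  norm_measurable (fun _ : Om => v).
Proof. by move=> u; exact: measurable_cst. Qed.

Lemma norm_measurable_norm (V : normedModType R) (F : Om -> V) :
  norm_measurable F -> measurable_fun [set: Om] (fun w => `|F w|).
Proof. by move=> /(_ 0); under eq_fun do rewrite subr0. Qed.

Lemma measurable_norm_gt (V : normedModType R) (F : Om -> V) (c : R) :
  norm_measurable F -> measurable [set w | c < `|F w|].
Proof.
move=> mF; rewrite (_ : [set _ | _] = (fun w => `|F w|) @^-1` `]c, +oo[%classic).
  by rewrite -[X in measurable X]setTI; exact: (norm_measurable_norm mF).
by apply/seteqP; split => w /=; rewrite in_itv/= andbT.
Qed.

Lemma measurable_lipschitz2 (V W : normedModType R) (e : nat -> V) (f : nat -> W)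
    (F : Om -> V) (G : Om -> W) (Psi : V -> W -> R) (c : R) :
  dense_seq e -> dense_seq f -> norm_measurable F -> norm_measurable G ->
  (forall u v u' v', `|Psi u v - Psi u' v'| <= c * (`|u - u'| + `|v - v'|)) ->
  measurable_fun [set: Om] (fun w => Psi (F w) (G w)).
Proof.
move=> de df mF mG Psil.
pose delta (j : nat * nat) (z : V * W) := `|z.1 - e j.1| + `|z.2 - f j.2|.
apply: (@measurable_continuous_of_dense (V * W)%type (nat * nat)%type delta
  (fun w => (F w, G w)) (fun z => Psi z.1 z.2)).
- by move=> j; apply: measurable_funD; [exact: mF|exact: mG].
- move=> z r r0; have r20 : 0 < r / 2 by rewrite divr_gt0.
  have [i ie] := de z.1 _ r20; have [j jf] := df z.2 _ r20.
  by exists (i, j); rewrite /delta/=; lra.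
move=> z r r0; exists (r / (2 * (`|c| + 1))) => [|z' j].
  by rewrite divr_gt0// mulr_gt0// ltr_wpDl.
rewrite /delta => h1 h2; apply: le_lt_trans (Psil _ _ _ _) _.
have c0 : 0 < `|c| + 1 by rewrite ltr_wpDl.
have {}h : `|z.1 - z'.1| + `|z.2 - z'.2| < r / (`|c| + 1).
  have t1 := ler_distD (e j.1) z.1 z'.1; have t2 := ler_distD (f j.2) z.2 z'.2.
  rewrite (distrC (e _)) in t1; rewrite (distrC (f _)) in t2.
  have -> : r / (`|c| + 1) = r / (2 * (`|c| + 1)) + r / (2 * (`|c| + 1)).
    by field; rewrite gt_eqF.
  by move: h1 h2 t1 t2; lra.
apply: (@le_lt_trans _ _ ((`|c| + 1) * (`|z.1 - z'.1| + `|z.2 - z'.2|))).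
  by rewrite ler_wpM2r// ?addr_ge0// (le_trans (ler_norm c))// lerDl.
by rewrite mulrC -ltr_pdivlMr.
Qed.

Let norm_sub_lipschitz (V : normedModType R) (x y v x' y' : V) :
  `| `|x - y - v| - `|x' - y' - v| | <= 1 * (`|x - x'| + `|y - y'|).
Proof.
rewrite mul1r; apply: le_trans (ler_dist_dist _ _) _.
suff -> : x - y - v - (x' - y' - v) = (x - x') - (y - y') by exact: ler_normB.
by rewrite opprB addrA subrK !opprB (addrC y') addrACA (addrC (- y)).
Qed.

Lemma norm_measurableB (V : normedModType R) (e : nat -> V) (F G : Om -> V) :
  dense_seq e -> norm_measurable F -> norm_measurable G ->
  norm_measurable (fun w => F w - G w).
Proof.
move=> de mF mG v.
apply: (@measurable_lipschitz2 _ _ e e F G (fun x y => `|x - y - v|) 1) => //;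
  exact: norm_sub_lipschitz.
Qed.

Lemma norm_measurable_sub (V : normedModType R) (e : nat -> V) (F G : Om -> V) :
  dense_seq e -> norm_measurable F -> norm_measurable G ->
  measurable_fun [set: Om] (fun w => `|F w - G w|).
Proof. by move=> de mF mG; exact: (norm_measurable_norm (norm_measurableB de mF mG)). Qed.

Lemma norm_measurableN (V : normedModType R) (F : Om -> V) :
  norm_measurable F -> norm_measurable (fun w => - F w).
Proof.
move=> mF v; rewrite (_ : (fun _ => _) = (fun w => `|F w - (- v)|)); first exact: mF.
by apply/funext => w; rewrite -normrN !opprD !opprK.
Qed.

Lemma norm_measurableD (V : normedModType R) (e : nat -> V) (F G : Om -> V) :
  dense_seq e -> norm_measurable F -> norm_measurable G ->
  norm_measurable (fun w => F w + G w).
Proof.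
move=> de mF mG v; rewrite (_ : (fun _ => _) = (fun w => `|F w - (- G w) - v|)).
  exact: norm_measurableB de mF (norm_measurableN mG) v.
by apply/funext => w; rewrite opprK.
Qed.

Lemma norm_measurable_sum (V : normedModType R) (e : nat -> V) n
    (F : nat -> Om -> V) : dense_seq e ->
  (forall i, (i < n)%N -> norm_measurable (F i)) ->
  norm_measurable (fun w => \sum_(i < n) F i w).
Proof.
move=> de; elim: n => [|n IH] mF.
  by move=> v; under eq_fun do rewrite big_ord0; exact: measurable_cst.
rewrite (_ : (fun _ => _) = (fun w => \sum_(i < n) F i w + F n w)); last first.
  by apply/funext => w; rewrite big_ord_recr.
by apply: norm_measurableD de _ _; [apply: IH => i /ltnW|]; exact: mF.
Qed.

Lemma norm_measurableZ (V : normedModType R) (c : R) (F : Om -> V) :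
  norm_measurable F -> norm_measurable (fun w => c *: F w).
Proof.
move=> mF v; have [->|c0] := eqVneq c 0.
  by under eq_fun do rewrite scale0r; exact: measurable_cst.
rewrite (_ : (fun _ => _) = (fun w => `|c| * `|F w - c^-1 *: v|)); last first.
  by apply/funext => w; rewrite -normrZ scalerBr scalerA divff// scale1r.
by apply: measurable_funM => //; exact: mF.
Qed.

Lemma norm_measurable_dot (V : hilbertType R) (e : nat -> V) (F G : Om -> V) :
  dense_seq e -> norm_measurable F -> norm_measurable G ->
  measurable_fun [set: Om] (fun w => dot (F w) (G w) : R).
Proof.
move=> de mF mG.
rewrite (_ : (fun _ => _) = (fun w => 2^-1 *
    (`|F w| ^+ 2 + `|G w| ^+ 2 - `|F w - G w| ^+ 2))); last first.
  by apply/funext => w; rewrite sqnormB; field.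
apply: measurable_funM => //; apply: measurable_funB.
  by apply: measurable_funD; apply: measurable_funX; exact: norm_measurable_norm.
by apply: measurable_funX; apply/norm_measurable_norm/(norm_measurableB de).
Qed.

(** The squared norm is the supremum over a dense sequence of the affine
    functions [2 <x, e j> - |e j|^2]. *)
Lemma weakly_measurable_norm_measurable (V : hilbertType R) (e : nat -> V)
    (F : Om -> V) : dense_seq e ->
  (forall v, measurable_fun [set: Om] (fun w => dot (F w) v : R)) ->
  norm_measurable F.
Proof.
move=> de mF v.
pose g j w : R := 2 * dot (F w - v) (e j) - `|e j| ^+ 2.
have gle j w : g j w <= `|F w - v| ^+ 2.
  by have := sqr_ge0 `|F w - v - e j|; rewrite sqnormB /g; lra.
have mg j : measurable_fun [set: Om] (g j).
  apply: measurable_funB => //; apply: measurable_funM => //.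
  under eq_fun do rewrite dotBl.
  by apply: measurable_funB => //; exact: mF.
move=> _; apply: (measurability _ (RGenOInfty.measurableE R)) => //.
move=> /= _ [_ [t ->] <-]; rewrite setTI.
have [t0|t0] := ltP t 0.
  rewrite (_ : _ @^-1` _ = setT)//; apply/seteqP; split => // w _ /=.
  by rewrite in_itv/= andbT (lt_le_trans t0).
rewrite (_ : _ @^-1` _ = \bigcup_j (g j @^-1` `]t ^+ 2, +oo[%classic)); last first.
  apply/seteqP; split => w /=; rewrite in_itv/= andbT.
    move=> tw; have sw : 0 < `|F w - v| ^+ 2 - t ^+ 2.
      by rewrite subr_gt0 ltr_pXn2r// nnegrE.
    have [j hj] := de (F w - v) (Num.sqrt (`|F w - v| ^+ 2 - t ^+ 2)) ltac:(by rewrite sqrtr_gt0).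
    exists j => //=; rewrite in_itv/= andbT /g.
    have {hj} : `|F w - v - e j| ^+ 2 < `|F w - v| ^+ 2 - t ^+ 2.
      by rewrite -[ltRHS]sqr_sqrtr ?ltW// ltr_pXn2r// nnegrE.
    by rewrite (sqnormB (F w - v)); lra.
  move=> [j _] /=; rewrite in_itv/= andbT => h.
  by rewrite -(@ltr_pXn2r _ 2)// ?nnegrE//; exact: lt_le_trans h (gle _ _).
apply: bigcupT_measurable => j.
by rewrite -[X in measurable X]setTI; apply: mg => //; exact: measurable_itv.
Qed.

Lemma norm_measurable_preimage_ball (V : normedModType R) (F : Om -> V) v (r : R) :
  norm_measurable F -> measurable [set w | `|F w - v| < r].
Proof.
move=> mF; rewrite (_ : [set _ | _] = (fun w => `|F w - v|) @^-1` `]-oo, r[%classic).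
  by rewrite -[X in measurable X]setTI; apply: mF => //; exact: measurable_itv.
by apply/seteqP; split => w /=; rewrite in_itv.
Qed.

(** An open set is a countable union of balls around the points of [e]. *)
Lemma norm_measurable_preimage_open (V : normedModType R) (e : nat -> V)
    (F : Om -> V) (O : set V) : dense_seq e ->
  norm_measurable F -> open O -> measurable (F @^-1` O).
Proof.
move=> de mF oO.
pose A (jn : nat * nat) := if `[< forall v, `|v - e jn.1| < jn.2.+1%:R^-1 -> O v >]
  then [set w | `|F w - e jn.1| < jn.2.+1%:R^-1] else set0.
rewrite (_ : _ @^-1` _ = \bigcup_jn A jn); last first.
  apply/seteqP; split => w /=; last first.
    by move=> [[j n] _]; rewrite /A /=; case: asboolP => // h /= /h.
  move=> Ow; have /nbhs_ballP[r /= r0 rO] : nbhs (F w) O by exact: open_nbhs_nbhs.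
  have r20 : 0 < r / 2 by rewrite divr_gt0.
  have [N _ hN] := near_infty_natSinv_lt (PosNum r20).
  have sN : N.+1%:R^-1 < r / 2 := hN N (leqnn N).
  have [//|j jw] := de (F w) N.+1%:R^-1.
  exists (j, N) => //; rewrite /A /=; case: asboolP => // -[] v vj.
  apply: rO; rewrite -ball_normE /ball_/=.
  have := ler_distD (e j) (F w) v; rewrite (distrC (e j)).
  by have := lt_trans jw sN; have := lt_trans vj sN; lra.
apply: countable_bigcupT_measurable => // -[j n]; rewrite /A /=.
by case: asboolP => // _; exact: norm_measurable_preimage_ball.
Qed.

End strong_measurability.

Lemma norm_measurable_comp (R : realType) d d' (Om : measurableType d)
    (Z : measurableType d') (V : normedModType R) (F : Z -> V) (g : Om -> Z) :
  norm_measurable F -> measurable_fun setT g -> norm_measurable (F \o g).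
Proof. by move=> mF mg v; exact: measurableT_comp (mF v) mg. Qed.

Section borel.
Context {R : realType}.

Lemma borel_measurable_fun (S : ptopologicalType) d (Om : measurableType d)
    (F : Om -> borel S) :
  (forall O : set S, open O -> measurable (F @^-1` O)) -> measurable_fun setT F.
Proof.
move=> mF; apply: (@measurability _ _ Om (borel S) setT F open) => //.
by move=> _ [U oU <-]; rewrite setTI; exact: mF.
Qed.

Lemma continuous_borel_measurable (T : ptopologicalType) (f : T -> R) :
  continuous f -> measurable_fun [set: borel T] f.
Proof.
move=> cf _; apply: (measurability _ (RGenOpens.measurableE R)) => //.
move=> _ [_ [a [b ->]] <-]; rewrite setTI.
apply: sub_sigma_algebra; move/continuousP : cf; apply; exact: interval_open.
Qed.

Lemma continuous_norm_measurable (T : ptopologicalType) (V : normedModType R)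
    (F : T -> V) : continuous F -> @norm_measurable R _ (borel T) V F.
Proof.
move=> cF v; apply: continuous_borel_measurable => t.
apply: (@continuous_comp _ _ _ (fun t => F t - v) Num.norm).
  by apply: continuousB; [exact: cF|exact: cst_continuous].
exact: norm_continuous.
Qed.

End borel.

Section total_sequences.
Context {R : realType} {V : hilbertType R}.

Let rat_comb (u : nat -> V) (s : seq (rat * nat)) : V :=
  \sum_(x <- s) ratr x.1 *: u x.2.

(** The closest point [p] to [v] in the closure of the rational span of [u]
    satisfies [v - p] orthogonal to every [u n], because moving [p] by the
    rational multiples of [u n] stays in the span. *)
Lemma total_dense_seq (u : nat -> V) :
  (forall v, (forall n, dot v (u n) = 0 :> R) -> v = 0) ->
  exists e : nat -> V, dense_seq e.
Proof.
move=> tot; pose C := range (rat_comb u).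
suff clC v : closure C v.
  exists (fun j => rat_comb u (odflt [::] (unpickle j))) => v r r0.
  have [|_ [[s _ <-] vs]] := clC v (ball v r); first exact: nbhsx_ballx.
  exists (pickle s); rewrite pickleK /=.
  by move: vs; rewrite -ball_normE.
pose J w : R := `|v - w| ^+ 2.
have Jc : continuous J.
  move=> w; apply: (@continuous_comp _ _ _ (fun w => `|v - w|) (fun x => x ^+ 2)).
    apply: (@continuous_comp _ _ _ (fun w => v - w) Num.norm).
      by apply: continuousB; [exact: cst_continuous|exact: id].
    exact: norm_continuous.
  exact: exprn_continuous.
have [p Cp pmin] : exists2 p, closure C p & forall w, C w -> J p <= J w.
  apply: (@midpoint_convex_minimizer _ _ _ _ 4^-1) => //.
  - by exists (rat_comb u [::]); exists [::].
  - move=> _ _ [s _ <-] [t _ <-].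
    exists ([seq (2^-1 * x.1, x.2) | x <- s] ++ [seq (2^-1 * x.1, x.2) | x <- t]) => //.
    rewrite /rat_comb big_cat/= !big_map scalerDr !scaler_sumr.
    by congr (_ + _); apply: eq_bigr => x _; rewrite scalerA rmorphM fmorphV rmorph_nat.
  - by move=> w; rewrite /J sqr_ge0.
  - by move=> x y; rewrite /J parallelogram_mid.
suff -> : v = p by [].
apply/eqP; rewrite -subr_eq0; apply/eqP/tot => n.
have key (q : rat) : 2 * ratr q * dot (v - p) (u n) <= ratr q ^+ 2 * `|u n| ^+ 2.
  have shift w : C w -> C (w + ratr q *: u n).
    move=> [s _ <-]; exists ((q, n) :: s) => //.
    by rewrite /rat_comb big_cons/= addrC.
  pose A := [set w | J p <= J (w + ratr q *: u n)].
  have clA : closed A.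
    rewrite (_ : A = (fun w => J (w + ratr q *: u n)) @^-1` [set r | J p <= r]) //.
    apply: closed_comp; last exact: closed_ge.
    move=> w _; apply: (@continuous_comp _ _ _ (fun w => w + ratr q *: u n) J); last exact: Jc.
    by apply: continuousD; [exact: id|exact: cst_continuous].
  have : A p.
    by apply: clA; apply: closure_subset Cp => w Cw; exact/pmin/shift.
  rewrite /A/= /J opprD addrA (sqnormB (v - p)) dotZr normrZ exprMn real_normK ?num_real//.
  by lra.
have invq (m : nat) : ratr (m.+1%:R^-1) = m.+1%:R^-1 :> R.
  by rewrite fmorphV rmorph_nat.
set d := dot _ _ in key *.
have kd (x : R) : (forall m : nat, x <= m.+1%:R^-1 * `|u n| ^+ 2) -> x <= 0.
  move=> h; apply: (@ler_cvg_to _ \oo _ R (cst x) (fun m : nat => m.+1%:R^-1 * `|u n| ^+ 2) x 0).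
  - exact: cvg_cst.
  - rewrite -[X in _ --> X](mul0r (`|u n| ^+ 2)); apply: cvgM; last exact: cvg_cst.
    exact: cvg_harmonic.
  - by near=> m; exact: h.
have m0 (m : nat) : 0 < m.+1%:R^-1 :> R by [].
have d1 : 2 * d <= 0.
  apply: kd => m; have := key m.+1%:R^-1; rewrite invq.
  have := m0 m; move: m.+1%:R^-1 (`|u n| ^+ 2) => a b a0 h.
  by rewrite -(ler_pM2l a0); lra.
have d2 : - (2 * d) <= 0.
  apply: kd => m; have := key (- m.+1%:R^-1); rewrite rmorphN/= invq.
  have := m0 m; move: m.+1%:R^-1 (`|u n| ^+ 2) => a b a0 h.
  by rewrite -(ler_pM2l a0); lra.
by apply/eqP; rewrite eq_le; apply/andP; split; lra.
Unshelve. all: by end_near. Qed.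

End total_sequences.

(** * Bochner integrals in separable Hilbert spaces *)

Section quantization.
Context {R : realType} {V : normedModType R}.
Context (e : nat -> V).

(** The point closest to [v] among [0, e 0, ..., e m.-1]. *)
Fixpoint nearest (m : nat) (v : V) : V :=
  if m is m'.+1 then
    if `|v - e m'| < `|v - nearest m' v| then e m' else nearest m' v
  else 0.

Lemma nearest_dist m v :
  `|v - nearest m.+1 v| = Num.min `|v - e m| `|v - nearest m v|.
Proof. by rewrite /= minEle leNgt; case: ltgtP => //= [|h]; rewrite ?h ?ltxx//. Qed.

Lemma nearest_le_norm m v : `|v - nearest m v| <= `|v|.
Proof.
elim: m => [|m IH]; first by rewrite /= subr0.
by rewrite nearest_dist ge_min IH orbT.
Qed.

Lemma nearest_le_dense m j v : (j < m)%N -> `|v - nearest m v| <= `|v - e j|.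
Proof.
elim: m => // m IH; rewrite ltnS leq_eqVlt nearest_dist ge_min.
by move=> /orP[/eqP ->|/IH ->]; rewrite ?lexx ?orbT.
Qed.

Lemma cvg_nearest v : dense_seq e -> (fun m => `|v - nearest m v|) @ \oo --> 0.
Proof.
move=> de; apply/cvgrPdist_lt => r r0; have [j jr] := de v r r0.
exists j.+1 => // m /= jm; rewrite sub0r normrN normr_id.
exact: le_lt_trans (nearest_le_dense _ jm) jr.
Qed.

Lemma nearest_finite d (T : measurableType d) (f : T -> V) m :
  finite_set (range (nearest m \o f)).
Proof.
apply: (@sub_finite_set _ _ (range (nearest m))); first by move=> _ [t _ <-]; exists (f t).
elim: m => [|m IH] /=.
  by apply: (@sub_finite_set _ _ [set 0]) => // _ [v _ <-].
apply: (@sub_finite_set _ _ (range (nearest m) `|` [set e m])).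
  by move=> _ [v _ <-]; case: ifP => _; [right|left; exists v].
by rewrite finite_setU; split.
Qed.

Lemma measurable_nearest_dist d (T : measurableType d) (f : T -> V) m :
  norm_measurable f -> measurable_fun [set: T] (fun t => `|f t - nearest m (f t)|).
Proof.
move=> mf; elim: m => [|m IH]; first by under eq_fun do rewrite /= subr0; exact: norm_measurable_norm.
under eq_fun do rewrite nearest_dist.
by apply: measurable_minr => //; exact: mf.
Qed.

Lemma measurable_nearest d (T : measurableType d) (f : T -> V) m v :
  norm_measurable f -> measurable ((nearest m \o f) @^-1` [set v]).
Proof.
have mProp (Q : Prop) : measurable [set _ : T | Q].
  have [q|q] := pselect Q.
    by rewrite (_ : [set _ | _] = setT)//; apply/seteqP; split.
  by rewrite (_ : [set _ | _] = set0)//; apply/seteqP; split.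
move=> mf; elim: m => [|m IH]; first exact: (mProp (0 = v)).
pose A := [set t | `|f t - e m| < `|f t - nearest m (f t)|].
have mA : measurable A.
  rewrite (_ : A = (fun t => `|f t - e m| < `|f t - nearest m (f t)|) @^-1` [set true]).
    rewrite -[X in measurable X]setTI.
    have mlt := measurable_fun_ltr (mf (e m)) (measurable_nearest_dist m mf).
    exact: mlt.
  by apply/seteqP; split => t.
rewrite (_ : _ @^-1` _ = (A `&` [set _ | e m = v]) `|` (~` A `&` (nearest m \o f) @^-1` [set v])).
  by apply: measurableU; apply: measurableI => //; exact: measurableC.
apply/seteqP; split => t /=; rewrite /A/=.
  by case: ifP => h; [left|right].
by case: ifP => h -[[]|[]].
Qed.

End quantization.

Section bochner_integral.
Context {R : realType} d {T : measurableType d} {V : hilbertType R}.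
Context (P : {measure set T -> \bar R}) (Pfin : (P setT < +oo)%E).
Implicit Types (f s : T -> V).

Lemma integrable_bounded (g : T -> R) (c : R) :
  measurable_fun setT g -> (forall t, `|g t| <= c) -> P.-integrable setT (EFin \o g).
Proof.
move=> mg gc; apply: (@le_integrable _ _ _ _ _ _ _ (EFin \o cst c)) => //.
- exact/measurable_EFinP.
- by move=> t _ /=; rewrite lee_fin (le_trans (gc t))// ler_norm.
apply/integrableP; split; first exact/measurable_EFinP.
rewrite (_ : (fun _ => _) = cst `|c|%:E) ?integral_cst//.
by rewrite lte_mul_pinfty// ?lee_fin.
Qed.

Lemma dot_simple_integral s : simple_function P s -> forall v,
  P.-integrable setT (fun t => (dot (s t) v)%:E) /\
  \int[P]_t dot (s t) v = dot (simple_integral P s) v.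
Proof.
move=> [fs ms Ps] v.
pose r := finmap.enum_fset (fset_set (range s)).
have sE t : dot (s t) v = \sum_(x <- r) dot x v * \1_(s @^-1` [set x]) t.
  rewrite (bigD1_seq (s t))/= ?finmap.fset_uniq//; last first.
    by rewrite in_fset_set// inE; exists t.
  rewrite indicE mem_set// mulr1 big1 ?addr0// => x xs.
  by rewrite indicE memNset ?mulr0// => /= sx; rewrite sx eqxx in xs.
have ix x : P.-integrable setT (fun t => (dot x v)%:E * (\1_(s @^-1` [set x]) t)%:E)%E.
  apply: integrableZl => //; apply: (@integrable_bounded _ 1) => [|t].
    exact/measurable_indic/ms.
  by rewrite indicE; case: (_ \in _); rewrite ?normr1 ?normr0.
have sE' : (fun t => (dot (s t) v)%:E) = (fun t => \sum_(x <- r) ((dot x v)%:E * (\1_(s @^-1` [set x]) t)%:E)%E)%E.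
  by apply/funext => t; rewrite sE -sumEFin.
split; first by rewrite sE'; exact: integrable_sum.
rewrite /Rintegral sE' integral_sum// /simple_integral fsbig_finite//= -/r.
have -> : dot (\sum_(x <- r) fine (P (s @^-1` [set x])) *: x) v =
   \sum_(x <- r) fine (P (s @^-1` [set x])) * dot x v.
  by elim: r {sE sE'} => [|x r IH]; rewrite ?big_nil ?dot0l// !big_cons dotDl dotZl IH.
rewrite -[RHS]/(fine _%:E) -sumEFin; congr fine; apply: eq_bigr => x _.
rewrite integralZl//; last first.
  apply: (@integrable_bounded _ 1) => [|t]; first exact/measurable_indic/ms.
  by rewrite indicE; case: (_ \in _); rewrite ?normr1 ?normr0.
rewrite integral_indic// setIT mulrC EFinM fineK// ge0_fin_numE//.
by apply: le_lt_trans Pfin; apply: le_measure; rewrite ?inE//; exact: ms.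
Qed.

Lemma simple_function_norm_measurable s : simple_function P s -> norm_measurable s.
Proof.
move=> [fs ms _] v.
have -> : (fun t => `|s t - v|) = (fun t => \sum_(x <- finmap.enum_fset (fset_set (range s)))
   `|x - v| * \1_(s @^-1` [set x]) t).
  apply/funext => t; rewrite (bigD1_seq (s t))/= ?finmap.fset_uniq//; last first.
    by rewrite in_fset_set// inE; exists t.
  rewrite indicE mem_set// mulr1 big1 ?addr0// => x xs.
  by rewrite indicE memNset ?mulr0// => /= sx; rewrite sx eqxx in xs.
by apply: measurable_sum => x; apply: measurable_funM.
Qed.

(** Testing against a vector turns the convergence of simple functions in mean
    into convergence of real integrals. *)
Lemma dot_is_bochner_integral f v : is_bochner_integral P f v ->
  (forall u, measurable_fun setT (fun t => dot (f t) u : R)) -> forall u,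
  P.-integrable setT (fun t => (dot (f t) u)%:E) /\
  \int[P]_t dot (f t) u = dot v u.
Proof.
move=> [s [ss is0 s0 sv]] mf u.
have ie n : P.-integrable setT (fun t => (dot (f t - s n t) u)%:E).
  apply: (@le_integrable _ _ _ _ _ _ _ (fun t => `|u|%:E * `|f t - s n t|%:E)%E) => //.
  - apply/measurable_EFinP; under eq_fun do rewrite dotBl.
    apply: measurable_funB => //.
    by have [/integrableP[/measurable_EFinP]] := dot_simple_integral (ss n) u.
  - by move=> t _; rewrite -EFinM !abse_EFin lee_fin !normrM !normr_id mulrC cauchy_schwarz.
  - exact: integrableZl.
have isn n := (dot_simple_integral (ss n) u).1.
have fE n : (fun t => (dot (f t) u)%:E) = ((fun t => (dot (f t - s n t) u)%:E) \+ (fun t => (dot (s n t) u)%:E))%E.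
  by apply/funext => t; rewrite /= -EFinD -dotDl subrK.
have iff : P.-integrable setT (fun t => (dot (f t) u)%:E).
  by rewrite (fE 0%N); exact: integrableD.
split=> //.
have lim1 : (fun n => dot (simple_integral P (s n)) u : R) @ \oo --> (dot v u : R).
  apply/cvgrPdist_le => r r0.
  have c0 : 0 < `|u| + 1 by rewrite ltr_wpDl.
  move/cvgrPdist_le : sv => /(_ (r / (`|u| + 1)) (divr_gt0 r0 c0))[N _ hN].
  exists N => // n /hN/= h; rewrite -dotBl (le_trans (cauchy_schwarz _ _))//.
  apply: (@le_trans _ _ (r / (`|u| + 1) * (`|u| + 1))).
    by apply: ler_pM => //; rewrite lerDl.
  by rewrite divfK// gt_eqF.
have lim2 : (fun n => dot (simple_integral P (s n)) u : R) @ \oo --> \int[P]_t dot (f t) u.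
  apply/cvgrPdist_le => r r0.
  have c0 : 0 < `|u| + 1 by rewrite ltr_wpDl.
  move/fine_cvgP : s0 => [_ /cvgrPdist_le /(_ (r / (`|u| + 1)) (divr_gt0 r0 c0))[N _ hN]].
  exists N => // n /hN/=; rewrite sub0r normrN => h.
  rewrite -(dot_simple_integral (ss n) u).2 -(RintegralB measurableT iff (isn n)).
  apply: le_trans (le_normr_Rintegral _ _) _ => //.
    by have := ie n; congr (integrable _ _ _); apply/funext => t /=; rewrite dotBl.
  apply: (@le_trans _ _ (\int[P]_t (`|u| * `|f t - s n t|))).
    apply: le_Rintegral => //.
    - apply/integrableP; have := ie n.
      under eq_fun do rewrite dotBl.
      move=> /integrable_abse/integrableP//.
    - exact: (integrableZl measurableT `|u| (is0 n)).
    - by move=> t _; rewrite -dotBl mulrC cauchy_schwarz.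
  rewrite (RintegralZl _ measurableT (is0 n)).
  apply: (@le_trans _ _ ((`|u| + 1) * (r / (`|u| + 1)))).
    apply: ler_pM => //; first by apply: Rintegral_ge0.
      by rewrite lerDl.
    exact: le_trans (ler_norm _) h.
  by rewrite mulrC divfK// gt_eqF.
exact: cvg_unique lim2 lim1.
Qed.

(** The regression function takes the default value of the integral at the points
    where the conditional law has no first moment; its measurability depends on
    knowing that value. *)
Lemma bochner_eq0 f : norm_measurable f ->
  (\int[P]_t `|f t|%:E = +oo)%E -> bochner P f = 0.
Proof.
move=> mf foo; apply: xgetPN => v [s [ss is0 _ _]].
suff : (\int[P]_t `|f t|%:E < +oo)%E by rewrite foo.
have : P.-integrable setT (fun t => `|f t|%:E).
  apply: (@le_integrable _ _ _ _ _ _ _ ((fun t => `|f t - s 0%N t|%:E) \+ (fun t => `|s 0%N t|%:E))%E) => //.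
  - exact/measurable_EFinP/norm_measurable_norm.
  - move=> t _ /=; rewrite lee_fin normr_id.
    rewrite [leRHS]ger0_norm ?addr_ge0//.
    by rewrite -{1}(subrK (s 0%N t) (f t)) ler_normD.
  apply: integrableD => //.
  have ms := simple_function_norm_measurable (ss 0%N).
  have [fs _ _] := ss 0%N.
  have [c sc] : exists c : R, forall t, `|s 0%N t| <= c.
    exists (\sum_(x <- finmap.enum_fset (fset_set (range (s 0%N)))) `|x|) => t.
    rewrite (bigD1_seq (s 0%N t))/= ?finmap.fset_uniq//; last first.
      by rewrite in_fset_set// inE; exists t.
    by rewrite lerDl sumr_ge0.
  apply: (@integrable_bounded _ c); first exact: norm_measurable_norm.
  by move=> t; rewrite normr_id.
by move=> /integrableP[_]; under eq_integral do rewrite abse_EFin normr_id.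
Qed.

(** Simple functions that converge in mean have integrals that form a Cauchy
    sequence: by duality, the distance of two integrals is at most the mean
    distance of the functions. *)
Lemma is_bochner_integral_exists (e : nat -> V) f : dense_seq e ->
  norm_measurable f -> (\int[P]_t `|f t|%:E < +oo)%E ->
  exists v, is_bochner_integral P f v.
Proof.
move=> de mf foo; pose s m := nearest e m \o f.
have ss m : simple_function P (s m).
  split; [exact: nearest_finite|by move=> v; exact: measurable_nearest|].
  move=> v _; apply: le_lt_trans Pfin; apply: le_measure; rewrite ?inE//.
  exact: measurable_nearest.
have inf : P.-integrable setT (fun t => `|f t|%:E).
  apply/integrableP; split; first exact/measurable_EFinP/norm_measurable_norm.
  by under eq_integral do rewrite abse_EFin normr_id.
have mfs m : measurable_fun setT (fun t => `|f t - s m t|%:E).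
  exact/measurable_EFinP/measurable_nearest_dist.
have ifs m : P.-integrable setT (fun t => `|f t - s m t|%:E).
  apply: le_integrable inf => // t _.
  by rewrite !abse_EFin lee_fin !normr_id nearest_le_norm.
have cfs : (fun n => \int[P]_t `|f t - s n t|%:E)%E @ \oo --> 0%E.
  have h0 : {ae P, forall t, setT t -> (fun m => `|f t - s m t|%:E) @ \oo --> 0%E}.
    apply: aeW => t _; apply/fine_cvgP; split; first by near=> n.
    exact: cvg_nearest.
  have h1 : {ae P, forall t, forall m, setT t -> (`| `|f t - s m t|%:E | <= `|f t|%:E)%E}.
    by apply: aeW => t m _; rewrite abse_EFin lee_fin normr_id nearest_le_norm.
  have [_ _] := @dominated_convergence _ _ _ P setT measurableT
    (fun m t => `|f t - s m t|%:E) (cst 0%E) (fun t => `|f t|%:E) mfs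
    (measurable_cst _) h0 inf h1.
  by rewrite integral0.
suff [v sv] : exists v : V, (fun n => simple_integral P (s n)) @ \oo --> v.
  by exists v; exists s; split.
apply: (@cauchy_seq_cvg R V (fun n => simple_integral P (s n))) => r r0.
have r20 : 0 < r / 3 by rewrite divr_gt0.
move/fine_cvgP : cfs => [_ /cvgrPdist_le /(_ (r / 3) r20)[N _ hN]].
exists N => m n Nm Nn; set x := _ - _.
suff : `|x| <= r / 3 + r / 3 by move=> h; apply: le_lt_trans h _; lra.
apply: norm_le_dot => [|u]; first by lra.
have [im Im] := dot_simple_integral (ss m) u.
have [jn In] := dot_simple_integral (ss n) u.
have iD : P.-integrable setT (EFin \o (fun t => `|f t - s m t| + `|f t - s n t|)).
  exact: (integrableD measurableT (ifs m) (ifs n)).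
rewrite /x dotBl -Im -In -(RintegralB measurableT im jn).
apply: (@le_trans _ _ (\int[P]_t (`|u| * (`|f t - s m t| + `|f t - s n t|)))).
  apply: le_Rintegral => //.
  - exact: (integrableB measurableT im jn).
  - exact: (integrableZl measurableT `|u| iD).
  - move=> t _; rewrite -dotBl (le_trans (dot_le _ _))// mulrC ler_wpM2l//.
    rewrite -(subrKA (f t)) (le_trans (ler_normD _ _))//.
    by rewrite (distrC (s m t)).
rewrite (RintegralZl _ measurableT iD) mulrC ler_wpM2r//.
rewrite (RintegralD measurableT (ifs m) (ifs n)) lerD//.
- by have := hN m Nm; rewrite /= sub0r normrN; apply/le_trans/ler_norm.
- by have := hN n Nn; rewrite /= sub0r normrN; apply/le_trans/ler_norm.
Unshelve. all: by end_near. Qed.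

Lemma dot_bochner (e : nat -> V) f : dense_seq e ->
  norm_measurable f -> (\int[P]_t `|f t|%:E < +oo)%E -> forall u,
  P.-integrable setT (fun t => (dot (f t) u)%:E) /\
  \int[P]_t dot (f t) u = dot (bochner P f) u.
Proof.
move=> de mf foo; apply: dot_is_bochner_integral.
  exact: xgetPex (is_bochner_integral_exists de mf foo).
move=> u; apply: norm_measurable_dot de mf _; exact: norm_measurable_cst.
Qed.

End bochner_integral.

Lemma probability_ltoo (R : realType) d (T : measurableType d) (P : probability T R) :
  (P setT < +oo)%E.
Proof. by rewrite probability_setT ltry. Qed.

Lemma integral_probability_cst (R : realType) d (Om : measurableType d)
  (P : probability Om R) (c : R) : (\int[P]_w c%:E = c%:E)%E.
Proof.
rewrite -[X in _ = X]mule1 -[in RHS](@probability_setT _ _ _ P).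
exact: (integral_cst P measurableT c%:E).
Qed.

Lemma Rintegral_probability_cst (R : realType) d (Om : measurableType d)
  (P : probability Om R) (c : R) : \int[P]_w c = c.
Proof.
rewrite Rintegral_cst//; have -> : fine (P setT) = 1 by rewrite probability_setT.
by rewrite mulr1.
Qed.


(** * Disintegration *)

Section giry_of_measure.
Context d (S : measurableType d) (R : realType).
Context (mu : {measure set S -> \bar R}) (mu1 : mu setT = 1%E).

Let m := (mu : set S -> \bar R).

HB.instance Definition _ := Measure.on m.

Let m_le1 : (m setT <= 1)%E.
Proof. by rewrite /m mu1. Qed.

HB.instance Definition _ := Measure_isSubProbability.Build _ _ _ m m_le1.

(** A measure of mass one as a point of the Giry monad, whose map and bind are
    the push-forward and the mixture of laws. *)
Definition giry_of_measure : giry S R := m.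

End giry_of_measure.

Section kernel_of_family.
Context d d' (Z : measurableType d) (S : measurableType d') (R : realType).
Context (kappa : Z -> {measure set S -> \bar R})
  (mkappa : forall B, measurable B -> measurable_fun setT (kappa ^~ B))
  (kappa1 : forall z, kappa z setT = 1%E).

Let k := kappa.

HB.instance Definition _ := isKernel.Build _ _ Z S R k mkappa.
HB.instance Definition _ := Kernel_isProbability.Build _ _ Z S R k kappa1.

Definition kernel_of_family : R.-pker Z ~> S := k.

End kernel_of_family.

Section disintegration.
Context {R : realType} d d1 d2 (Om : measurableType d) (Z : measurableType d1)
  (S : measurableType d2).
Context (P : probability Om R) (W : Om -> Z) (b : Om -> S)
  (kappa : Z -> {measure set S -> \bar R}) (Pi : set (set Z)).
Context (mW : measurable_fun setT W) (mb : measurable_fun setT b)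
  (mkappa : forall B, measurable B -> measurable_fun setT (kappa ^~ B))
  (kappa1 : forall z, kappa z setT = 1%E)
  (Pi_gen : measurable = <<s Pi >>) (PiI : setI_closed Pi) (PiT : Pi setT)
  (kappaP : forall E B, Pi E -> measurable B ->
    P (W @^-1` E `&` b @^-1` B) = (\int[P]_(w in W @^-1` E) kappa (W w) B)%E).

Let kappa_giry z : giry S R := giry_of_measure (kappa1 z).

Let pairW w (s : S) : Z * S := (W w, s).

Let measurable_pairW w : measurable_fun setT (pairW w).
Proof. exact: measurable_fun_pair. Qed.

Let graph_kernel w : giry (Z * S)%type R :=
  giry_map (@measurable_pairW w) (kappa_giry (W w)).

Let kappa_kernel : R.-pker Z ~> S := kernel_of_family mkappa kappa1.

Let measurable_graph_kernel : measurable_fun setT graph_kernel.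
Proof.
apply: measurable_giry_codensity => // B mB.
rewrite (_ : (fun w => _) = (fun z => kappa_kernel z (xsection B z)) \o W).
  apply: measurableT_comp => //.
  by apply: measurable_fun_xsection_finite_kernel; rewrite inE.
by apply/funext => w /=; rewrite xsectionE.
Qed.

Let joint w : Z * S := (W w, b w).

Let measurable_joint : measurable_fun setT joint.
Proof. exact: measurable_fun_pair. Qed.

Let PS : giry Om R := P.

Let G := [set E `*` B | E in Pi & B in @measurable _ S].

Let measurable_genG : @measurable _ (Z * S)%type = <<s G >>.
Proof.
apply/seteqP; split; last first.
  apply: smallest_sub; first exact: sigma_algebra_measurable.
  move=> _ [E PE [B mB <-]]; apply: measurableX => //.
  by rewrite Pi_gen; exact: sub_sigma_algebra.
rewrite measurable_prod_measurableType.
apply: smallest_sub; first exact: smallest_sigma_algebra.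
move=> _ [E mE [B mB <-]].
have -> : E `*` B = (E `*` setT) `&` (setT `*` B) by rewrite -setXI setIT setTI.
apply: (@measurableI _ (g_sigma_algebraType G)).
  move: mE; rewrite Pi_gen; move: E.
  apply: (@smallest_sub _ _ _ [set E | <<s G >> (E `*` setT)]).
    split => /=.
    - by rewrite set0X; exact: (@measurable0 _ (g_sigma_algebraType G)).
    - move=> E GE; rewrite setTD.
      have -> : ~` E `*` setT = ~` (E `*` (setT : set S)).
        by apply/seteqP; split => -[x y] /=; tauto.
      exact: (@measurableC _ (g_sigma_algebraType G)).
    - move=> F GF; rewrite setX_bigcupl.
      exact: (@bigcupT_measurable _ (g_sigma_algebraType G)).
  by move=> E PE; apply: sub_sigma_algebra; exists E => //; exists setT.
by apply: sub_sigma_algebra; exists setT => //; exists B.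
Qed.

Let joint_law (A : set (Z * S)) : measurable A ->
  giry_map measurable_joint PS A = giry_bind PS measurable_graph_kernel A.
Proof.
apply: (measure_unique G (fun=> setT)) => //.
- move=> _ _ [E PE [B mB <-]] [E' PE' [B' mB' <-]].
  exists (E `&` E'); first exact: PiI.
  by exists (B `&` B'); [exact: measurableI|rewrite setXI].
- by move=> _; exists setT => //; exists setT => //; rewrite setXTT.
- exact: bigcup_const.
- move=> _ [E PE [B mB <-]].
  have mE : measurable E by rewrite Pi_gen; exact: sub_sigma_algebra.
  have mWE : measurable (W @^-1` E) by rewrite -[X in measurable X]setTI; exact: mW.
  have mEB := measurableX mE mB.
  transitivity (\int[P]_(w in W @^-1` E) kappa (W w) B)%E; first exact: kappaP.
  transitivity (giry_int (giry_bind PS measurable_graph_kernel) (fun x => (\1_(E `*` B) x)%:E)); last first.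
    by rewrite /giry_int integral_indic// setIT.
  rewrite giry_int_bind//; last exact/measurable_EFinP/measurable_indic.
  rewrite /giry_int integral_mkcond; apply: eq_integral => w _.
  rewrite integral_indic// setIT patchE.
  rewrite /graph_kernel/= /giry_map/= /pushforward/=.
  case: ifPn => wE.
    congr (kappa _ _); apply/seteqP; split => s //=; last by case.
    by split=> //; move: wE; rewrite inE.
  rewrite [X in kappa _ X](_ : _ = set0) ?measure0//.
  by apply/seteqP; split => s //= [] /mem_set; rewrite notin_setE/= in wE => /set_mem.
- move=> _; exact: (le_lt_trans (@sprobability_setT _ _ _ (giry_map measurable_joint PS)) (ltry _)).
Qed.

(** The two sides agree on the rectangles with a side in [Pi], hence define the
    same measure on the product space. *)
Lemma integral_disintegration (F : Z * S -> \bar R) :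
  measurable_fun setT F -> (forall x, (0 <= F x)%E) ->
  (\int[P]_w F (W w, b w) = \int[P]_w \int[kappa (W w)]_s F (W w, s))%E.
Proof.
move=> mF F0.
transitivity (giry_int (giry_map measurable_joint PS) F).
  by rewrite giry_int_map.
transitivity (giry_int (giry_bind PS measurable_graph_kernel) F).
  by apply: eq_measure_integral => A mA _; exact: joint_law.
rewrite giry_int_bind//; apply: eq_integral => w _.
by rewrite giry_int_map.
Qed.

End disintegration.

(** * Baire sets and the weak topology on measures *)

Section baire.
Context (R : realType) (T : ptopologicalType).

(** These sets generate the Baire sigma-algebra. *)
Definition cozero : set (set T) :=
  [set U | exists g : T -> R, [/\ continuous g, forall t, 0 <= g t & U = [set t | 0 < g t]]].

Lemma cozeroI : setI_closed cozero.
Proof.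
move=> _ _ [g [cg g0 ->]] [f [cf f0 ->]]; exists (fun t => g t * f t); split.
- by move=> t; apply: continuousM; [exact: cg|exact: cf].
- by move=> t; rewrite mulr_ge0.
apply/seteqP; split => t /=; first by move=> [gt ft]; rewrite mulr_gt0.
rewrite !lt0r => /andP[]; rewrite mulf_eq0 negb_or => /andP[-> ->] _.
by rewrite g0 f0.
Qed.

Lemma cozeroT : cozero setT.
Proof.
exists (fun=> 1); split => //; first exact: cst_continuous.
by apply/seteqP; split => t //= _; exact: ltr01.
Qed.

Lemma cozero_open (U : set T) : cozero U -> open U.
Proof.
move=> [g [cg _ ->]]; rewrite (_ : [set _ | _] = g @^-1` [set x | 0 < x])//.
by apply: open_comp; [move=> t _; exact: cg|exact: open_gt].
Qed.

Lemma baire_borel (B : set T) : <<s cozero >> B -> (@measurable _ (borel T)) B.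
Proof.
apply: smallest_sub; first exact: smallest_sigma_algebra.
by move=> U /cozero_open oU; exact: sub_sigma_algebra.
Qed.

Lemma integrals_measurable (h : T -> R) : continuous h -> bounded_fun h ->
  measurable_fun [set: borel (measures R T)]
    (fun x : measures R T => \int[x]_u h u).
Proof.
move=> ch bh; pose hh : bounded_continuous R T := exist _ h (conj ch bh).
apply: continuous_borel_measurable => x.
rewrite (_ : (fun x => _) = (proj hh) \o (@integrals R T)) //.
apply: continuous_comp; first exact: initial_continuous.
exact: (@proj_continuous {classic (bounded_continuous R T)} (fun=> R) hh).
Qed.

(** The indicator of a cozero set is the increasing limit of the bounded
    continuous functions [min 1 (n g)]. *)
Lemma evaluation_cozero_measurable (U : set T) : cozero U ->
  measurable_fun [set: borel (measures R T)] (evaluation U).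
Proof.
move=> cU; have [g [cg g0 UE]] := cU.
pose h (n : nat) t : R := Num.min 1 (n%:R * g t).
have ch n : continuous (h n).
  move=> t; apply: (@continuous_min R T (fun=> 1) (fun t => n%:R * g t)).
    exact: cst_continuous.
  by apply: continuousM; [exact: cst_continuous|exact: cg].
have h0 n t : 0 <= h n t by rewrite /h le_min ler01 mulr_ge0.
have h1 n t : h n t <= 1 by rewrite /h ge_min lexx.
have bh n : bounded_fun (h n).
  exists 1; split => // M M1 t _ /=.
  by rewrite ger0_norm// (le_trans (h1 n t))// ltW.
have mh n : measurable_fun [set: borel T] (h n) by exact: continuous_borel_measurable.
apply: (emeasurable_fun_cvg (fun n (x : borel (measures R T)) => (\int[(x : probability (borel T) R)]_u (h n u))%:E)).
  by move=> n; apply/measurable_EFinP; exact: integrals_measurable.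
move=> x _.
have ih n : (x : probability (borel T) R).-integrable setT (EFin \o h n).
  apply: (integrable_bounded (probability_ltoo _) (mh n) (c := 1)).
  by move=> t; rewrite ger0_norm.
rewrite (_ : (fun n => _) = (fun n => \int[(x : probability (borel T) R)]_u (h n u)%:E)%E); last first.
  by apply/funext => n; rewrite /Rintegral fineK//; exact: (integrable_fin_num measurableT (ih n)).
have mU : measurable (U : set (borel T)) by apply: sub_sigma_algebra; exact: cozero_open.
rewrite [X in _ --> X](_ : _ = \int[(x : probability (borel T) R)]_u (\1_U u)%:E)%E; last first.
  by rewrite integral_indic// setIT.
rewrite [X in _ --> X](_ : _ = \int[(x : probability (borel T) R)]_u limn (fun n => (h n u)%:E))%E.
  apply: cvg_monotone_convergence => //.
  - by move=> n; exact/measurable_EFinP.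
  - by move=> n t _; rewrite lee_fin.
  - move=> t _ m n mn; rewrite lee_fin /h le_min !ge_min lexx/=.
    by apply/orP; right; rewrite ler_wpM2r// ler_nat.
apply: eq_integral => t _; apply/esym/cvg_lim => //.
apply: cvg_EFin; first by near=> n.
rewrite indicE; have [tU|tU] := boolP (t \in U).
  have gt : 0 < g t by move: tU; rewrite inE UE.
  apply: cvg_near_cst; near=> n; rewrite /h; apply/eqP.
  rewrite eq_le ge_min lexx le_min lexx/= -ler_pdivrMr//.
  by near: n; exact: nbhs_infty_ger.
have gt : g t = 0.
  by apply/eqP; rewrite eq_le g0 andbT leNgt; apply: contra tU => gt; rewrite inE UE.
by apply: cvg_near_cst; near=> n; rewrite /h gt /= mulr0 min_r ?ler01.
Unshelve. all: by end_near. Qed.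

(** Dynkin induction from the cozero sets, which are stable under intersection. *)
Lemma evaluation_baire_measurable (B : set T) : <<s cozero >> B ->
  measurable_fun [set: borel (measures R T)] (evaluation B).
Proof.
pose D := g_sigma_algebraType cozero.
apply: (@dynkin_induction _ D cozero
  (fun B => measurable_fun [set: borel (measures R T)] (evaluation B))) => //.
- exact: cozeroI.
- exact: (evaluation_cozero_measurable cozeroT).
- by move=> U; exact: evaluation_cozero_measurable.
- move=> S mS mevS.
  rewrite (_ : evaluation _ = (fun x : measures R T => 1 - evaluation S x)%E).
    by apply: emeasurable_funB => //; exact: measurable_cst.
  by apply/funext => x; rewrite /evaluation probability_setC//; exact: baire_borel.
- move=> F mF tF mevF.
  rewrite (_ : evaluation _ = (fun x : measures R T => \sum_(0 <= n <oo) evaluation (F n) x)%E).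
    by apply: ge0_emeasurable_sum => // n x _ _; exact: measure_ge0.
  apply/funext => x; apply/esym/cvg_lim => //.
  apply: measure_semi_sigma_additive => //; first by move=> n; exact: (baire_borel (mF n)).
  by apply: bigcupT_measurable => n; exact: (baire_borel (mF n)).
Qed.

End baire.

(** * Kernel mean embeddings *)

Section mean_embedding.
Context (R : realType) (T : ptopologicalType) (sepT : separable T)
  (k : T -> T -> R) (kc : continuous (fun p : T * T => k p.1 p.2))
  (Bk : R) (kB : forall u, k u u <= Bk) (H : rkhs k).

Local Notation phi := (rkhs_section H).

Lemma dot_section u v : dot (phi u) (phi v) = k v u :> R.
Proof. by rewrite rkhs_reproducing rkhs_sectionE. Qed.

Lemma kernel_bound_ge0 : 0 <= Bk.
Proof. by apply: le_trans (kB point); rewrite -dot_section dot_norm sqr_ge0. Qed.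

Lemma norm_section u : `|phi u| <= Num.sqrt Bk.
Proof.
rewrite -(@ler_pXn2r _ 2)// ?nnegrE ?sqrtr_ge0// sqr_sqrtr ?kernel_bound_ge0//.
by rewrite -dot_norm dot_section.
Qed.

(** [|phi u - phi v|^2 = k u u - 2 k u v + k v v]. *)
Lemma section_continuous : continuous phi.
Proof.
move=> u; apply/cvgrPdist_lt => e e0.
pose g v := k u u - 2 * k v u + k v v.
have gu : g u = 0 by rewrite /g; ring.
have pair_cvg (a : T -> T) (b : T -> T) : {for u, continuous a} -> {for u, continuous b} ->
    {for u, continuous (fun v => k (a v) (b v))}.
  move=> ca cb; apply: (@continuous_comp _ _ _ (fun v => (a v, b v)) (fun p => k p.1 p.2)).
    exact: cvg_pair.
  exact: kc.
have gc : {for u, continuous g}.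
  apply: continuousD; last exact: pair_cvg.
  apply: continuousB; first exact: cst_continuous.
  apply: continuousM; first exact: cst_continuous.
  by apply: pair_cvg => //; exact: cst_continuous.
have e20 : g u < e ^+ 2 by rewrite gu exprn_gt0.
have ge : \forall v \near u, g v < e ^+ 2 by apply: (cvgr_lt (g u)).
near=> v; have : g v < e ^+ 2 by near: v.
rewrite /g => h.
rewrite -(@ltr_pXn2r _ 2)// ?nnegrE ?(ltW e0)//.
by rewrite sqnormB -!dot_norm !dot_section.
Unshelve. all: by end_near. Qed.

Lemma dot_section_continuous (f : H) : continuous (fun u => dot (phi u) f : R).
Proof.
move=> s; apply/cvgrPdist_lt => e e0.
have c0 : 0 < `|f| + 1 by rewrite ltr_wpDl.
have cs : phi t @[t --> s] --> phi s := @section_continuous s.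
move/cvgrPdist_lt : cs => /(_ _ (divr_gt0 e0 c0)) cs.
near=> t; rewrite -dotBl; apply: le_lt_trans (cauchy_schwarz _ _) _.
apply: (@le_lt_trans _ _ (`|phi s - phi t| * (`|f| + 1))).
  by rewrite ler_wpM2l// lerDl.
by rewrite -ltr_pdivlMr//; near: t.
Unshelve. all: by end_near. Qed.

(** The sections at the points of a dense sequence are total: an element
    orthogonal to all of them is a continuous function that vanishes on a dense
    set. *)
Lemma rkhs_dense_seq : exists e : nat -> H, dense_seq e.
Proof.
have [D cD dD] := sepT.
have [D0|[f]] := pfcard_geP cD.
  by have [x []] := dD setT (ex_intro _ point I) openT; rewrite D0.
apply: (@total_dense_seq _ _ (phi \o f)) => v v0.
have vphi t : dot v (phi t) = 0.
  have cv : continuous (fun t => dot v (phi t) : R).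
    rewrite (_ : (fun t => _) = (fun t => dot (phi t) v : R)).
      exact: dot_section_continuous.
    by apply/funext => s; rewrite dotC.
  apply: contrapT => vt.
  have oO : open [set t | dot v (phi t) != 0 :> R].
    rewrite (_ : [set _ | _] = (fun t => dot v (phi t)) @^-1` [set x : R | x != 0])//.
    by apply: open_comp => [s _|]; [exact: cv|exact: open_neq].
  have [||t' [/= t'0 Dt']] := dD [set t | dot v (phi t) != 0 :> R] => //.
    by exists t; exact/eqP.
  by have [j _ jt] := 'surj_f Dt'; rewrite -jt v0 eqxx in t'0.
apply: (@rkhs_inj _ _ _ H); apply/funext => t.
by rewrite -!rkhs_reproducing vphi dot0l.
Qed.

Lemma norm_measurable_section : @norm_measurable R _ (borel T) H phi.
Proof. exact: (continuous_norm_measurable section_continuous). Qed.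

Lemma dot_mean_embedding (x : probability (borel T) R) (f : H) :
  dot (mean_embedding H x) f = \int[x]_u dot (phi u) f.
Proof.
have [e de] := rkhs_dense_seq.
suff foo : (\int[x]_t `|phi t|%:E < +oo)%E.
  by have [_ ->] := dot_bochner (probability_ltoo x) de norm_measurable_section foo f.
have := @integrable_bounded R _ (borel T) x (probability_ltoo x) (fun u => `|phi u|) (Num.sqrt Bk).
case/(_ _ _)/integrableP => //.
- exact: norm_measurable_norm norm_measurable_section.
- by move=> u; rewrite normr_id norm_section.
by move=> _; under eq_integral do rewrite /= normr_id.
Qed.

Lemma integrable_dot_section (x : probability (borel T) R) (f : H) :
  x.-integrable setT (EFin \o (fun u => dot (phi u) f)).
Proof.
have [e de] := rkhs_dense_seq.
apply: (integrable_bounded (probability_ltoo _) (c := Num.sqrt Bk * `|f|)).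
  apply: (norm_measurable_dot de norm_measurable_section).
  exact: norm_measurable_cst.
by move=> u; rewrite (le_trans (cauchy_schwarz _ _))// ler_wpM2r// norm_section.
Qed.

Lemma norm_mean_embedding (x : probability (borel T) R) :
  `|mean_embedding H x| <= Num.sqrt Bk.
Proof.
apply: norm_le_dot; first exact: sqrtr_ge0.
move=> f; rewrite dot_mean_embedding.
have -> : Num.sqrt Bk * `|f| = \int[x]_u (Num.sqrt Bk * `|f|).
  by rewrite Rintegral_probability_cst.
apply: le_Rintegral => //; first exact: integrable_dot_section.
  apply: (integrable_bounded (probability_ltoo _) (c := Num.sqrt Bk * `|f|)) => // u.
  by rewrite ger0_norm// mulr_ge0// sqrtr_ge0.
by move=> u _; rewrite (le_trans (dot_le _ _))// ler_wpM2r// norm_section.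
Qed.

Lemma norm_val_embeddings (a : embeddings H) : `|(val a : H)| <= Num.sqrt Bk.
Proof. by case: a => a /= /set_mem[x _ <-]; exact: norm_mean_embedding. Qed.

(** Weak convergence of measures gives weak convergence of the mean embeddings,
    which suffices for measurability since [H] is separable. *)
Lemma norm_measurable_mean_embedding :
  @norm_measurable R _ (borel (measures R T)) H (@mean_embedding R T k H).
Proof.
have [e de] := rkhs_dense_seq.
apply: (weakly_measurable_norm_measurable de) => f.
rewrite (_ : (fun x => _) = (fun x : measures R T => \int[x]_u dot (phi u) f)); last first.
  by apply/funext => x; exact: dot_mean_embedding.
apply: integrals_measurable.
  exact: dot_section_continuous.
exists (Num.sqrt Bk * `|f|); split => // M M1 t _ /=.
rewrite (le_trans (cauchy_schwarz _ _))// (le_trans _ (ltW M1))//.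
by rewrite ler_wpM2r// norm_section.
Qed.

Lemma norm_measurable_val :
  @norm_measurable R _ (borel (embeddings H)) H (fun a => val (a : embeddings H)).
Proof.
exact: (@continuous_norm_measurable R _ H (fun a : embeddings H => val a)
  (@initial_continuous (embeddings H) H val)).
Qed.

Lemma embeddings_measurable_fun d (Om : measurableType d) (F : Om -> borel (embeddings H)) :
  norm_measurable (fun w => val (F w : embeddings H) : H) -> measurable_fun setT F.
Proof.
have [e de] := rkhs_dense_seq.
move=> mF; apply: borel_measurable_fun => U [V oV <-].
exact: (norm_measurable_preimage_open de mF oV).
Qed.

Lemma Rintegral_empirical N (s : nat -> T) (g : T -> R) (c : R) :
  (0 < N)%N -> measurable_fun [set: borel T] g -> (forall t, `|g t| <= c) ->
  \int[empirical R N s]_u g u = N%:R^-1 * \sum_(n < N) g (s n).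
Proof.
move=> N0 mg gc.
(* adding [c] makes the integrand nonnegative, as integration against a sum of
   measures requires *)
have gc0 t : 0 <= g t + c by have := gc t; have := ler_norm (- g t); rewrite normrN; lra.
have N0r : (N%:R : R) != 0 by rewrite pnatr_eq0 -lt0n.
have mgc : measurable_fun [set: borel T] (fun t => (g t + c)%:E).
  by apply/measurable_EFinP; apply: measurable_funD.
have ev : msum (fun n => \d_(s n : borel T)) N setT = (N%:R : R)%:E.
  rewrite /msum (eq_bigr (fun=> (1 : R)%:E)); last by move=> i _; exact: diracT.
  by rewrite sumEFin sumr_const card_ord.
have key : (\int[empirical R N s]_u (g u + c)%:E = (N%:R^-1 * \sum_(n < N) (g (s n) + c))%:E)%E.
  have Nn : 0 <= (N%:R : R)^-1 by rewrite invr_ge0.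
  transitivity (\int[mscale (NngNum Nn) (msum (fun n => \d_(s n : borel T)) N)]_u (g u + c)%:E)%E.
    apply: eq_measure_integral => A mA _.
    pose m : set (borel T) -> \bar R := msum (fun n => \d_(s n : borel T)) N.
    transitivity (if (m setT == 0%E) || (m setT == +oo%E)
        then (\d_(point : borel T) A) else m A * (fine (m setT))^-1%:E)%E.
      by change (mnormalize m (\d_(point : borel T)) A = (if (m setT == 0%E) || (m setT == +oo%E)
        then (\d_(point : borel T) A) else m A * (fine (m setT))^-1%:E)%E); rewrite /= /mnormalize; case: ifP.
    by rewrite /m ev eqe (negbTE N0r)/= muleC.
  rewrite ge0_integral_mscale//; last by move=> t _; rewrite lee_fin.
  rewrite ge0_integral_measure_sum//; last by move=> t _; rewrite lee_fin.
  rewrite EFinM; congr (_ * _)%E.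
  rewrite -sumEFin; apply: eq_bigr => n _.
  by rewrite integral_dirac// diracT mul1e.
have ig : (empirical R N s).-integrable setT (EFin \o g).
  exact: (integrable_bounded (probability_ltoo _) mg gc).
have ic : (empirical R N s).-integrable setT (EFin \o (fun=> c)).
  exact: (integrable_bounded (probability_ltoo _) (measurable_cst c) (c := `|c|)).
have := RintegralD measurableT ig ic.
have -> : \int[empirical R N s]_u (g u + c) = N%:R^-1 * \sum_(n < N) (g (s n) + c).
  by rewrite /Rintegral key.
rewrite Rintegral_probability_cst.
rewrite big_split/= sumr_const card_ord mulrDr -[c *+ N]mulr_natl mulKf//.
by move/addIr.
Qed.

(** Mean embeddings are tested against the elements of [H], which reduces the
    claim to real integrals. *)
Lemma mean_embedding_empirical N (s : nat -> T) : (0 < N)%N ->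
  mean_embedding H (empirical R N s) = N%:R^-1 *: \sum_(n < N) phi (s n).
Proof.
move=> N0; apply: dot_inj => f; have [e de] := rkhs_dense_seq.
rewrite dot_mean_embedding (@Rintegral_empirical _ _ _ (Num.sqrt Bk * `|f|) N0)//.
- by rewrite dotZl (@dot_suml _ _ N (fun n => phi (s n))).
- apply: (norm_measurable_dot de norm_measurable_section).
  exact: norm_measurable_cst.
- by move=> u; rewrite (le_trans (cauchy_schwarz _ _))// ler_wpM2r// norm_section.
Qed.

End mean_embedding.

(** * Vector-valued reproducing kernel Hilbert spaces *)

Section vrkhs.
Context (R : realType) (X : Type) (Y V : hilbertType R) (iota : X -> V)
  (K : X -> X -> {linear Y -> Y}) (Kc : forall a b, continuous (K a b))
  (HK : vrkhs K) (L h c : R) (h0 : 0 < h) (L0 : 0 < L)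
  (iotac : forall a, `|iota a| <= c)
  (KL : forall a b, opnorm (fun y => vrkhs_section HK a y - vrkhs_section HK b y)
    <= L * `|iota a - iota b| `^ h).

Implicit Types (f g : HK) (a b : X) (y : Y).

Lemma vrkhs_funD f g a : vrkhs_fun (f + g) a = vrkhs_fun f a + vrkhs_fun g a.
Proof. by rewrite -[f]scale1r vrkhs_linear !scale1r. Qed.

Lemma vrkhs_fun0 a : vrkhs_fun (0 : HK) a = 0.
Proof. by apply: (addrI (vrkhs_fun (0 : HK) a)); rewrite -vrkhs_funD !addr0. Qed.

Lemma vrkhs_funZ (r : R) f a : vrkhs_fun (r *: f) a = r *: vrkhs_fun f a.
Proof. by rewrite -[r *: f]addr0 vrkhs_linear vrkhs_fun0 addr0. Qed.

Lemma vrkhs_funB f g a : vrkhs_fun (f - g) a = vrkhs_fun f a - vrkhs_fun g a.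
Proof. by rewrite vrkhs_funD -scaleN1r vrkhs_funZ scaleN1r. Qed.

Lemma vrkhs_sectionZ a (r : R) y :
  vrkhs_section HK a (r *: y) = r *: vrkhs_section HK a y.
Proof.
apply: (@vrkhs_inj _ _ _ _ HK); apply/funext => b.
by rewrite vrkhs_funZ !vrkhs_sectionE linearZ.
Qed.

(** [|K_a y|^2 = <K(a, a) y, y>] and [K(a, a)] is a bounded operator. *)
Lemma vrkhs_section_bounded a : exists2 M : R, 0 <= M &
  forall y, `|vrkhs_section HK a y| <= M * `|y|.
Proof.
have /linear_bounded_continuous/linear_boundedP hb := @Kc a a.
have [r r0 Kr] := pinfty_ex_gt0 hb.
exists (Num.sqrt r) => [|y]; first exact: sqrtr_ge0.
rewrite -(@ler_pXn2r _ 2)// ?nnegrE ?mulr_ge0 ?sqrtr_ge0// exprMn sqr_sqrtr ?(ltW r0)//.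
rewrite -dot_norm vrkhs_reproducing vrkhs_sectionE (le_trans (dot_le _ _))//.
by rewrite expr2 mulrA ler_wpM2r.
Qed.

(** A supremum is an upper bound only of a bounded set; here the set is bounded
    because the operators [K_a] are. *)
Lemma vrkhs_section_holder a b y :
  `|vrkhs_section HK a y - vrkhs_section HK b y| <=
  L * `|iota a - iota b| `^ h * `|y|.
Proof.
have [->|y0] := eqVneq y 0.
  have z d : vrkhs_section HK d 0 = 0 by rewrite -(scale0r 0) vrkhs_sectionZ scale0r.
  by rewrite !z subrr !normr0 mulr0.
have ny : 0 < `|y| by rewrite normr_gt0.
rewrite -ler_pdivrMr//; apply: le_trans (KL a b).
have [M M0 aM] := vrkhs_section_bounded a; have [N N0 bN] := vrkhs_section_bounded b.
rewrite /opnorm; apply: sup_ubound.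
  exists (M + N) => _ [v /= v1 <-].
  rewrite (le_trans (ler_normB _ _))// lerD//.
    by rewrite (le_trans (aM _))// -[leRHS]mulr1 ler_wpM2l.
  by rewrite (le_trans (bN _))// -[leRHS]mulr1 ler_wpM2l.
exists (`|y|^-1 *: y) => /=.
  by rewrite normrZ normfV normr_id mulVf// gt_eqF.
by rewrite !vrkhs_sectionZ -scalerBr normrZ normfV normr_id mulrC.
Qed.

Lemma vrkhs_fun_holder f a b :
  `|vrkhs_fun f a - vrkhs_fun f b| <= L * `|iota a - iota b| `^ h * `|f|.
Proof.
apply: norm_le_dot => [|y]; first by rewrite !mulr_ge0 ?powR_ge0// ltW.
rewrite dotBl -!vrkhs_reproducing -dotBr (le_trans (dot_le _ _))// mulrC.
by rewrite mulrAC ler_wpM2r// vrkhs_section_holder.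
Qed.

(** Hoelder continuity bounds the evaluations uniformly over the bounded set
    [range iota], starting from any single one of them. *)
Lemma vrkhs_fun_bounded (a0 : X) : exists2 B : R, 0 <= B &
  forall f a, `|vrkhs_fun f a| <= B * `|f|.
Proof.
have [M M0 aM] := vrkhs_section_bounded a0.
have c0 : 0 <= c by apply: le_trans (iotac a0).
exists (M + L * (c + c) `^ h) => [|f a].
  by rewrite addr_ge0// mulr_ge0 ?powR_ge0// ltW.
rewrite -(subrK (vrkhs_fun f a0) (vrkhs_fun f a)) (le_trans (ler_normD _ _))//.
rewrite addrC mulrDl lerD//.
  apply: norm_le_dot => [|y]; first by rewrite mulr_ge0.
  rewrite -vrkhs_reproducing (le_trans (dot_le _ _))// mulrAC mulrC.
  by rewrite ler_wpM2r.
apply: le_trans (vrkhs_fun_holder _ _ _) _; rewrite ler_wpM2r// ler_wpM2l ?(ltW L0)//.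
apply: ge0_ler_powR; rewrite ?nnegrE ?(ltW h0) ?addr_ge0//.
by rewrite (le_trans (ler_normB _ _))// lerD.
Qed.

End vrkhs.

Lemma powR_cvg0 (R : realType) (h e : R) : 0 < h -> 0 < e ->
  exists2 s : R, 0 < s & forall t, 0 <= t -> t < s -> t `^ h < e.
Proof.
move=> h0 e0; exists (e `^ h^-1) => [|t t0 ts]; first exact: powR_gt0.
have -> : e = (e `^ h^-1) `^ h by rewrite -powRrM mulVf ?gt_eqF// powRr1// ltW.
by apply: gt0_ltr_powR; rewrite ?nnegrE// powR_ge0.
Qed.

(** * Regularized least squares *)

Section ridge.
Context (R : realType) (X : ptopologicalType) (Y : hilbertType R)
  (K : X -> X -> {linear Y -> Y}) (HK : vrkhs K)
  (B : R) (B0 : 0 <= B) (fB : forall (f : HK) a, `|vrkhs_fun f a| <= B * `|f|)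
  (lambda : R) (lambda0 : 0 < lambda) (l : nat).

Implicit Types (f g : HK) (a b : nat -> X) (y z : nat -> Y).

Definition loss f (p : X * Y) : R := `|vrkhs_fun f p.1 - p.2| ^+ 2.

Lemma loss_ge0 f p : 0 <= loss f p.
Proof. exact: sqr_ge0. Qed.

Lemma sqr_dist (u v : R) : `|u ^+ 2 - v ^+ 2| <= `|u - v| * (`|u| + `|v|).
Proof. by rewrite subr_sqr normrM ler_wpM2l// ler_normD. Qed.

Lemma sqnorm_dist (u v : Y) : `| `|u| ^+ 2 - `|v| ^+ 2| <= `|u - v| * (`|u| + `|v|).
Proof.
rewrite (le_trans (sqr_dist _ _))// !normr_id ler_wpM2r ?addr_ge0//.
exact: ler_dist_dist.
Qed.

Lemma norm_residual f p (r c : R) : `|f| <= r -> `|p.2| <= c ->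
  `|vrkhs_fun f p.1 - p.2| <= B * r + c.
Proof.
move=> fr pc; rewrite (le_trans (ler_normB _ _))// lerD//.
by rewrite (le_trans (fB _ _))// ler_wpM2l.
Qed.

Lemma loss_lipschitz_fun f g p (r c : R) : `|f| <= r -> `|g| <= r -> `|p.2| <= c ->
  `|loss f p - loss g p| <= B * `|f - g| * (2 * (B * r + c)).
Proof.
move=> fr gr pc; rewrite (le_trans (sqnorm_dist _ _))// ler_pM ?addr_ge0//.
  by rewrite opprB addrA subrK -vrkhs_funB.
by rewrite mulr2n mulrDl mul1r lerD// norm_residual.
Qed.

Lemma loss_lipschitz_point f p q (r c : R) : `|f| <= r -> `|p.2| <= c -> `|q.2| <= c ->
  `|loss f p - loss f q| <=
  (`|vrkhs_fun f p.1 - vrkhs_fun f q.1| + `|p.2 - q.2|) * (2 * (B * r + c)).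
Proof.
move=> fr pc qc; rewrite (le_trans (sqnorm_dist _ _))// ler_pM ?addr_ge0//.
  rewrite opprB (addrC q.2) addrACA (addrC (- p.2)) -(opprB p.2).
  exact: ler_normB.
by rewrite mulr2n mulrDl mul1r lerD// norm_residual.
Qed.

Local Notation J := (@objective R X Y K HK lambda l).
Local Notation rdg := (@ridge R X Y K HK lambda l).

Lemma objectiveE a y f :
  J a y f = l%:R^-1 * (\sum_(i < l) loss f (a i, y i)) + lambda * `|f| ^+ 2.
Proof. by []. Qed.

Lemma objective_ge0 a y f : 0 <= J a y f.
Proof.
rewrite addr_ge0// mulr_ge0 ?invr_ge0 ?sqr_ge0//; last exact: ltW.
by apply: sumr_ge0 => i _; exact: sqr_ge0.
Qed.

Lemma vrkhs_fun_continuous (p : X) : continuous (fun f : HK => vrkhs_fun f p).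
Proof.
move=> f; apply/cvgrPdist_lt => e e0.
have B1 : 0 < B + 1 by rewrite ltr_wpDl.
have cf : g @[g --> f] --> f by exact: cvg_id.
move/cvgrPdist_lt : cf => /(_ _ (divr_gt0 e0 B1)) cf.
near=> g; rewrite -vrkhs_funB (le_lt_trans (fB _ _))//.
apply: (@le_lt_trans _ _ ((B + 1) * `|f - g|)); first by rewrite ler_wpM2r// lerDl.
by rewrite mulrC -ltr_pdivlMr//; near: g.
Unshelve. all: by end_near. Qed.

Lemma loss_continuous p : continuous (loss ^~ p).
Proof.
move=> f; rewrite /loss.
apply: (@continuous_comp _ _ _ (fun f => `|vrkhs_fun f p.1 - p.2|) (fun x => x ^+ 2)).
  apply: (@continuous_comp _ _ _ (fun f => vrkhs_fun f p.1 - p.2) Num.norm).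
    by apply: continuousB; [exact: vrkhs_fun_continuous|exact: cst_continuous].
  exact: norm_continuous.
exact: exprn_continuous.
Qed.

Lemma objective_continuous a y : continuous (J a y).
Proof.
move=> f.
have sumc n : {for f, continuous (fun g : HK => \sum_(i < n) loss g (a i, y i))}.
  elim: n => [|n IH].
    rewrite (_ : (fun _ => _) = cst (0 : R)); first exact: cst_continuous.
    by apply/funext => g; rewrite big_ord0.
  rewrite (_ : (fun _ => _) =
    (fun g : HK => \sum_(i < n) loss g (a i, y i) + loss g (a n, y n))).
    apply: continuousD; [exact: IH|exact: loss_continuous].
  by apply/funext => g; rewrite big_ord_recr.
have normc : {for f, continuous (fun g : HK => `|g| ^+ 2)}.
  apply: (@continuous_comp _ _ _ (fun g : HK => `|g|) (fun x => x ^+ 2)).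
    exact: norm_continuous.
  exact: exprn_continuous.
exact: (continuousD (continuousM (@cst_continuous _ _ _ _) (sumc l))
  (continuousM (@cst_continuous _ _ _ _) normc)).
Qed.

(** Strong convexity in midpoint form, by the parallelogram law. *)
Lemma objective_midpoint a y f g :
  J a y (2^-1 *: (f + g)) <=
  (J a y f + J a y g) / 2 - (lambda / 4) * `|f - g| ^+ 2.
Proof.
have nm : `|2^-1 *: (f + g)| ^+ 2 = (`|f| ^+ 2 + `|g| ^+ 2) / 2 - 4^-1 * `|f - g| ^+ 2.
  by have := parallelogram_mid f g 0; rewrite !sub0r !normrN.
have ls i : loss (2^-1 *: (f + g)) (a i, y i) <=
    (loss f (a i, y i) + loss g (a i, y i)) / 2.
  rewrite /loss/= vrkhs_funZ vrkhs_funD distrC parallelogram_mid.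
  by rewrite !(distrC (y i)) gerBl mulr_ge0// sqr_ge0.
rewrite !objectiveE nm.
apply: (@le_trans _ _ (l%:R^-1 * (\sum_(i < l) (loss f (a i, y i) + loss g (a i, y i)) / 2)
   + lambda * ((`|f| ^+ 2 + `|g| ^+ 2) / 2 - 4^-1 * `|f - g| ^+ 2))).
  by rewrite lerD2r ler_wpM2l ?invr_ge0//; exact: ler_sum.
rewrite -mulr_suml big_split/=; move: (l%:R^-1) => li.
by rewrite le_eqVlt; apply/orP; left; apply/eqP; field.
Qed.

Lemma ridge_min a y g : J a y (rdg a y) <= J a y g.
Proof.
suff [f fmin] : exists f, forall g, J a y f <= J a y g.
  have := @xgetPex _ 0 [set f | forall g, J a y f <= J a y g] (ex_intro _ f fmin).
  exact.
have [f _ fmin] := @midpoint_convex_minimizer R HK (J a y) setT (lambda / 4)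
  ltac:(by rewrite divr_gt0) (ex_intro _ 0 I) (fun _ _ _ _ => I)
  (objective_ge0 a y) (objective_midpoint a y) (@objective_continuous a y).
by exists f => g'; exact: fmin.
Qed.

(** The value at the midpoint of [g] and the minimizer is at least the minimum. *)
Lemma ridge_growth a y g :
  (lambda / 2) * `|g - rdg a y| ^+ 2 <= J a y g - J a y (rdg a y).
Proof.
have := ridge_min a y (2^-1 *: (g + rdg a y)).
have := objective_midpoint a y g (rdg a y).
by lra.
Qed.

(** The zero function is a competitor, with objective at most [c ^+ 2]. *)
Lemma ridge_bounded a y (c : R) : 0 <= c ->
  (forall i, (i < l)%N -> `|y i| <= c) -> `|rdg a y| <= c / Num.sqrt lambda.
Proof.
move=> c0 yc.
have s0 : 0 < Num.sqrt lambda by rewrite sqrtr_gt0.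
rewrite ler_pdivlMr// -(@ler_pXn2r _ 2)// ?nnegrE ?mulr_ge0 ?(ltW s0)//.
rewrite exprMn sqr_sqrtr ?(ltW lambda0)// mulrC.
apply: (@le_trans _ _ (J a y 0)).
  apply: le_trans (ridge_min a y 0).
  by rewrite objectiveE lerDr mulr_ge0 ?invr_ge0// sumr_ge0// => i _; exact: loss_ge0.
rewrite objectiveE normr0 expr0n/= mulr0 addr0.
have [->|l0] := posnP l; first by rewrite invr0 mul0r sqr_ge0.
rewrite mulrC ler_pdivrMr ?ltr0n//.
apply: (@le_trans _ _ (\sum_(i < l) c ^+ 2)).
  apply: ler_sum => i _; rewrite /loss vrkhs_fun0 sub0r normrN/=.
  by rewrite lerXn2r ?nnegrE// yc.
by rewrite sumr_const card_ord mulr_natr.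
Qed.

(** Each of the two minimizers is a competitor for the other data set; strong
    convexity turns the resulting excesses into a squared distance. *)
Lemma ridge_perturbation a y b z :
  lambda * `|rdg a y - rdg b z| ^+ 2 <=
  l%:R^-1 * \sum_(i < l)
    ((loss (rdg b z) (a i, y i) - loss (rdg b z) (b i, z i)) +
     (loss (rdg a y) (b i, z i) - loss (rdg a y) (a i, y i))).
Proof.
have := ridge_growth a y (rdg b z); have := ridge_growth b z (rdg a y).
rewrite !objectiveE (distrC (rdg b z)) big_split/= !sumrB.
by lra.
Qed.

(** Replacing a single observation moves the minimizer by [O(1/l)]. *)
Lemma ridge_stability a y b z (j : 'I_l) (c : R) :
  0 <= c -> (forall i, (i < l)%N -> `|y i| <= c) ->
  (forall i, (i < l)%N -> `|z i| <= c) ->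
  (forall i : 'I_l, i != j -> a i = b i /\ y i = z i) ->
  `|rdg a y - rdg b z| <=
    4 * B * (B * (c / Num.sqrt lambda) + c) / (lambda * l%:R).
Proof.
set r := c / Num.sqrt lambda.
move=> c0 yc zc abyz.
have := ridge_perturbation a y b z.
have := ridge_bounded a c0 yc; have := ridge_bounded b c0 zc; rewrite -/r.
set f := rdg a y; set g := rdg b z => gr fr.
have l0 : 0 < (l%:R : R) by rewrite ltr0n (leq_ltn_trans (leq0n j)).
rewrite (bigD1 j)//= [\sum_(i < l | i != j) _]big1 ?addr0; last first.
  by move=> i /abyz[-> ->]; rewrite !subrr addr0.
have := loss_lipschitz_fun (p := (a j, y j)) gr fr (yc _ (ltn_ord j)).
have := loss_lipschitz_fun (p := (b j, z j)) fr gr (zc _ (ltn_ord j)).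
rewrite (distrC g f); set d := `|f - g|; set k := B * r + c.
set t1 := loss g _; set t2 := loss g _; set t3 := loss f _; set t4 := loss f _.
move=> /ler_normlP[h1 h1'] /ler_normlP[h2 h2'] h3.
rewrite ler_pdivlMr ?mulr_gt0//.
have d0 : 0 <= d := normr_ge0 _.
have [d1|dn0] := eqVneq d 0.
  rewrite d1 mul0r !mulr_ge0//.
  by rewrite addr_ge0// mulr_ge0// (le_trans _ gr).
have dgt : 0 < d by rewrite lt_neqAle eq_sym dn0.
rewrite -(ler_pM2l dgt).
have : lambda * d ^+ 2 * l%:R <= t2 - t1 + (t3 - t4).
  rewrite -ler_pdivlMr// [leRHS]mulrC; exact: h3.
by move: h1 h1' h2 h2'; lra.
Qed.

End ridge.

(** * Measurability of the ridge estimator *)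

Section ridge_measurability.
Context (R : realType) (X : ptopologicalType) (Y V : hilbertType R)
  (iota : X -> V) (K : X -> X -> {linear Y -> Y}) (HK : vrkhs K)
  (B : R) (B0 : 0 <= B) (fB : forall (f : HK) a, `|vrkhs_fun f a| <= B * `|f|)
  (L h : R) (L0 : 0 < L) (h0 : 0 < h)
  (fL : forall (f : HK) a b,
    `|vrkhs_fun f a - vrkhs_fun f b| <= L * `|iota a - iota b| `^ h * `|f|)
  (lambda : R) (lambda0 : 0 < lambda) (l : nat).

Local Notation rdg := (@ridge R X Y K HK lambda l).

Let sum_norm_ge (y : nat -> Y) i : (i < l)%N -> `|y i| <= \sum_(j < l) `|y j|.
Proof. by move=> il; rewrite (bigD1 (Ordinal il))//= lerDl sumr_ge0. Qed.

Let small_modulus (D r e : R) : 0 <= D -> 0 <= r -> 0 < e ->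
  exists2 s : R, 0 < s & forall t u, 0 <= t -> t < s -> 0 <= u -> u < s ->
    (L * t `^ h * r + u) * D < e.
Proof.
move=> D0 r0 e0.
have k0 : 0 < (D + 1) * (L * r + 1).
  by rewrite mulr_gt0// ltr_wpDl// mulr_ge0// ltW.
have n0 : 0 < e / ((D + 1) * (L * r + 1)) by rewrite divr_gt0.
have [s s0 hs] := powR_cvg0 h0 n0.
exists (Num.min s (e / ((D + 1) * (L * r + 1)))); first by rewrite lt_min s0.
move=> t u t0; rewrite lt_min => /andP[/(hs _ t0) th _] u0.
rewrite lt_min => /andP[_ ue].
set n := e / _ in n0 th ue.
have -> : e = n * ((D + 1) * (L * r + 1)) by rewrite /n divfK// gt_eqF.
apply: (@le_lt_trans _ _ (n * (L * r + 1) * D)).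
  rewrite ler_wpM2r// mulrDr mulr1; apply: lerD; last exact: ltW.
  rewrite [leLHS]mulrAC [leLHS]mulrC; apply: ler_wpM2r; last exact: ltW.
  by rewrite mulr_ge0// ltW.
rewrite mulrAC -mulrA ltr_pM2l// ltr_pM2r ?ltrDl//.
by rewrite ltr_wpDl// mulr_ge0// ltW.
Qed.

Lemma loss_jointly_continuous (f : HK) (p : X) (y : Y) (e : R) : 0 < e ->
  exists2 s : R, 0 < s & forall g q z, `|f - g| < s ->
    `|iota p - iota q| < s -> `|y - z| < s ->
    `|loss f (p, y) - loss g (q, z)| < e.
Proof.
move=> e0; pose r := `|f| + 1; pose c := `|y| + 1.
have r0 : 0 <= r by rewrite addr_ge0.
have c0 : 0 <= c by rewrite addr_ge0.
pose D := 2 * (B * r + c).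
have D0 : 0 <= D by rewrite mulr_ge0// addr_ge0// mulr_ge0.
have e20 : 0 < e / 2 by rewrite divr_gt0.
have [s s0 hs] := small_modulus D0 r0 e20.
have BD0 : 0 < B * D + 1 by rewrite ltr_wpDl// mulr_ge0.
pose s' := e / 2 / (B * D + 1).
have s'0 : 0 < s' by rewrite divr_gt0.
exists (Num.min 1 (Num.min s s')); first by rewrite !lt_min ltr01 s0.
move=> g q z; rewrite !lt_min => /and3P[fg1 _ fg] /and3P[_ pq _] /and3P[yz1 yz _].
have gr : `|g| <= r.
  rewrite -(subrK f g) (le_trans (ler_normD _ _))// addrC lerD2l distrC ltW//.
have zc : `|z| <= c.
  rewrite -(subrK y z) (le_trans (ler_normD _ _))// addrC lerD2l distrC ltW//.
have fr : `|f| <= r by rewrite lerDl.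
have yc : `|y| <= c by rewrite lerDl.
have h1 := loss_lipschitz_fun B0 fB (p := (p, y)) fr gr yc.
have h2 := loss_lipschitz_point B0 fB (p := (p, y)) (q := (q, z)) gr yc zc.
have h3 : (`|vrkhs_fun g p - vrkhs_fun g q| + `|y - z|) * D < e / 2.
  apply: le_lt_trans (hs `|iota p - iota q| `|y - z| _ pq _ yz) => //.
  rewrite ler_wpM2r// lerD2r (le_trans (fL _ _ _))// ler_wpM2l//.
  by rewrite mulr_ge0 ?powR_ge0// ltW.
have h4 : B * `|f - g| * D < e / 2.
  have -> : e / 2 = s' * (B * D + 1) by rewrite /s' divfK// gt_eqF.
  apply: (@le_lt_trans _ _ (s' * (B * D))).
    rewrite [leLHS]mulrAC [leLHS]mulrC.
    by apply: ler_wpM2r; [exact: mulr_ge0|exact: ltW].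
  by rewrite ltr_pM2l// ltrDl.
have := ler_distD (loss g (p, y)) (loss f (p, y)) (loss g (q, z)).
by move: h1 h2 h3 h4; rewrite /= -/D; lra.
Qed.

(** Two data sets that are close have labels with a common bound, hence fits with
    a common bound, so that the differences of losses in [ridge_perturbation] are
    uniformly small. *)
Lemma ridge_continuous (a : nat -> X) (y : nat -> Y) (e : R) : 0 < e ->
  exists2 s : R, 0 < s & forall b z,
    (forall i, (i < l)%N -> `|iota (a i) - iota (b i)| < s /\ `|y i - z i| < s) ->
    `|rdg a y - rdg b z| < e.
Proof.
move=> e0; pose c := \sum_(j < l) `|y j| + 1; pose r := c / Num.sqrt lambda.
have c0 : 0 <= c by rewrite addr_ge0// sumr_ge0.
have r0 : 0 <= r by rewrite divr_ge0// sqrtr_ge0.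
pose D := 2 * (2 * (B * r + c)).
have D0 : 0 <= D by rewrite !mulr_ge0// addr_ge0// mulr_ge0.
have e20 : 0 < lambda * e ^+ 2 by rewrite mulr_gt0// exprn_gt0.
have [s s0 hs] := small_modulus D0 r0 e20.
exists (Num.min 1 s); first by rewrite lt_min ltr01.
move=> b z abyz.
have yc i : (i < l)%N -> `|y i| <= c.
  by move=> il; rewrite (le_trans (sum_norm_ge y il))// lerDl.
have zc i : (i < l)%N -> `|z i| <= c.
  move=> il; rewrite -(subrK (y i) (z i)) (le_trans (ler_normD _ _))// addrC.
  rewrite lerD ?sum_norm_ge// distrC ltW//.
  by have [_] := abyz i il; rewrite lt_min => /andP[].
have fr := ridge_bounded B0 fB lambda0 a c0 yc.
have gr := ridge_bounded B0 fB lambda0 b c0 zc.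
rewrite -(@ltr_pXn2r _ 2)// ?nnegrE ?(ltW e0)// -(ltr_pM2l lambda0).
apply: le_lt_trans (ridge_perturbation B0 fB lambda0 l a y b z) _.
set f := rdg a y; set g := rdg b z.
have term (i : 'I_l) : loss g (a i, y i) - loss g (b i, z i) +
    (loss f (b i, z i) - loss f (a i, y i)) < lambda * e ^+ 2.
  have [] := abyz i (ltn_ord i); rewrite !lt_min => /andP[_ abi] /andP[_ yzi].
  apply: le_lt_trans (hs _ _ (normr_ge0 _) abi (normr_ge0 _) yzi).
  have lip (u : HK) : `|u| <= r -> `|loss u (a i, y i) - loss u (b i, z i)| <=
      (L * `|iota (a i) - iota (b i)| `^ h * r + `|y i - z i|) * (2 * (B * r + c)).
    move=> ur; apply: le_trans (loss_lipschitz_point B0 fB (p := (a i, y i))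
      (q := (b i, z i)) ur (yc _ (ltn_ord i)) (zc _ (ltn_ord i))) _.
    apply: ler_wpM2r; first by rewrite mulr_ge0// addr_ge0// mulr_ge0.
    rewrite lerD2r (le_trans (fL _ _ _))//.
    by rewrite ler_wpM2l// mulr_ge0 ?powR_ge0// ltW.
  have := lip f fr; have := lip g gr.
  move=> /ler_normlP[h1 h1'] /ler_normlP[h2 h2'].
  by rewrite /D; move: h1 h1' h2 h2'; lra.
have [l0|l0] := posnP l.
  by rewrite l0 invr0 mul0r.
rewrite mulrC ltr_pdivrMr ?ltr0n//.
have -> : lambda * e ^+ 2 * l%:R = \sum_(i < l) (lambda * e ^+ 2).
  by rewrite sumr_const card_ord mulr_natr.
apply: ltr_sum => [|i _]; last exact: term.
by apply/hasP; exists (Ordinal l0) => //; exact: mem_index_enum.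
Qed.

(** A function of finitely many data is measurable when it is continuous, since
    the tuples of points of dense sequences are dense in the product. *)
Lemma data_measurable d (Om : measurableType d) (e : nat -> V) (e' : nat -> Y)
    (n : nat) (F : nat -> Om -> X) (G : nat -> Om -> Y)
    (Psi : (nat -> X) -> (nat -> Y) -> R) :
  dense_seq e -> dense_seq e' ->
  (forall i, (i < n)%N -> norm_measurable (iota \o F i)) ->
  (forall i, (i < n)%N -> norm_measurable (G i)) ->
  (forall a y (r : R), 0 < r -> exists2 s : R, 0 < s & forall b z,
    (forall i, (i < n)%N -> `|iota (a i) - iota (b i)| < s /\ `|y i - z i| < s) ->
    `|Psi a y - Psi b z| < r) ->
  measurable_fun setT (fun w => Psi (F ^~ w) (G ^~ w)).
Proof.
move=> de de' mF mG Psic.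
pose delta (j : {ffun 'I_n -> nat * nat}) (z : (nat -> X) * (nat -> Y)) : R :=
  \sum_(i < n) (`|iota (z.1 i) - e (j i).1| + `|z.2 i - e' (j i).2|).
have deltai (j : {ffun 'I_n -> nat * nat}) (z : (nat -> X) * (nat -> Y)) (i : 'I_n) : `|iota (z.1 i) - e (j i).1| <= delta j z /\
    `|z.2 i - e' (j i).2| <= delta j z.
  rewrite /delta (bigD1 i)//= -addrA; split.
    by rewrite lerDl addr_ge0// sumr_ge0// => k _; rewrite addr_ge0.
  by rewrite addrCA lerDl addr_ge0// sumr_ge0// => k _; rewrite addr_ge0.
apply: (@measurable_continuous_of_dense R _ Om ((nat -> X) * (nat -> Y))%type _ delta
  (fun w => (F ^~ w, G ^~ w)) (fun z => Psi z.1 z.2)).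
- move=> j; apply: measurable_sum => i; apply: measurable_funD.
    exact: mF.
  exact: mG.
- move=> z r r0; have n0 : 0 < r / (2 * (n%:R + 1)).
    by rewrite divr_gt0// mulr_gt0// ltr_wpDl.
  have hi (i : 'I_n) := de (iota (z.1 i)) _ n0.
  have hi' (i : 'I_n) := de' (z.2 i) _ n0.
  exists [ffun i => (projT1 (cid (hi i)), projT1 (cid (hi' i)))].
  apply: (@le_lt_trans _ _ (\sum_(i < n) (r / (n%:R + 1)))).
    apply: ler_sum => i _; rewrite ffunE/=.
    case: cid => j /= h1; case: cid => j' /= h2.
    have -> : r / (n%:R + 1) = r / (2 * (n%:R + 1)) + r / (2 * (n%:R + 1)).
      by field; rewrite gt_eqF// ltr_wpDl.
    by rewrite lerD// ltW.
  rewrite sumr_const card_ord -[ltLHS]mulr_natr -mulrA gtr_pMr//.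
  by rewrite mulrC ltr_pdivrMr ?mul1r ?ltrDl// ltr_wpDl.
move=> z r r0; have [s s0 hs] := Psic z.1 z.2 r r0.
exists (s / 2) => [|z' j zj z'j]; first by rewrite divr_gt0.
apply: hs => i il.
have [h1 h2] := deltai j z (Ordinal il).
have [h3 h4] := deltai j z' (Ordinal il).
have t1 := ler_distD (e (j (Ordinal il)).1) (iota (z.1 i)) (iota (z'.1 i)).
have t2 := ler_distD (e' (j (Ordinal il)).2) (z.2 i) (z'.2 i).
rewrite (distrC (e _)) in t1; rewrite (distrC (e' _)) in t2.
by move: h1 h2 h3 h4; rewrite /=; split; lra.
Qed.

(** The datum of index [l] is a new point, at which the fit to the first [l] data
    is tested. *)
Lemma ridge_measurable d (Om : measurableType d) (e : nat -> V) (e' : nat -> Y)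
    (F : nat -> Om -> X) (G : nat -> Om -> Y) (Phi : HK -> X -> Y -> R) :
  dense_seq e -> dense_seq e' ->
  (forall i, (i <= l)%N -> norm_measurable (iota \o F i)) ->
  (forall i, (i <= l)%N -> norm_measurable (G i)) ->
  (forall f p y (r : R), 0 < r -> exists2 s : R, 0 < s & forall g q z,
    `|f - g| < s -> `|iota p - iota q| < s -> `|y - z| < s ->
    `|Phi f p y - Phi g q z| < r) ->
  measurable_fun setT (fun w => Phi (rdg (F ^~ w) (G ^~ w)) (F l w) (G l w)).
Proof.
move=> de de' mF mG Phic.
apply: (@data_measurable _ _ e e' l.+1 F G (fun a y => Phi (rdg a y) (a l) (y l))) => //.
move=> a y r r0; have [s s0 hs] := Phic (rdg a y) (a l) (y l) r r0.
have [s' s'0 hs'] := ridge_continuous a y s0.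
exists (Num.min s s') => [|b z abyz]; first by rewrite lt_min s0.
have [] := abyz l (ltnSn l); rewrite !lt_min => /andP[h1 _] /andP[h2 _].
apply: hs => //; apply: hs' => i il.
by have [] := abyz i (ltnW il); rewrite !lt_min => /andP[_ ?] /andP[_ ?].
Qed.

End ridge_measurability.

(** * Two-stage samples *)

Section baire_type.
Context (R : realType) (T : ptopologicalType).

(** The value of a measure on a Baire set is a measurable function of the measure
    for the weak topology; on other Borel sets this may fail. *)
Definition baire := g_sigma_algebraType (@cozero R T).

Lemma measurable_id_baire : measurable_fun [set: borel T] (id : borel T -> baire).
Proof. by move=> _ B mB; rewrite setTI; exact: (@baire_borel R T B mB). Qed.

Definition baire_restriction (x : probability (borel T) R) : giry baire R :=
  giry_map measurable_id_baire x.

Lemma baire_restriction_setT x : baire_restriction x setT = 1%E.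
Proof. exact: (@probability_setT _ _ _ x). Qed.

Lemma integral_baire_restriction (x : probability (borel T) R) (F : baire -> \bar R) :
  measurable_fun setT F -> (forall u, (0 <= F u)%E) ->
  (\int[baire_restriction x]_u F u = \int[x]_u F u)%E.
Proof. by move=> mF F0; exact: (giry_int_map measurable_id_baire). Qed.

End baire_type.

Lemma continuous_baire_measurable (R : realType) (T : ptopologicalType) (g : T -> R) :
  continuous g -> measurable_fun [set: baire R T] g.
Proof.
move=> cg _; apply: (measurability _ (RGenOInfty.measurableE R)) => //.
move=> _ [_ [t ->] <-]; rewrite setTI; apply: sub_sigma_algebra.
exists (fun u => Num.max (g u - t) 0); split.
- move=> u; apply: (@continuous_max R T (fun u => g u - t) (fun=> 0)).
    by apply: continuousB; [exact: cg|exact: cst_continuous].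
  exact: cst_continuous.
- by move=> u; rewrite le_max lexx orbT.
by apply/seteqP; split => u /=; rewrite in_itv/= andbT lt_max ltxx orbF subr_gt0.
Qed.


Section sampling.
Context (R : realType) (T : ptopologicalType) (Y : hilbertType R)
  (M : probability (borel (measures R T) * borel Y)%type R) (l N : nat)
  (S : two_stage_sample M l N).

Local Notation Om := (sample_space S).
Local Notation P := (sample_prob S).
Local Notation pairs := (borel (measures R T) * borel Y)%type.

Definition sample_pair (i : nat) (w : Om) : pairs := (dist i w, label S i w).

Lemma sample_pair_measurable i : (i < l)%N -> measurable_fun setT (sample_pair i).
Proof.
move=> il; apply: measurable_fun_pair.
  exact: dist_measurable.
exact: label_measurable.
Qed.

Definition baire_bag i n (w : Om) : baire R T := bag S i n w.

Lemma baire_bag_measurable i n : (i < l)%N -> (n < N)%N ->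
  measurable_fun setT (baire_bag i n).
Proof.
move=> il nN.
exact: (measurableT_comp (@measurable_id_baire R T) (bag_measurable il nN)).
Qed.

Definition sample_box (A : nat -> set pairs) (B : nat -> nat -> set (baire R T)) : set Om :=
  [set w | forall i, (i < l)%N -> A i (sample_pair i w) /\
     forall n, (n < N)%N -> B i n (baire_bag i n w)].

Definition measurable_box (A : nat -> set pairs) (B : nat -> nat -> set (baire R T)) :=
  (forall i, measurable (A i)) /\ (forall i n, measurable (B i n)).

(** The conditional probability, given the pair, that a bag point lies in [B]. *)
Definition pair_value (B : set (baire R T)) (p : pairs) : \bar R :=
  evaluation B (p.1 : measures R T).

Lemma pair_value_measurable B : measurable B -> measurable_fun [set: pairs] (pair_value B).
Proof. by move=> mB; exact: (measurableT_comp (evaluation_baire_measurable mB)). Qed.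

Lemma pair_valueT p : pair_value setT p = 1%E.
Proof. exact: (baire_restriction_setT (p.1 : measures R T)). Qed.

Lemma pair_value_ge0 B p : (0 <= pair_value B p)%E.
Proof. exact: (measure_ge0 (baire_restriction (p.1 : measures R T))). Qed.

Lemma sample_box_law A B : measurable_box A B ->
  P (sample_box A B) =
  (\big[mule/1]_(i < l) \int[M]_(p in A i) \big[mule/1]_(n < N) pair_value (B i n) p)%E.
Proof.
move=> [mA mB]; apply: (@sample_law _ _ _ _ _ _ S A B) => // i n.
  exact: (@baire_borel R T _ (mB i n)).
exact: (@evaluation_baire_measurable R T _ (mB i n)).
Qed.

Lemma measurable_sample_box A B : measurable_box A B -> measurable (sample_box A B).
Proof.
move=> [mA mB].
have -> : sample_box A B = \bigcap_i (if (i < l)%N then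
    (sample_pair i @^-1` A i) `&` \bigcap_n (if (n < N)%N then baire_bag i n @^-1` B i n else setT)
    else setT).
  apply/seteqP; split => w /= h.
    move=> i _; case: ifPn => // il; have [h1 h2] := h i il; split => // n _.
    by case: ifPn => // nN; exact: h2.
  move=> i il; have := h i I; rewrite il => -[h1 h2]; split => // n nN.
  by have := h2 n I; rewrite nN.
apply: bigcapT_measurable => i; case: ifPn => // il; apply: measurableI.
  by rewrite -[X in measurable X]setTI; exact: sample_pair_measurable.
apply: bigcapT_measurable => n; case: ifPn => // nN.
by rewrite -[X in measurable X]setTI; exact: baire_bag_measurable.
Qed.

Lemma sample_box_bags_law i (E : set pairs) (B : nat -> set (baire R T)) : (i < l)%N ->
  measurable E -> (forall n, measurable (B n)) ->
  P (sample_pair i @^-1` E `&` [set w | forall n, (n < N)%N -> B n (baire_bag i n w)]) =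
  (\int[M]_(p in E) \big[mule/1]_(n < N) pair_value (B n) p)%E.
Proof.
move=> il mE mB.
pose A' j := if j == i then E else setT.
pose B' j n := if j == i then B n else setT.
have box : measurable_box A' B'.
  by split => [j|j n]; rewrite /A' /B'; case: ifP.
transitivity (P (sample_box A' B')).
  congr (P _); apply/seteqP; split => w /=.
    move=> [h1 h2] j jl; rewrite /A' /B'; case: eqP => // ->; split => //.
  move=> h; have := h i il; rewrite /A' /B' eqxx => -[h1 h2].
  by split.
rewrite (sample_box_law box) (bigD1 (Ordinal il))//= big1 ?mule1; last first.
  move=> j ji; have {ji} jiF : (j == i :> nat) = false.
    by apply/negbTE; apply: contra ji => /eqP jE; apply/eqP/val_inj.
  rewrite /A' /B' jiF.
  under eq_integral => p _.
    rewrite big1; last by move=> n _; rewrite pair_valueT.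
    over.
  by rewrite integral_cst// mul1e; exact: (probability_setT M).
by rewrite /A' /B' eqxx.
Qed.

Lemma sample_pair_law i (E : set pairs) : (i < l)%N -> measurable E ->
  P (sample_pair i @^-1` E) = M E.
Proof.
move=> il mE; have := sample_box_bags_law (B := fun=> setT) il mE (fun=> measurableT).
rewrite (_ : [set w | _] = setT) ?setIT; last by apply/seteqP; split.
move=> ->; under eq_integral => p _.
  rewrite big1; last by move=> n _; rewrite pair_valueT.
  over.
by rewrite integral_cst// mul1e.
Qed.

Lemma integral_sample_pair i (F : pairs -> \bar R) : (i < l)%N ->
  measurable_fun setT F -> (forall p, (0 <= F p)%E) ->
  (\int[P]_w F (sample_pair i w) = \int[M]_p F p)%E.
Proof.
move=> il mF F0; have mp := sample_pair_measurable il.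
transitivity (giry_int (giry_map mp (P : giry Om R)) F); first by rewrite giry_int_map.
apply: eq_measure_integral => A mA _.
exact: sample_pair_law.
Qed.

End sampling.

Section independence.
Context (R : realType) (T : ptopologicalType) (Y : hilbertType R)
  (M : probability (borel (measures R T) * borel Y)%type R) (l N : nat)
  (S : two_stage_sample M l N) (i : nat) (il : (i < l)%N).

Local Notation Om := (sample_space S).
Local Notation P := (sample_prob S).
Local Notation pairs := (borel (measures R T) * borel Y)%type.

(** Events that do not involve the observation of index [i]. *)
Definition others_box : set (set Om) :=
  [set E | exists A B, [/\ measurable_box A B, A i = setT, forall n, B i n = setT
    & E = sample_box A B]].

Definition others := g_sigma_algebraType others_box.

Lemma others_boxT : others_box setT.
Proof.
exists (fun=> setT), (fun _ _ => setT); split => //.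
by apply/seteqP; split.
Qed.

Lemma others_boxI : setI_closed others_box.
Proof.
move=> _ _ [A [B [[mA mB] Ai Bi ->]]] [A' [B' [[mA' mB'] Ai' Bi' ->]]].
exists (fun j => A j `&` A' j), (fun j n => B j n `&` B' j n); split.
- by split => [j|j n]; exact: measurableI.
- by rewrite Ai Ai' setIT.
- by move=> n; rewrite Bi Bi' setIT.
apply/seteqP; split => w /=.
  move=> [h h'] j jl; have [h1 h2] := h j jl; have [h1' h2'] := h' j jl.
  by split => // n nN; split; [exact: h2|exact: h2'].
by move=> h; split => j jl; have [[h1 h1'] h2] := h j jl;
  split => // n nN; have [] := h2 n nN.
Qed.

Lemma others_box_measurable E : others_box E -> measurable E.
Proof. by move=> [A [B [mAB _ _ ->]]]; exact: measurable_sample_box. Qed.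

Lemma measurable_id_others : measurable_fun [set: Om] (id : Om -> others).
Proof.
move=> _ E mE; rewrite setTI; move: mE.
apply: smallest_sub; first exact: sigma_algebra_measurable.
exact: others_box_measurable.
Qed.

Lemma baire_bag_others_measurable j n : (j < l)%N -> j != i -> (n < N)%N ->
  measurable_fun [set: others] (fun w : others => baire_bag (S := S) j n w).
Proof.
move=> jl ji nN _ B mB; rewrite setTI; apply: sub_sigma_algebra.
exists (fun=> setT), (fun j' n' => if (j' == j) && (n' == n) then B else setT); split.
- by split => [//|j' n']; case: ifP.
- by [].
- by move=> n'; rewrite eq_sym (negbTE ji).
apply/seteqP; split => w /=.
  by move=> wB j' j'l; split => // n' n'N; case: ifP => // /andP[/eqP -> /eqP ->].
by move=> h; have [_ /(_ n nN)] := h j jl; rewrite !eqxx.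
Qed.

Lemma label_others_measurable j : (j < l)%N -> j != i ->
  measurable_fun [set: others] (fun w : others => label S j w).
Proof.
move=> jl ji _ B mB; rewrite setTI; apply: sub_sigma_algebra.
exists (fun j' => if j' == j then setT `*` B else setT), (fun _ _ => setT); split => //.
- by split => [j'|//]; case: ifP => // _; exact: measurableX.
- by rewrite eq_sym (negbTE ji).
apply/seteqP; split => w /=.
  by move=> wB j' j'l; split => //; case: ifP => // /eqP ->.
by move=> h; have [] := h j jl; rewrite eqxx => -[].
Qed.

Lemma others_box_independent E (D : set pairs) : others_box E -> measurable D ->
  P (E `&` sample_pair (S := S) i @^-1` D) = (P E * M D)%E.
Proof.
move=> [A [B [[mA mB] Ai Bi ->]]] mD.
pose A' j := if j == i then D else A j.
have box' : measurable_box A' B.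
  by split => // j; rewrite /A'; case: ifP.
have -> : sample_box A B `&` sample_pair (S := S) i @^-1` D = sample_box A' B.
  apply/seteqP; split => w /=.
    move=> [h wD] j jl; have [h1 h2] := h j jl; split => //.
    by rewrite /A'; case: eqP => // ->.
  move=> h; split; last by have [] := h i il; rewrite /A' eqxx.
  move=> j jl; have [h1 h2] := h j jl; split => //.
  by move: h1; rewrite /A'; case: eqP => // ->; rewrite Ai.
have one (D' : set pairs) : measurable D' ->
    (\int[M]_(p in D') \big[mule/1]_(n < N) pair_value (B i n) p = M D')%E.
  move=> mD'; under eq_integral => p _.
    rewrite big1; last by move=> n _; rewrite Bi pair_valueT.
    over.
  by rewrite integral_cst// mul1e.
have box : measurable_box A B by [].
transitivity (M D * \big[mule/1]_(j < l | j != Ordinal il)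
    \int[M]_(p in A j) \big[mule/1]_(n < N) pair_value (B j n) p)%E.
  rewrite (sample_box_law S box') (bigD1 (Ordinal il))//=.
  congr (_ * _)%E; first by rewrite /A' eqxx; exact: one.
  apply: eq_bigr => j ji; rewrite /A'; have {ji} -> // : (j == i :> nat) = false.
  by apply/negbTE; apply: contra ji => /eqP jE; apply/eqP/val_inj.
rewrite (sample_box_law S box) [in RHS](bigD1 (Ordinal il))//=.
rewrite [X in _ = (X * _ * _)%E](_ : _ = 1%E); first by rewrite mul1e muleC.
by rewrite Ai (one _ measurableT) (probability_setT M).
Qed.

(** The pair of index [i] is independent of the other observations and their
    bags. *)
Lemma integral_sample_independent (F : others * pairs -> \bar R) :
  measurable_fun setT F -> (forall x, (0 <= F x)%E) ->
  (\int[P]_w F (w, sample_pair (S := S) i w) = \int[P]_w \int[M]_p F (w, p))%E.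
Proof.
move=> mF F0.
apply: (@integral_disintegration R _ _ _ Om others pairs P (id : Om -> others) (sample_pair (S := S) i)
  (fun=> M) others_box) => //.
- exact: measurable_id_others.
- exact: sample_pair_measurable.
- by move=> z; exact: (probability_setT M).
- exact: others_boxI.
- exact: others_boxT.
move=> E D oE mD; rewrite others_box_independent//.
by rewrite integral_cst; [rewrite muleC|exact: others_box_measurable].
Qed.

End independence.

Section bag_covariance.
Context (R : realType) (T : ptopologicalType) (Y : hilbertType R)
  (M : probability (borel (measures R T) * borel Y)%type R) (l N : nat)
  (S : two_stage_sample M l N) (i : nat) (il : (i < l)%N).

Local Notation Om := (sample_space S).
Local Notation P := (sample_prob S).
Local Notation pairs := (borel (measures R T) * borel Y)%type.
Local Notation restr p := (baire_restriction (p.1 : measures R T)).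

Lemma prod_pair_value2 (m n : nat) (B B' : set (baire R T)) (p : pairs) :
  (m < N)%N -> (n < N)%N -> m != n ->
  (\big[mule/1]_(j < N) pair_value
     (if j == m :> nat then B else if j == n :> nat then B' else setT) p =
   pair_value B p * pair_value B' p)%E.
Proof.
move=> mN nN mn; rewrite (bigD1 (Ordinal mN))//= eqxx.
rewrite (bigD1 (Ordinal nN))/=; last by rewrite -val_eqE/= eq_sym.
rewrite eq_sym (negbTE mn) eqxx big1 ?mule1// => j /andP[jm jn].
by rewrite -val_eqE/= in jm; rewrite -val_eqE/= in jn; rewrite (negbTE jm) (negbTE jn) pair_valueT.
Qed.

Lemma prod_pair_value1 (n : nat) (B : set (baire R T)) (p : pairs) : (n < N)%N ->
  (\big[mule/1]_(j < N) pair_value (if j == n :> nat then B else setT) p =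
   pair_value B p)%E.
Proof.
move=> nN; rewrite (bigD1 (Ordinal nN))//= eqxx big1 ?mule1// => j jn.
by rewrite -val_eqE/= in jn; rewrite (negbTE jn) pair_valueT.
Qed.

(** Given the pair, a bag point has the law that the pair prescribes. *)
Lemma integral_bag1 (n : nat) (F : pairs * baire R T -> \bar R) : (n < N)%N ->
  measurable_fun setT F -> (forall x, (0 <= F x)%E) ->
  (\int[P]_w F (sample_pair (S := S) i w, baire_bag (S := S) i n w) =
   \int[P]_w \int[restr (sample_pair (S := S) i w)]_u F (sample_pair (S := S) i w, u))%E.
Proof.
move=> nN mF F0.
apply: (@integral_disintegration R _ _ _ Om pairs (baire R T) P (sample_pair (S := S) i)
  (baire_bag (S := S) i n) (fun p => restr p) measurable) => //.
- exact: sample_pair_measurable.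
- exact: baire_bag_measurable.
- by move=> B mB; exact: pair_value_measurable.
- by move=> z; exact: baire_restriction_setT.
- by rewrite smallest_id//; exact: sigma_algebra_measurable.
- exact: measurableI.
move=> E B mE mB.
have mpE : measurable (sample_pair (S := S) i @^-1` E).
  by rewrite -[X in measurable X]setTI; exact: sample_pair_measurable.
transitivity (\int[M]_(p in E) pair_value B p)%E; last first.
  rewrite [LHS]integral_mkcond [RHS]integral_mkcond.
  rewrite -(integral_sample_pair S il (F := pair_value B \_ E)).
  - by apply: eq_integral => w _; rewrite !patchE.
  - apply/(measurable_restrictT _ mE); apply: measurable_funTS.
    exact: pair_value_measurable.
  - by move=> p; rewrite patchE; case: ifP => // _; exact: pair_value_ge0.
have mB1 (j : nat) : measurable (if j == n then B else setT) by case: (j == n).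
have := sample_box_bags_law S il mE mB1.
under eq_integral => p _ do rewrite prod_pair_value1//.
move=> <-; congr (P _); apply/seteqP; split => w /= [h1 h2]; split => //.
  by move=> j jN; case: eqP => // ->.
by have := h2 n nN; rewrite eqxx.
Qed.

(** Given the pair, two points of a bag are independent. *)
Lemma integral_bag2 (m n : nat) (F : pairs * baire R T * baire R T -> \bar R) :
  (m < N)%N -> (n < N)%N -> m != n ->
  measurable_fun setT F -> (forall x, (0 <= F x)%E) ->
  (\int[P]_w F (sample_pair (S := S) i w, baire_bag (S := S) i m w, baire_bag (S := S) i n w) =
   \int[P]_w \int[restr (sample_pair (S := S) i w)]_u
     F (sample_pair (S := S) i w, baire_bag (S := S) i m w, u))%E.
Proof.
move=> mN nN mn mF F0.
have mW : measurable_fun setT (fun w => (sample_pair (S := S) i w, baire_bag (S := S) i m w)).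
  by apply: measurable_fun_pair; [exact: sample_pair_measurable|exact: baire_bag_measurable].
apply: (@integral_disintegration R _ _ _ Om (pairs * baire R T)%type (baire R T) P
  (fun w => (sample_pair (S := S) i w, baire_bag (S := S) i m w))
  (baire_bag (S := S) i n) (fun x => restr x.1)
  [set E `*` B | E in @measurable _ pairs & B in @measurable _ (baire R T)]) => //.
- exact: baire_bag_measurable.
- by move=> B mB; exact: (measurableT_comp (pair_value_measurable mB)).
- by move=> z; exact: baire_restriction_setT.
- exact: measurable_prod_measurableType.
- move=> _ _ [E mE [B mB <-]] [E' mE' [B' mB' <-]].
  exists (E `&` E'); first exact: measurableI.
  by exists (B `&` B'); [exact: measurableI|rewrite setXI].
- by exists setT => //; exists setT => //; rewrite setXTT.
move=> _ B' [E mE [B mB <-]] mB'.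
have mEB : measurable (E `*` B) by exact: measurableX.
transitivity (\int[M]_(p in E) (pair_value B p * pair_value B' p))%E.
  have mB1 (j : nat) : measurable (if j == m then B else if j == n then B' else setT).
    by case: (j == m) => //; case: (j == n).
  have := sample_box_bags_law S il mE mB1.
  under eq_integral => p _ do rewrite prod_pair_value2//.
  move=> <-; congr (P _); apply/seteqP; split => w /=.
    move=> [[h1 h2] h3]; split => // j jN.
    by case: eqP => [->//|_]; case: eqP => [->//|].
  move=> [h1 h2]; split; [split => //|].
    by have := h2 m mN; rewrite eqxx.
  by have := h2 n nN; rewrite eq_sym (negbTE mn) eqxx.
pose G (x : pairs * baire R T) := ((\1_(E `*` B) x)%:E * pair_value B' x.1)%E.
have mG : measurable_fun setT G.
  apply: emeasurable_funM; first exact/measurable_EFinP/measurable_indic.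
  exact: (measurableT_comp (pair_value_measurable mB')).
have G0 x : (0 <= G x)%E by rewrite mule_ge0 ?pair_value_ge0.
transitivity (\int[P]_w G (sample_pair (S := S) i w, baire_bag (S := S) i m w))%E; last first.
  rewrite [RHS]integral_mkcond; apply: eq_integral => w _.
  rewrite patchE /G indicE; set b1 := _ \in _; set b2 := _ \in _.
  have -> : b1 = b2 by apply/idP/idP; rewrite !inE.
  by case: b2; rewrite ?mul1e ?mul0e.
rewrite integral_bag1//.
pose H (p : pairs) := (pair_value B p * pair_value B' p)%E.
transitivity (\int[P]_w (H \_ E) (sample_pair (S := S) i w))%E.
  rewrite [LHS]integral_mkcond (integral_sample_pair S il (F := H \_ E))//.
    apply/(measurable_restrictT _ mE); apply: measurable_funTS.
    by apply: emeasurable_funM; exact: pair_value_measurable.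
  by move=> p; rewrite patchE; case: ifP => // _; rewrite mule_ge0 ?pair_value_ge0.
apply: eq_integral => w _; set p := sample_pair i w.
rewrite patchE; case: ifPn => pE.
  have -> : (fun u => G (p, u)) = (fun u : baire R T => (\1_B u)%:E * pair_value B' p)%E.
    apply/funext => u; rewrite /G !indicE; congr (_%:R%:E * _)%E.
    by congr nat_of_bool; apply/idP/idP; rewrite !inE/=; [case|split => //; rewrite inE in pE].
  rewrite ge0_integralZr//; last first.
    exact/measurable_EFinP/measurable_indic.
  by rewrite integral_indic// setIT.
rewrite integral0_eq// => u _; rewrite /G indicE memNset ?mul0e//=.
by move=> [] /mem_set; rewrite (negbTE pE).
Qed.

End bag_covariance.

Section bag_variance.
Context (R : realType) (T : ptopologicalType) (sepT : separable T)
  (k : T -> T -> R) (kc : continuous (fun p : T * T => k p.1 p.2))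
  (Bk : R) (kB : forall u, k u u <= Bk) (H : rkhs k) (Y : hilbertType R)
  (M : probability (borel (measures R T) * borel Y)%type R) (l N : nat)
  (S : two_stage_sample M l N) (i : nat) (il : (i < l)%N).

Local Notation phi := (rkhs_section H).
Local Notation P := (sample_prob S).
Local Notation pairs := (borel (measures R T) * borel Y)%type.

Let mu (p : pairs) : H := mean_embedding H (p.1 : measures R T).

Let mu_measurable : norm_measurable mu.
Proof.
exact: (norm_measurable_comp (norm_measurable_mean_embedding sepT kc kB (H := H)) measurable_fst).
Qed.

Lemma norm_measurable_section_baire : @norm_measurable R _ (baire R T) H phi.
Proof.
move=> v; apply: continuous_baire_measurable => t.
apply: (@continuous_comp _ _ _ (fun t => phi t - v) Num.norm).
  by apply: continuousB; [exact: section_continuous|exact: cst_continuous].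
exact: norm_continuous.
Qed.

Let dev (p : pairs) (u : T) : H := phi u - mu p.

Let dev_le p u : `|dev p u| <= 2 * Num.sqrt Bk.
Proof.
rewrite mulr_natl mulr2n (le_trans (ler_normB _ _))// lerD//.
  exact: norm_section.
exact: norm_mean_embedding.
Qed.

Let dot_dev_le p u v : `|dot (dev p u) (dev p v)| <= 4 * Bk.
Proof.
apply: le_trans (cauchy_schwarz _ _) _.
have -> : 4 * Bk = (2 * Num.sqrt Bk) * (2 * Num.sqrt Bk).
  by rewrite mulrACA -[Num.sqrt Bk * _]expr2 sqr_sqrtr ?(kernel_bound_ge0 kB H)//; ring.
by apply: ler_pM; rewrite ?normr_ge0 ?dev_le.
Qed.

Let Bk0 : 0 <= Bk := kernel_bound_ge0 kB H.

Let D (m n : nat) w : R :=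
  dot (dev (sample_pair (S := S) i w) (baire_bag (S := S) i m w))
      (dev (sample_pair (S := S) i w) (baire_bag (S := S) i n w)).

Let dev_measurable n : (n < N)%N -> norm_measurable (fun w =>
  dev (sample_pair (S := S) i w) (baire_bag (S := S) i n w)).
Proof.
move=> nN; have [e de] := rkhs_dense_seq sepT kc H.
apply: (norm_measurableB de).
  exact: (norm_measurable_comp norm_measurable_section_baire (baire_bag_measurable il nN)).
exact: (norm_measurable_comp mu_measurable (sample_pair_measurable il)).
Qed.

Let D_measurable m n : (m < N)%N -> (n < N)%N -> measurable_fun setT (D m n).
Proof.
move=> mN nN; have [e de] := rkhs_dense_seq sepT kc H.
exact: (norm_measurable_dot de (dev_measurable mN) (dev_measurable nN)).
Qed.

Let D_integrable m n : (m < N)%N -> (n < N)%N -> P.-integrable setT (EFin \o D m n).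
Proof.
move=> mN nN; apply: (integrable_bounded (probability_ltoo _) (D_measurable mN nN)).
by move=> w; exact: dot_dev_le.
Qed.

(** Given the pair and the point of index [m], the deviation of the point of
    index [n] has mean zero. [integral_bag2] is for nonnegative functions, hence the
    shift by [4 * Bk]. *)
Let D_uncorrelated m n : (m < N)%N -> (n < N)%N -> m != n ->
  (\int[P]_w (D m n w)%:E = 0)%E.
Proof.
move=> mN nN mn; have [e de] := rkhs_dense_seq sepT kc H.
pose F (x : pairs * baire R T * baire R T) : \bar R :=
  (dot (dev x.1.1 x.1.2) (dev x.1.1 x.2) + 4 * Bk)%:E.
have F0 x : (0 <= F x)%E.
  rewrite lee_fin; have := dot_dev_le x.1.1 x.1.2 x.2.
  by move=> /ler_normlP[]; lra.
have mF : measurable_fun setT F.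
  have m11 : measurable_fun setT (fun x : pairs * baire R T * baire R T => x.1.1).
    by apply: measurableT_comp => //; exact: measurable_fst.
  have m12 : measurable_fun setT (fun x : pairs * baire R T * baire R T => x.1.2).
    by apply: measurableT_comp => //; exact: measurable_fst.
  have mmu := norm_measurable_comp mu_measurable m11.
  apply/measurable_EFinP; apply: measurable_funD => //.
  apply: (norm_measurable_dot de).
    exact: (norm_measurableB de (norm_measurable_comp norm_measurable_section_baire m12) mmu).
  exact: (norm_measurableB de (norm_measurable_comp norm_measurable_section_baire measurable_snd) mmu).
have key := integral_bag2 S il mN nN mn mF F0.
have inner p (u : T) : (\int[baire_restriction (p.1 : measures R T)]_v F (p, u, v) = (4 * Bk)%:E)%E.
  rewrite integral_baire_restriction//; last by apply: (measurableT_comp mF); apply: measurable_fun_pair => //; exact: measurable_cst.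
  set x : probability (borel T) R := p.1 : measures R T.
  have ii : x.-integrable setT (EFin \o (fun v => dot (phi v) (dev p u))).
    exact: (integrable_dot_section sepT kc kB).
  have ic (c : R) : x.-integrable setT (EFin \o (fun=> c)).
    exact: (integrable_bounded (probability_ltoo _) (measurable_cst c) (c := `|c|)).
  have Rint : \int[x]_v (dot (dev p u) (dev p v) + 4 * Bk) = 4 * Bk.
    transitivity (\int[x]_v (dot (phi v) (dev p u) + (4 * Bk - dot (mu p) (dev p u)))).
      apply: eq_Rintegral => v _; rewrite (dotC (dev p u)) [dev p v]/dev dotBl; ring.
    rewrite (RintegralD measurableT ii (ic _)) Rintegral_probability_cst.
    by rewrite -(dot_mean_embedding sepT kc kB) -/(mu p); ring.
  rewrite -Rint /Rintegral fineK//.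
  apply: (integrable_fin_num measurableT).
  rewrite (_ : (fun v => _) = EFin \o (fun v => dot (phi v) (dev p u) + (4 * Bk - dot (mu p) (dev p u)))).
    exact: (integrableD measurableT ii (ic _)).
  apply/funext => v /=; congr EFin; rewrite (dotC (dev p u)) [dev p v]/dev dotBl; ring.
move: key; under [in X in _ = X -> _]eq_integral => w _ do rewrite inner.
have ic : P.-integrable setT (EFin \o (fun=> 4 * Bk)).
  exact: (integrable_bounded (probability_ltoo _) (measurable_cst _) (c := `|4 * Bk|)).
rewrite (_ : (fun w => F _) = (fun w => (D m n w)%:E + (EFin \o (fun=> 4 * Bk)%R) w)%E); last first.
  by apply/funext => w; rewrite /F /= EFinD.
rewrite integralD//=; last exact: D_integrable.
rewrite integral_probability_cst.
have Dfin : (\int[P]_w (D m n w)%:E)%E \is a fin_num by exact: (integrable_fin_num measurableT (D_integrable mN nN)).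
rewrite -(fineK Dfin) -EFinD => -[] h; congr EFin.
by apply: (addIr (4 * Bk)); rewrite h add0r.
Qed.

(** The deviations of the points of a bag are bounded and pairwise
    uncorrelated. *)
Lemma bag_mean_variance : (0 < N)%N ->
  (\int[P]_w (`|val (embed H (empirical R N (fun n => bag S i n w))) -
     mean_embedding H (dist i w : measures R T)| ^+ 2)%:E <= (4 * Bk / N%:R)%:E)%E.
Proof.
move=> N0; have N0r : (N%:R : R) != 0 by rewrite pnatr_eq0 -lt0n.
have ED w : `|val (embed H (empirical R N (fun n => bag S i n w))) -
     mean_embedding H (dist i w : measures R T)| ^+ 2 =
   N%:R^-1 ^+ 2 * (\sum_(m < N) \sum_(n < N) D m n w).
  rewrite /= (mean_embedding_empirical sepT kc kB)//.
  have -> : mean_embedding H (dist i w : measures R T) =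
      N%:R^-1 *: \sum_(n < N) mu (sample_pair (S := S) i w).
    by rewrite sumr_const card_ord -[mu _ *+ N]scaler_nat scalerA mulVf// scale1r.
  rewrite -scalerBr -sumrB normrZ exprMn ger0_norm ?invr_ge0// -dot_norm.
  congr (_ * _); rewrite (@dot_suml _ _ N (fun n => phi (bag S i n w) - mu (sample_pair (S := S) i w))).
  apply: eq_bigr => m _; rewrite dotC.
  rewrite (@dot_suml _ _ N (fun n => phi (bag S i n w) - mu (sample_pair (S := S) i w))).
  by apply: eq_bigr => n _; rewrite dotC.
under eq_integral => w _ do rewrite ED.
have iDD : P.-integrable setT (fun w => \sum_(m < N) \sum_(n < N) (D m n w)%:E)%E.
  by apply: integrable_sum => // m _; apply: integrable_sum => // n _; exact: D_integrable.
rewrite (_ : (fun w => _) = (fun w => (N%:R^-1 ^+ 2)%:E * \sum_(m < N) \sum_(n < N) (D m n w)%:E)%E); last first.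
  apply/funext => w; rewrite EFinM; congr (_ * _)%E.
  by rewrite -sumEFin; apply: eq_bigr => m _; rewrite sumEFin.
rewrite integralZl//.
have -> : (4 * Bk / N%:R)%:E = ((N%:R^-1 ^+ 2)%:E * \sum_(m < N) (4 * Bk)%:E)%E.
  rewrite sumEFin sumr_const card_ord -EFinM -[_ *+ N]mulr_natr; congr EFin.
  by field.
apply: lee_wpmul2l; first by rewrite lee_fin sqr_ge0.
rewrite integral_sum//; last first.
  by move=> m; apply: integrable_sum => // n _; exact: D_integrable.
apply: lee_sum => m _; rewrite integral_sum//; last by move=> n; exact: D_integrable.
rewrite (bigD1 m)//= big1 ?adde0; last first.
  by move=> n nm; apply: D_uncorrelated => //; rewrite eq_sym.
rewrite -[leRHS]mule1 -(probability_setT P) -integral_cst//.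
apply: ge0_le_integral => //.
- by move=> w _; rewrite lee_fin /D dot_norm sqr_ge0.
- exact/measurable_EFinP/D_measurable.
- by move=> w _; rewrite lee_fin; exact: le_trans (ler_norm _) (dot_dev_le _ _ _).
Qed.

End bag_variance.

(** * Excess risk and regression function *)

Section regression.
Context (R : realType) (X : ptopologicalType) (Y : hilbertType R)
  (e : nat -> Y) (de : dense_seq e)
  (rho : probability (borel X * borel Y)%type R) (rhoX : probability (borel X) R)
  (kappa : R.-pker (borel X) ~> (borel Y)) (C : R) (C0 : 0 <= C)
  (rhoX_marginal : is_law rhoX rho fst)
  (kappa_conditional : is_conditional rho rhoX kappa)
  (rhoC : rho [set p | C < `|(p.2 : Y)|] = 0%E).

Local Notation reg := (regression kappa).

Let kappa_ltoo a : (kappa a setT < +oo)%E.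
Proof. by rewrite prob_kernel ltry. Qed.

Lemma norm_measurable_id : @norm_measurable R _ (borel Y) Y (fun y => y).
Proof. by apply: (@continuous_norm_measurable R Y Y id) => y; exact: cvg_id. Qed.

Let norm_y_measurable : measurable_fun [set: borel Y] (fun y => `|(y : Y)|%:E).
Proof. by apply/measurable_EFinP; exact: (norm_measurable_norm norm_measurable_id). Qed.

Let kernel_integral_measurable (g : borel Y -> \bar R) :
  measurable_fun setT g -> (forall y, (0 <= g y)%E) ->
  measurable_fun [set: borel X] (fun a => \int[kappa a]_y g y)%E.
Proof.
move=> mg g0; apply: measurable_fun_integral_kernel => //.
exact: measurable_kernel.
Qed.

(** Where the norm has a finite integral, [dot (reg a) v] is a difference of
    integrals of nonnegative functions; elsewhere [reg a] is zero. *)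
Lemma norm_measurable_regression : @norm_measurable R _ (borel X) Y reg.
Proof.
apply: (weakly_measurable_norm_measurable de) => v.
pose n (a : borel X) := (\int[kappa a]_y `|(y : Y)|%:E)%E.
pose g (a : borel X) := (\int[kappa a]_y (dot (y : Y) v + `|v| * `|(y : Y)|)%:E)%E.
have mn : measurable_fun setT n by exact: kernel_integral_measurable.
have mdot : measurable_fun [set: borel Y] (fun y : borel Y => dot (y : Y) v).
  by apply: (norm_measurable_dot de norm_measurable_id); exact: norm_measurable_cst.
have mg : measurable_fun setT g.
  apply: kernel_integral_measurable => [|y].
    apply/measurable_EFinP; apply: measurable_funD => //.
    by apply: measurable_funM => //; exact: (norm_measurable_norm norm_measurable_id).
  by rewrite lee_fin; have := cauchy_schwarz (y : Y) v; move=> /ler_normlP[]; lra.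
rewrite (_ : (fun a => _) = (fun a => if (n a < +oo)%E then fine (g a) - `|v| * fine (n a) else 0)).
  apply: measurable_fun_ifT => //.
    by apply: measurable_fun_lte => //; exact: measurable_cst.
  apply: measurable_funB; first exact: measurableT_comp.
  by apply: measurable_funM => //; exact: measurableT_comp.
apply/funext => a; case: ifPn => na.
  have [iy <-] := dot_bochner (kappa_ltoo a) de norm_measurable_id na v.
  have inorm : (kappa a).-integrable setT (EFin \o (fun y : borel Y => `|(y : Y)|)).
    apply/integrableP; split => //.
    by under eq_integral do rewrite /= normr_id.
  have := RintegralD measurableT iy (integrableZl measurableT `|v| inorm).
  rewrite (RintegralZl _ measurableT inorm) => gE.
  have -> : fine (g a) = \int[kappa a]_y (dot (y : Y) v + `|v| * `|(y : Y)|) by [].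
  by rewrite gE addrK.
rewrite /regression (bochner_eq0 (kappa_ltoo a) norm_measurable_id) ?dot0l//.
by apply/eqP; rewrite -leye_eq leNgt.
Qed.

Lemma integral_conditional (F : borel X * borel Y -> \bar R) :
  measurable_fun setT F -> (forall x, (0 <= F x)%E) ->
  (\int[rho]_p F p = \int[rhoX]_a \int[kappa a]_y F (a, y))%E.
Proof.
move=> mF F0.
have marg (G : borel X -> \bar R) : measurable_fun setT G -> (forall a, (0 <= G a)%E) ->
    (\int[rhoX]_a G a = \int[rho]_p G p.1)%E.
  move=> mG G0.
  transitivity (giry_int (giry_map measurable_fst (rho : giry _ R)) G); last by rewrite giry_int_map.
  by apply: eq_measure_integral => A mA _; exact: rhoX_marginal.
rewrite (_ : (fun p => F p) = (fun p => F (p.1, p.2))); last by apply/funext => -[].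
rewrite (@integral_disintegration R _ _ _ _ (borel X) (borel Y) rho fst snd kappa measurable)//.
- rewrite marg// => [|a]; last exact: integral_ge0.
  exact: (@measurable_fun_integral_finite_kernel _ _ (borel X) (borel Y) R F kappa F0 mF).
- exact: measurable_kernel.
- exact: prob_kernel.
- by rewrite smallest_id//; exact: sigma_algebra_measurable.
- exact: measurableI.
move=> E B mE mB.
have -> : fst @^-1` E `&` snd @^-1` B = E `*` B :> set (X * Y) by [].
rewrite kappa_conditional// [LHS]integral_mkcond [RHS]integral_mkcond.
rewrite (marg ((fun a => kappa a B) \_ E)).
- by apply: eq_integral => p _; rewrite !patchE.
- by apply/(measurable_restrictT _ mE); apply: measurable_funTS; exact: measurable_kernel.
- by move=> a; rewrite patchE; case: ifP.
Qed.

Let large : set (borel Y) := [set y | C < `|(y : Y)|].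

Let measurable_large : measurable large.
Proof. exact: (@measurable_norm_gt R _ (borel Y) Y (fun y => y) C norm_measurable_id). Qed.

Let kappaC : {ae rhoX, forall a, kappa a large = 0%E}.
Proof.
have h := kappa_conditional measurableT measurable_large.
have : (\int[rhoX]_a `|kappa a large| = 0)%E.
  under eq_integral => a _ do rewrite gee0_abs//.
  rewrite -h -rhoC; congr (rho _).
  by apply/seteqP; split => -[x y] //= [].
move/ae_eq_integral_abs => /(_ measurableT (measurable_kernel kappa _ measurable_large)).
by apply: filterS => a /(_ I).
Qed.

(** [reg a] is the mean of the conditional law at [a]. *)
Let bias_variance (a : borel X) (v : Y) : kappa a large = 0%E ->
  (\int[kappa a]_y (`|v - y| ^+ 2)%:E =
   (`|reg a - v| ^+ 2)%:E + \int[kappa a]_y (`|reg a - y| ^+ 2)%:E)%E.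
Proof.
move=> kC.
have aeC : {ae kappa a, forall y : borel Y, `|(y : Y)| <= C}.
  by exists large; split => // y /= /negP; rewrite -ltNge.
have bounded_int (f : borel Y -> R) (c : R) : measurable_fun setT f -> (forall y, 0 <= f y) ->
    (forall y, `|(y : Y)| <= C -> f y <= c) -> (kappa a).-integrable setT (EFin \o f).
  move=> mf f0 fc; apply/integrableP; split; first exact/measurable_EFinP.
  apply: (@le_lt_trans _ _ (\int[kappa a]_y (`|c|)%:E)%E).
    apply: ae_ge0_le_integral => //.
    - by apply/measurable_EFinP; exact: measurableT_comp.
    - apply: filterS aeC => y yC _ /=; rewrite lee_fin ger0_norm//.
      by rewrite (le_trans (fc y yC))// ler_norm.
  rewrite (_ : (fun=> _) = cst `|c|%:E)// integral_cst// lte_mul_pinfty// ?lee_fin//.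
have msub (u : Y) : measurable_fun setT (fun y : borel Y => `|u - y|).
  by apply: (norm_measurable_sub de _ norm_measurable_id); exact: norm_measurable_cst.
have iy : (\int[kappa a]_y `|(y : Y)|%:E < +oo)%E.
  have /integrableP[_] := bounded_int (fun y => `|(y : Y)|) C (norm_measurable_norm norm_measurable_id)
    (fun _ => normr_ge0 _) (fun _ => id).
  by under eq_integral do rewrite /= normr_id.
have i2 : (kappa a).-integrable setT (EFin \o (fun y : borel Y => `|reg a - y| ^+ 2)).
  apply: (bounded_int _ ((`|reg a| + C) ^+ 2)).
  - by apply: measurable_funX; exact: msub.
  - by move=> y; exact: sqr_ge0.
  - by move=> y yC; rewrite lerXn2r ?nnegrE ?addr_ge0// (le_trans (ler_normB _ _))// lerD.
have [id dE] := dot_bochner (kappa_ltoo a) de norm_measurable_id iy (reg a - v).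
have ic (c : R) : (kappa a).-integrable setT (EFin \o (fun=> c)).
  exact: (integrable_bounded (kappa_ltoo a) (measurable_cst c) (c := `|c|)).
pose c := `|reg a - v| ^+ 2 - 2 * dot (reg a) (reg a - v).
have i1 : (kappa a).-integrable setT (EFin \o (fun y : borel Y => c + 2 * dot (y : Y) (reg a - v))).
  exact: (integrableD measurableT (ic c) (integrableZl measurableT 2 id)).
have E1 : (\int[kappa a]_y (c + 2 * dot (y : Y) (reg a - v))%:E = (`|reg a - v| ^+ 2)%:E)%E.
  rewrite -[LHS]fineK; last exact: (integrable_fin_num measurableT i1).
  congr EFin; rewrite -/(Rintegral _ _ _).
  rewrite (RintegralD measurableT (ic c) (integrableZl measurableT 2 id)).
  rewrite (RintegralZl _ measurableT id) dE -/(reg a) Rintegral_cst//.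
  have -> : fine (kappa a setT) = 1 by rewrite prob_kernel.
  by rewrite /c mulr1 subrK.
rewrite -E1 -(integralD measurableT i1 i2); apply: eq_integral => y _ /=.
rewrite -EFinD; congr EFin; rewrite /c.
have -> : v - y = (reg a - y) - (reg a - v) by rewrite opprB [RHS]addrC subrKA.
by rewrite sqnormB dotBl; ring.
Qed.

Lemma risk_decomposition (q : X -> Y) : @norm_measurable R _ (borel X) Y q ->
  risk rho q = (sqnormL2 rhoX (fun a => (reg a - q a)%R) + risk rho reg)%E.
Proof.
move=> mq.
have mloss (f : X -> Y) : @norm_measurable R _ (borel X) Y f ->
    measurable_fun [set: borel X * borel Y] (fun p => (`|f p.1 - p.2| ^+ 2)%:E).
  move=> mf; apply/measurable_EFinP; apply: measurable_funX.
  apply: (norm_measurable_sub de).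
    exact: (norm_measurable_comp mf measurable_fst).
  exact: (norm_measurable_comp norm_measurable_id measurable_snd).
have loss0 (f : X -> Y) (p : borel X * borel Y) : (0 <= (`|f p.1 - p.2| ^+ 2)%:E)%E.
  by rewrite lee_fin sqr_ge0.
have mreg := norm_measurable_regression.
rewrite /risk !integral_conditional//; [|exact: mloss|exact: mloss].
have mint (f : X -> Y) : @norm_measurable R _ (borel X) Y f ->
    measurable_fun [set: borel X] (fun a => \int[kappa a]_y (`|f a - y| ^+ 2)%:E)%E.
  move=> mf.
  exact: (@measurable_fun_integral_finite_kernel _ _ (borel X) (borel Y) R _ kappa (loss0 f) (mloss f mf)).
have mdiff : measurable_fun [set: borel X] (fun a => (`|reg a - q a| ^+ 2)%:E).
  by apply/measurable_EFinP; apply: measurable_funX; exact: (norm_measurable_sub de).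
have S0 (a : borel X) : (0 <= (`|reg a - q a| ^+ 2)%:E)%E by rewrite lee_fin sqr_ge0.
have I0 (f : X -> Y) (a : borel X) : (0 <= \int[kappa a]_y (`|f a - y| ^+ 2)%:E)%E.
  by apply: integral_ge0 => y _; rewrite lee_fin sqr_ge0.
have mI := mint reg mreg; have mq' := mint q mq.
rewrite /sqnormL2/= -(@ge0_integralD _ _ _ rhoX setT measurableT
  (fun a => (`|reg a - q a| ^+ 2)%:E) (fun a => \int[kappa a]_y (`|reg a - y| ^+ 2)%:E)%E)//.
apply: ge0_ae_eq_integral => //.
- by apply: emeasurable_funD.
- by move=> a _; rewrite adde_ge0.
by apply: filterS kappaC => a kC _; exact: bias_variance.
Qed.

Lemma risk_bounded (f : X -> Y) (c : R) : @norm_measurable R _ (borel X) Y f ->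
  (forall a, `|f a| <= c) -> (risk rho f <= ((c + C) ^+ 2)%:E)%E.
Proof.
move=> mf fc; rewrite -[leRHS]mule1 -(@probability_setT _ _ _ rho) -integral_cst//.
have aeC : {ae rho, forall p, `|(p.2 : Y)| <= C}.
  exists [set p | C < `|(p.2 : Y)|]; split => //.
    rewrite (_ : [set _ | _] = snd @^-1` large)//.
    by rewrite -[X in measurable X]setTI; exact: measurable_snd.
  by move=> y /= /negP; rewrite -ltNge.
have mrisk : measurable_fun [set: borel X * borel Y] (fun p => (`|f p.1 - p.2| ^+ 2)%:E).
  apply/measurable_EFinP; apply: measurable_funX; apply: (norm_measurable_sub de).
    exact: (norm_measurable_comp mf measurable_fst).
  exact: (norm_measurable_comp norm_measurable_id measurable_snd).
apply: (@ae_ge0_le_integral _ _ _ rho setT measurableT _ (cst ((c + C) ^+ 2)%:E) _ mrisk).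
- by move=> p _; rewrite lee_fin sqr_ge0.
- by move=> p _; rewrite lee_fin sqr_ge0.
- exact: measurable_cst.
have c0 : 0 <= c by apply: le_trans (fc point).
have [A [mA A0 sA]] := aeC; exists A; split => // p /= hp; apply: sA => /= pC.
apply: hp => _; rewrite lee_fin.
by rewrite lerXn2r ?nnegrE ?addr_ge0// (le_trans (ler_normB _ _))// lerD.
Qed.

Lemma risk_ge0 (f : X -> Y) : (0 <= risk rho f)%E.
Proof. by apply: integral_ge0 => p _; rewrite lee_fin sqr_ge0. Qed.

(** The excess risk exceeds the squared approximation error by the gap between
    the risk and its infimum over the hypothesis space. *)
Lemma excess_risk_gap (K : X -> X -> {linear Y -> Y}) (HK : vrkhs K) (B : R) :
  (forall (f : HK) a, `|vrkhs_fun f a| <= B * `|f|) ->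
  (forall f : HK, @norm_measurable R _ (borel X) Y (vrkhs_fun f)) ->
  exists iota : R, [/\ forall f : HK, (iota%:E <= risk rho (vrkhs_fun f))%E,
    forall r : R, 0 < r -> exists f : HK, (risk rho (vrkhs_fun f) < (iota + r)%:E)%E
    & forall f : HK, (excess_risk rho (vrkhs_fun f) reg - sq_approx_error HK rhoX reg =
        risk rho (vrkhs_fun f) - iota%:E)%E].
Proof.
move=> fB mf.
have rfin (f : HK) : risk rho (vrkhs_fun f) \is a fin_num.
  rewrite ge0_fin_numE ?risk_ge0//.
  apply: le_lt_trans (risk_bounded (mf f) (fun a => fB f a)) _.
  by rewrite ltry.
have dec (f : HK) := risk_decomposition (mf f).
have L0 (f : HK) : (0 <= sqnormL2 rhoX (fun a => (reg a - vrkhs_fun f a)%R))%E.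
  by apply: integral_ge0 => a _; rewrite lee_fin sqr_ge0.
have regfin : risk rho reg \is a fin_num.
  rewrite ge0_fin_numE ?risk_ge0//; apply: (@le_lt_trans _ _ (risk rho (vrkhs_fun (0 : HK)))).
    by rewrite dec leeDr.
  by rewrite ltey_eq rfin.
have Lfin (f : HK) : sqnormL2 rhoX (fun a => (reg a - vrkhs_fun f a)%R) \is a fin_num.
  rewrite ge0_fin_numE//; apply: (@le_lt_trans _ _ (risk rho (vrkhs_fun f))).
    by rewrite dec leeDl// risk_ge0.
  by rewrite ltey_eq rfin.
have finE (x : \bar R) : x \is a fin_num -> exists r : R, x = r%:E.
  by move=> xfin; exists (fine x); rewrite fineK.
have Dfin : sq_approx_error HK rhoX reg \is a fin_num.
  rewrite ge0_fin_numE.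
    apply: (@le_lt_trans _ _ (sqnormL2 rhoX (fun a => (reg a - vrkhs_fun (0 : HK) a)%R))).
      by apply: ereal_inf_lbound; exists 0.
    by rewrite ltey_eq Lfin.
  by apply: le_ereal_inf_tmp => _ [q _ <-]; exact: L0.
exists (fine (sq_approx_error HK rhoX reg) + fine (risk rho reg)); split.
- move=> f; rewrite EFinD !fineK// dec leeD2r//.
  by apply: ereal_inf_lbound; exists f.
- move=> r r0; have [_ [f _ <-] fr] := lb_ereal_inf_adherent r0 Dfin.
  exists f; rewrite dec.
  have {fr} : (sqnormL2 rhoX (fun a => (reg a - vrkhs_fun f a)%R) <
    sq_approx_error HK rhoX reg + r%:E)%E := fr.
  have [x ->] := finE _ (Lfin f); have [y ->] := finE _ regfin.
  by have [z ->] := finE _ Dfin; rewrite -!EFinD /= !lte_fin; lra.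
- move=> f; rewrite /excess_risk dec.
  have [x ->] := finE _ (Lfin f); have [y ->] := finE _ regfin.
  by have [z ->] := finE _ Dfin; rewrite /=; congr EFin; ring.
Qed.

End regression.

(** * Averages over a sample *)

Section averages.
Context (R : realType) d (Om : measurableType d) (P : probability Om R).

Let mEFin (F : Om -> R) : measurable_fun setT F -> measurable_fun setT (fun w => (F w)%:E).
Proof. by move=> mF; apply/measurable_EFinP. Qed.

Let integral_sum l (Z : 'I_l -> Om -> R) : (forall i, measurable_fun setT (Z i)) ->
  (forall i w, 0 <= Z i w) ->
  (\int[P]_w (\sum_i Z i w)%:E = \sum_i \int[P]_w (Z i w)%:E)%E.
Proof.
move=> mZ Z0; under eq_integral => w _ do rewrite -sumEFin.
rewrite (@ge0_integral_sum _ _ _ P setT measurableT _ (fun i w => (Z i w)%:E))//.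
- by move=> i; exact: mEFin.
- by move=> i w _; rewrite lee_fin.
Qed.

Let integral_affine (F : Om -> R) (a b : R) : measurable_fun setT F ->
  (forall w, 0 <= F w) -> 0 <= a -> 0 <= b ->
  (\int[P]_w (a * F w + b)%:E = a%:E * \int[P]_w (F w)%:E + b%:E)%E.
Proof.
move=> mF F0 a0 b0; under eq_integral => w _ do rewrite EFinD EFinM.
rewrite (@ge0_integralD _ _ _ P setT measurableT (fun w => a%:E * (F w)%:E)%E (cst b%:E))//.
- rewrite (@ge0_integralZl_EFin _ _ _ P setT measurableT (fun w => (F w)%:E))//.
  + by rewrite integral_probability_cst.
  + by move=> w _; rewrite lee_fin.
  + exact: mEFin.
- by move=> w _; rewrite -EFinM lee_fin mulr_ge0.
- by apply: mEFin; exact: measurable_funM.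
Qed.

(** Markov's inequality for [F - a]. *)
Lemma probability_gap_le (F : Om -> R) (a eps : R) : measurable_fun setT F ->
  0 <= a -> 0 < eps -> (forall w, a <= F w) ->
  (a%:E + eps%:E * P [set w | (eps <= F w - a)%R] <= \int[P]_w (F w)%:E)%E.
Proof.
move=> mF a0 eps0 aF; set A := [set w | _].
have mA : measurable A.
  rewrite (_ : A = (fun w => F w - a) @^-1` `[eps, +oo[%classic).
    by rewrite -[X in measurable X]setTI; apply: measurable_funB.
  by apply/seteqP; split => w /=; rewrite in_itv/= andbT.
have mI : measurable_fun setT (\1_A : Om -> R) by exact: measurable_indic.
have I0 w : 0 <= (\1_A w : R) by rewrite indicE ler0n.
have := integral_affine mI I0 (ltW eps0) a0.
rewrite integral_indic// setIT addeC => <-.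
apply: ge0_le_integral => //.
- by move=> w _; rewrite lee_fin addr_ge0// mulr_ge0// ltW.
- by apply: mEFin; apply: measurable_funD => //; exact: measurable_funM.
- exact: mEFin.
move=> w _; rewrite lee_fin indicE; case: (boolP (w \in A)) => [|_].
  by rewrite inE /A/= mulr1 lerBrDr.
by rewrite mulr0 add0r.
Qed.

(** The bookkeeping of the bound on the expected risk. Here [F] is the risk of the
    estimator, [U i] the risk of the fit without the observation of index [i],
    [V i] the loss of that fit at the observation, [W i] the loss of the
    competitor there and [G i] the squared error of the mean embedding. *)
Lemma integral_average_le l (F : Om -> R) (U V W G : 'I_l -> Om -> R) (a b e w g : R) :
  (0 < l)%N ->
  measurable_fun setT F -> (forall x, 0 <= F x) ->
  (forall i, measurable_fun setT (U i)) -> (forall i x, 0 <= U i x) ->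
  (forall i, measurable_fun setT (V i)) -> (forall i x, 0 <= V i x) ->
  (forall i, measurable_fun setT (W i)) -> (forall i x, 0 <= W i x) ->
  (forall i, measurable_fun setT (G i)) -> (forall i x, 0 <= G i x) ->
  0 <= a -> 0 <= b -> 0 <= e ->
  {ae P, forall x, l%:R * F x <= \sum_i U i x + l%:R * e} ->
  (forall i, \int[P]_x (U i x)%:E = \int[P]_x (V i x)%:E)%E ->
  {ae P, forall x, \sum_i V i x <= \sum_i (W i x + (a * G i x + b))} ->
  (forall i, (\int[P]_x (W i x)%:E <= w%:E)%E) ->
  (forall i, (\int[P]_x (G i x)%:E <= g%:E)%E) ->
  (\int[P]_x (F x)%:E <= (w + (a * g + b) + e)%:E)%E.
Proof.
move=> l0 mF F0 mU U0 mV V0 mW W0 mG G0 a0 b0 e0 FU UV VW Ww Gg.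
have lR : 0 < (l%:R : R) by rewrite ltr0n.
have le0 : 0 <= l%:R * e by rewrite mulr_ge0.
have sum0 (Z : 'I_l -> Om -> R) x : (forall i x, 0 <= Z i x) -> 0 <= \sum_i Z i x.
  by move=> Z0; apply: sumr_ge0.
rewrite -(@lee_pmul2l _ l%:R%:E) ?lte_fin//.
have FU' : (l%:R%:E * \int[P]_x (F x)%:E <= \int[P]_x (1 * (\sum_i U i x) + l%:R * e)%:E)%E.
  have := integral_affine mF F0 (ltW lR) (lexx 0); rewrite adde0 => <-.
  apply: (@ae_ge0_le_integral _ _ _ P setT measurableT).
  - by move=> x _; rewrite addr0 lee_fin mulr_ge0.
  - by apply: mEFin; under eq_fun do rewrite addr0; exact: measurable_funM.
  - by move=> x _; rewrite lee_fin mul1r addr_ge0// sum0.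
  - by apply: mEFin; under eq_fun do rewrite mul1r; apply: measurable_funD => //; exact: measurable_sum.
  - have [A [mA A0 sA]] := FU; exists A; split => // x /= hx; apply: sA => /= h.
    by apply: hx => _; rewrite lee_fin addr0 mul1r.
apply: le_trans FU' _.
rewrite integral_affine//; last 2 first.
  by exact: measurable_sum.
  by move=> x; exact: sum0.
rewrite mul1e integral_sum//.
rewrite (eq_bigr (fun i => \int[P]_x (V i x)%:E)%E) => [|i _]; last exact: UV.
rewrite -integral_sum// -EFinM mulrDr [X in (_ <= X)%E]EFinD leeD2r//.
have mGi i : measurable_fun setT (fun x => a * G i x + b).
  by apply: measurable_funD => //; exact: measurable_funM.
have G0i i x : 0 <= a * G i x + b by rewrite addr_ge0// mulr_ge0.
have mS i : measurable_fun setT (fun x => W i x + (a * G i x + b)) by exact: measurable_funD.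
have S0 i x : 0 <= W i x + (a * G i x + b) by rewrite addr_ge0.
have VW' : (\int[P]_x (\sum_i V i x)%:E <= \int[P]_x (\sum_i (W i x + (a * G i x + b)))%:E)%E.
  apply: (@ae_ge0_le_integral _ _ _ P setT measurableT).
  - by move=> x _; rewrite lee_fin sum0.
  - by apply: mEFin; exact: measurable_sum.
  - by move=> x _; rewrite lee_fin; apply: (sum0 (fun i x => W i x + (a * G i x + b))).
  - by apply: mEFin; apply: (@measurable_sum _ _ _ _ _ _ (fun i x => W i x + (a * G i x + b))).
  - have [A [mA A0 sA]] := VW; exists A; split => // x /= hx; apply: sA => /= h.
    by apply: hx => _; rewrite lee_fin.
apply: le_trans VW' _; rewrite (integral_sum mS S0).
rewrite mulr_natl -[X in (_ <= (_ *+ X)%:E)%E](card_ord l) -sumr_const -sumEFin.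
apply: lee_sum => i _.
under eq_integral => x _ do rewrite EFinD.
rewrite (@ge0_integralD _ _ _ P setT measurableT (fun x => (W i x)%:E)
  (fun x => (a * G i x + b)%:E))//.
- rewrite [(_ + (_ + b))%:E]EFinD leeD//.
  rewrite integral_affine//.
  by rewrite [X in (_ <= X)%E]EFinD EFinM leeD2r// lee_wpmul2l// lee_fin.
- by move=> x _; rewrite lee_fin.
- exact: mEFin.
- by move=> x _; rewrite lee_fin.
- exact: mEFin.
Qed.

End averages.

(** * Expected risk of the estimator *)

Lemma ridge_ext (R : realType) (X : ptopologicalType) (Y : hilbertType R)
    (K : X -> X -> {linear Y -> Y}) (HK : vrkhs K) (lambda : R) l
    (a b : nat -> X) (y z : nat -> Y) :
  (forall i, (i < l)%N -> a i = b i /\ y i = z i) ->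
  ridge HK lambda l a y = ridge HK lambda l b z.
Proof.
move=> ab; rewrite /ridge; suff -> : @objective R X Y K HK lambda l a y = objective lambda l b z by [].
apply/funext => f; rewrite /objective; congr (_ * _ + _).
by apply: eq_bigr => i _; have [-> ->] := ab i (ltn_ord i).
Qed.

(** A Hoelder modulus is controlled by a second moment: beyond the scale [s], the
    power [h] of [t / s] is below its square. *)
Lemma powR_le_quadratic (R : realType) (h s t : R) : 0 < h -> h <= 1 -> 0 < s ->
  0 <= t -> t `^ h <= s `^ h * (1 + t ^+ 2 / s ^+ 2).
Proof.
move=> h0 h1 s0 t0.
have [ts|ts] := leP t s.
  apply: (@le_trans _ _ (s `^ h)).
    by apply: ge0_ler_powR; rewrite ?nnegrE ?(ltW h0) ?(ltW s0).
  by rewrite ler_peMr ?powR_ge0// lerDl divr_ge0// sqr_ge0.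
have ts1 : 1 <= t / s by rewrite ler_pdivlMr// mul1r ltW.
have -> : t `^ h = s `^ h * (t / s) `^ h.
  by rewrite -powRM ?(ltW s0) ?divr_ge0 ?(ltW s0)// mulrC divfK// gt_eqF.
rewrite ler_wpM2l ?powR_ge0// -expr_div_n.
apply: (@le_trans _ _ ((t / s) `^ 2%:R)).
  by apply: ler_powR => //; rewrite (le_trans h1)// ler1n.
by rewrite powR_mulrn ?divr_ge0 ?(ltW s0)// lerDr.
Qed.

Section expected_risk.
Context (R : realType) (T : ptopologicalType) (sepT : separable T)
  (k : T -> T -> R) (kc : continuous (fun p : T * T => k p.1 p.2))
  (Bk : R) (kB : forall u, k u u <= Bk) (H : rkhs k)
  (Y : hilbertType R) (e' : nat -> Y) (de' : dense_seq e')
  (K : embeddings H -> embeddings H -> {linear Y -> Y}) (HK : vrkhs K)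
  (B : R) (B0 : 0 <= B) (fB : forall (f : HK) a, `|vrkhs_fun f a| <= B * `|f|)
  (L h : R) (L0 : 0 < L) (h0 : 0 < h) (h1 : h <= 1)
  (fL : forall (f : HK) (a b : embeddings H),
    `|vrkhs_fun f a - vrkhs_fun f b| <= L * `|val a - val b| `^ h * `|f|)
  (M : probability (borel (measures R T) * borel Y)%type R)
  (c : R) (c0 : 0 <= c) (Mc : M [set p | c < `|(p.2 : Y)|] = 0%E)
  (rho : probability (borel (embeddings H) * borel Y)%type R)
  (rho_law : is_law rho M (fun p => (embed H p.1, p.2))).

Local Notation pairs := (borel (measures R T) * borel Y)%type.
Local Notation X := (embeddings H).

Let iota (a : X) : H := val a.

Let embed_pair (p : pairs) : borel X * borel Y := (embed H (p.1 : measures R T), p.2).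

Let embed_pair_measurable : measurable_fun setT embed_pair.
Proof.
apply: measurable_fun_pair; last exact: measurable_snd.
apply: (embeddings_measurable_fun sepT kc).
exact: (norm_measurable_comp (norm_measurable_mean_embedding sepT kc kB (H := H)) measurable_fst).
Qed.

Lemma norm_measurable_vrkhs_fun (f : HK) : @norm_measurable R _ (borel X) Y (vrkhs_fun f).
Proof.
have [e de] := rkhs_dense_seq sepT kc H.
move=> v; apply: (@data_measurable R X Y H iota _ (borel X) e e' 1 (fun _ a => a) (fun _ _ => 0)
  (fun a _ => `|vrkhs_fun f (a 0%N) - v|)) => //.
- by move=> _ _; exact: norm_measurable_val.
- by move=> _ _; exact: norm_measurable_cst.
move=> a y r r0.
have c1 : 0 < L * `|f| + 1 by rewrite ltr_wpDl// mulr_ge0// ltW.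
have [s s0 hs] := powR_cvg0 h0 (divr_gt0 r0 c1).
exists s => // b z /(_ 0%N isT)[ab _].
apply: le_lt_trans (ler_dist_dist _ _) _; rewrite opprB addrA subrK.
apply: le_lt_trans (fL _ _ _) _.
have := hs _ (normr_ge0 _) ab; set t := _ `^ h => ht.
have t0 : 0 <= t by exact: powR_ge0.
apply: (@le_lt_trans _ _ (t * (L * `|f| + 1))).
  by rewrite mulrAC [leLHS]mulrC ler_wpM2l// lerDl.
by rewrite -ltr_pdivlMr.
Qed.

Let loss_measurable (f : HK) : measurable_fun [set: borel X * borel Y] (fun p => loss f p).
Proof.
apply: measurable_funX; apply: (norm_measurable_sub de').
  exact: (norm_measurable_comp (norm_measurable_vrkhs_fun f) measurable_fst).
exact: (norm_measurable_comp (@norm_measurable_id R Y) measurable_snd).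
Qed.

Lemma risk_embed (f : HK) :
  risk rho (vrkhs_fun f) = (\int[M]_p (loss f (embed_pair p))%:E)%E.
Proof.
transitivity (giry_int (giry_map embed_pair_measurable (M : giry _ R)) (fun p => (loss f p)%:E)).
  by apply: eq_measure_integral => A mA _; exact: rho_law.
rewrite giry_int_map//; first exact/measurable_EFinP.
by move=> x; rewrite lee_fin loss_ge0.
Qed.

Let norm_measurable_label d (Z : measurableType d) :
  @norm_measurable R _ (Z * borel Y)%type Y (fun p => p.2).
Proof. exact: (norm_measurable_comp (@norm_measurable_id R Y) measurable_snd). Qed.

Let aeM : {ae M, forall p, `|(p.2 : Y)| <= c}.
Proof.
exists [set p | c < `|(p.2 : Y)|]; split => //; last by move=> p /= /negP; rewrite -ltNge.
exact: (@measurable_norm_gt R _ (borel (measures R T) * borel Y)%type Y snd c (@norm_measurable_label _ (borel (measures R T)))).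
Qed.

Let rhoc : rho [set p | c < `|(p.2 : Y)|] = 0%E.
Proof.
by rewrite rho_law//; exact: (@measurable_norm_gt R _ (borel X * borel Y)%type Y snd c (@norm_measurable_label _ (borel X))).
Qed.

Lemma risk_fin_num (f : HK) : risk rho (vrkhs_fun f) \is a fin_num.
Proof.
rewrite ge0_fin_numE ?risk_ge0//.
exact: le_lt_trans (risk_bounded de' c0 rhoc (norm_measurable_vrkhs_fun f) (fun a => fB f a)) (ltry _).
Qed.

Definition real_risk (f : HK) : R := fine (risk rho (vrkhs_fun f)).

Lemma real_riskE f : (real_risk f)%:E = risk rho (vrkhs_fun f).
Proof. by rewrite /real_risk fineK// risk_fin_num. Qed.

Lemma real_risk_ge0 f : 0 <= real_risk f.
Proof. by rewrite -lee_fin real_riskE risk_ge0. Qed.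

Lemma real_risk_lipschitz (f g : HK) (r : R) : `|f| <= r -> `|g| <= r ->
  real_risk f <= real_risk g + B * `|f - g| * (2 * (B * r + c)).
Proof.
move=> fr gr; set D := B * `|f - g| * _.
have D0 : 0 <= D by rewrite !mulr_ge0// addr_ge0// mulr_ge0// (le_trans _ fr).
rewrite -lee_fin EFinD !real_riskE !risk_embed.
have mE (u : HK) : measurable_fun setT (fun p : pairs => (loss u (embed_pair p))%:E).
  apply/measurable_EFinP; exact: (measurableT_comp (loss_measurable u) embed_pair_measurable).
have l0 (u : HK) (p : pairs) : (0 <= (loss u (embed_pair p))%:E)%E by rewrite lee_fin loss_ge0.
have -> : D%:E = (\int[M]_p (cst D%:E) p)%E.
  by rewrite integral_probability_cst.
have mD : measurable_fun [set: pairs] (cst D%:E) by exact: measurable_cst.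
rewrite -(@ge0_integralD _ _ _ M setT measurableT (fun p => (loss g (embed_pair p))%:E) (cst D%:E))//.
apply: (@ae_ge0_le_integral _ _ _ M setT measurableT _ _ _ (mE f) _
  (emeasurable_funD (mE g) mD)) => //.
  by move=> p _; rewrite adde_ge0// lee_fin.
have [A [mA A0 sA]] := aeM; exists A; split => // p /= hp; apply: sA => /= pC.
apply: hp => _; rewrite -EFinD lee_fin.
have := loss_lipschitz_fun B0 fB (p := embed_pair p) fr gr pC.
by move=> /ler_normlP[_]; rewrite -/D; lra.
Qed.

Section sample.
Context (l N : nat) (N0 : (0 < N)%N) (l0 : (0 < l)%N) (S : two_stage_sample M l N)
  (lambda : R) (lambda0 : 0 < lambda).

Local Notation Om := (sample_space S).
Local Notation P := (sample_prob S).
Local Notation rdg := (@ridge R X Y K HK lambda l).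

Let bag_embed i w : X := embed H (empirical R N (fun n => bag S i n w)).

Let fit w : HK := rdg (bag_embed ^~ w) (label S ^~ w).

Let bag_embed_sum i w : iota (bag_embed i w) = N%:R^-1 *: \sum_(n < N) rkhs_section H (baire_bag (S := S) i n w).
Proof. exact: (mean_embedding_empirical sepT kc kB). Qed.

Let bag_embed_measurable d' (Om' : measurableType d') (F : nat -> nat -> Om' -> baire R T) i :
  (forall n, (n < N)%N -> measurable_fun setT (F i n)) ->
  norm_measurable (fun w => N%:R^-1 *: \sum_(n < N) rkhs_section H (F i n w)).
Proof.
have [e de] := rkhs_dense_seq sepT kc H.
move=> mF; apply: norm_measurableZ.
apply: (@norm_measurable_sum _ _ _ H e N (fun n w => rkhs_section H (F i n w))) => // n nN.
exact: (norm_measurable_comp (norm_measurable_section_baire kc (H := H)) (mF n nN)).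
Qed.

(** The risk is Lipschitz in the fit, and the fit is continuous in the data. *)
Lemma estimator_risk_measurable : measurable_fun setT (fun w => real_risk (fit w)).
Proof.
have [e de] := rkhs_dense_seq sepT kc H.
apply: (@data_measurable R X Y H iota _ Om e e' l bag_embed (fun i w => label S i w)
  (fun a y => real_risk (rdg a y))) => //.
- move=> i il; rewrite (_ : _ \o _ = (fun w => N%:R^-1 *: \sum_(n < N) rkhs_section H (baire_bag (S := S) i n w))).
    by apply: bag_embed_measurable => n nN; exact: baire_bag_measurable.
  by apply/funext => w; exact: bag_embed_sum.
- move=> i il; exact: (norm_measurable_comp (@norm_measurable_id R Y) (label_measurable il)).
move=> a y r r0; pose f := rdg a y; pose r1 := `|f| + 1.
have D0 : 0 <= B * (2 * (B * r1 + c)).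
  by rewrite !mulr_ge0// addr_ge0// mulr_ge0// addr_ge0.
have D1 : 0 < B * (2 * (B * r1 + c)) + 1 by rewrite ltr_wpDl.
have e0 : 0 < Num.min 1 (r / (B * (2 * (B * r1 + c)) + 1)) by rewrite lt_min ltr01 divr_gt0.
have [s s0 hs] := ridge_continuous B0 fB L0 h0 fL lambda0 l a y e0.
exists s => // b z /hs; rewrite -/f; set g := rdg b z.
rewrite lt_min => /andP[fg1 fg].
have fr : `|f| <= r1 by rewrite lerDl.
have gr : `|g| <= r1.
  rewrite -(subrK f g) (le_trans (ler_normD _ _))// addrC lerD2l distrC ltW//.
have d1 := real_risk_lipschitz fr gr; have d2 := real_risk_lipschitz gr fr.
have : B * `|f - g| * (2 * (B * r1 + c)) < r.
  rewrite ltr_pdivlMr// in fg; apply: le_lt_trans fg.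
  by rewrite mulrAC [leLHS]mulrC ler_wpM2l// lerDl.
rewrite (distrC g f) in d2; rewrite ltr_norml.
by move: d1 d2; set q := B * _ * _; lra.
Qed.

(** The observation of index [i] is replaced by a constant one, so that the size
    of the data set does not change. *)
Let fit_without (i : nat) w : HK :=
  rdg (fun j => if j == i then point else bag_embed j w)
    (fun j => if j == i then 0 else label S j w).

Let observation i w : X * Y := (bag_embed i w, label S i w).

Let loss_fit_without_measurable i : (i < l)%N ->
  measurable_fun [set: others S i * pairs]
    (fun x => (loss (fit_without i x.1) (embed_pair x.2))%:E).
Proof.
move=> il; have [e de] := rkhs_dense_seq sepT kc H.
apply/measurable_EFinP.
pose F j (x : others S i * pairs) : X :=
  if j == l then embed H (x.2.1 : measures R T) else if j == i then point else bag_embed j x.1.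
pose G j (x : others S i * pairs) : Y :=
  if j == l then (x.2.2 : Y) else if j == i then 0 else (label S j x.1 : Y).
have m21 : measurable_fun setT (fun x : others S i * pairs => x.2.1).
  by apply: measurableT_comp => //; exact: measurable_snd.
have m22 : measurable_fun setT (fun x : others S i * pairs => x.2.2).
  by apply: measurableT_comp => //; exact: measurable_snd.
rewrite (_ : (fun x => _) = (fun x => loss (rdg (F ^~ x) (G ^~ x)) (F l x, G l x))).
  apply: (@ridge_measurable R X Y H iota K HK B B0 fB L h L0 h0 fL lambda lambda0 l _
    (others S i * pairs)%type e e' F G (fun f p y => loss f (p, y))) => //.
  - move=> j jl; rewrite /F; have [_|jnl] := eqVneq j l.
      exact: (norm_measurable_comp (norm_measurable_mean_embedding sepT kc kB (H := H)) m21).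
    have [_|ji] := eqVneq j i; first exact: norm_measurable_cst.
    have {jl jnl} jl : (j < l)%N by rewrite ltn_neqAle jnl jl.
    rewrite (_ : _ \o _ = (fun x : others S i * pairs =>
      N%:R^-1 *: \sum_(n < N) rkhs_section H (baire_bag (S := S) j n x.1))).
      apply: (@bag_embed_measurable _ (others S i * pairs)%type
        (fun j n (x : others S i * pairs) => baire_bag (S := S) j n x.1) j) => n nN.
      exact: (measurableT_comp (baire_bag_others_measurable jl ji nN) measurable_fst).
    by apply/funext => x; exact: bag_embed_sum.
  - move=> j jl; rewrite /G; have [_|jnl] := eqVneq j l.
      exact: (norm_measurable_comp (@norm_measurable_id R Y) m22).
    have [_|ji] := eqVneq j i; first exact: norm_measurable_cst.
    have {jl jnl} jl : (j < l)%N by rewrite ltn_neqAle jnl jl.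
    apply: (norm_measurable_comp (@norm_measurable_id R Y)).
    exact: (measurableT_comp (label_others_measurable jl ji) measurable_fst).
  - by move=> f p y r r0; exact: (loss_jointly_continuous B0 fB L0 h0 fL).
apply/funext => x; rewrite /F /G !eqxx /=; congr (loss _ _).
apply: ridge_ext => j jl; rewrite (ltn_eqF jl); by split.
Qed.

(** The fit without the [i]-th observation is independent of that observation,
    so that its loss there is an unbiased estimate of its risk. *)
Let integral_leave_one_out i : (i < l)%N ->
  (\int[P]_w (loss (fit_without i w) (embed_pair (sample_pair (S := S) i w)))%:E =
   \int[P]_w (real_risk (fit_without i w))%:E)%E.
Proof.
move=> il.
rewrite (integral_sample_independent il (loss_fit_without_measurable il)); last first.
  by move=> x; rewrite lee_fin loss_ge0.
by apply: eq_integral => w _; rewrite real_riskE risk_embed.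
Qed.

Let real_risk_fit_without_measurable i : (i < l)%N ->
  measurable_fun setT (fun w : Om => (real_risk (fit_without i w))%:E).
Proof.
move=> il; rewrite (_ : (fun w => _) = (fun w : Om => \int[M]_p
    (loss (fit_without i w) (embed_pair p))%:E)%E); last first.
  by apply/funext => w; rewrite real_riskE risk_embed.
pose F (x : others S i * pairs) := (loss (fit_without i x.1) (embed_pair x.2))%:E.
have mM : measurable_fun [set: others S i] (fun w => \int[M]_p F (w, p))%E.
  apply: (@measurable_fun_fubini_tonelli_F _ _ _ _ _ M F) => [|x].
    exact: loss_fit_without_measurable.
  by rewrite lee_fin loss_ge0.
exact: (measurableT_comp mM (@measurable_id_others R T Y M l N S i)).
Qed.

Let ae_label : {ae P, forall w, forall i, (i < l)%N -> `|(label S i w : Y)| <= c}.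
Proof.
apply: ae_foralln => i; have [il|il] := ltnP i l; last by apply: aeW => w.
pose A : set pairs := [set p | c < `|(p.2 : Y)|].
have mA : measurable A.
  exact: (@measurable_norm_gt R _ (borel (measures R T) * borel Y)%type Y snd c (@norm_measurable_label _ (borel (measures R T)))).
exists (sample_pair (S := S) i @^-1` A); split.
- by rewrite -[X in measurable X]setTI; exact: sample_pair_measurable.
- by have := sample_pair_law S il mA; rewrite Mc.
by move=> w /= hw; rewrite /A/= ltNge; apply/negP => yc; apply: hw.
Qed.

Let gap i w : R := `|iota (bag_embed i w) - mean_embedding H (dist i w : measures R T)|.

Let loss_gap (f : HK) i w (r : R) : `|f| <= r -> `|(label S i w : Y)| <= c ->
  `|loss f (observation i w) - loss f (embed_pair (sample_pair (S := S) i w))| <=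
  L * gap i w `^ h * r * (2 * (B * r + c)).
Proof.
move=> fr yc; have r0 : 0 <= r by exact: le_trans fr.
apply: le_trans (loss_lipschitz_point B0 fB (p := observation i w)
  (q := embed_pair (sample_pair (S := S) i w)) fr yc yc) _.
apply: ler_wpM2r; first by rewrite mulr_ge0// addr_ge0// mulr_ge0.
rewrite /= subrr normr0 addr0 (le_trans (fL _ _ _))// ler_wpM2l//.
by rewrite mulr_ge0 ?powR_ge0// ltW.
Qed.

Let gap_measurable i : (i < l)%N -> measurable_fun setT (gap i).
Proof.
move=> il; have [e de] := rkhs_dense_seq sepT kc H.
apply: (norm_measurable_sub de (F := fun w => iota (bag_embed i w))).
  rewrite (_ : (fun w => _) = (fun w => N%:R^-1 *: \sum_(n < N) rkhs_section H (baire_bag (S := S) i n w))).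
    by apply: bag_embed_measurable => n nN; exact: baire_bag_measurable.
  by apply/funext => w; exact: bag_embed_sum.
exact: (norm_measurable_comp (norm_measurable_mean_embedding sepT kc kB (H := H)) (dist_measurable il)).
Qed.

Let r := c / Num.sqrt lambda.
Let D := B * r + c.
(** The effect of replacing one observation, on the risk and on any loss. *)
Let beta := B * (4 * B * D / (lambda * l%:R)) * (2 * D).

Let r0 : 0 <= r. Proof. by rewrite divr_ge0// sqrtr_ge0. Qed.
Let D0 : 0 <= D. Proof. by rewrite addr_ge0// mulr_ge0. Qed.
Let beta0 : 0 <= beta.
Proof. by rewrite !mulr_ge0// invr_ge0 mulr_ge0// ltW. Qed.

Let fit_le w : (forall i, (i < l)%N -> `|(label S i w : Y)| <= c) -> `|fit w| <= r.
Proof. exact: (ridge_bounded B0 fB lambda0 (bag_embed ^~ w) c0). Qed.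

Let label_without i w j : (forall j, (j < l)%N -> `|(label S j w : Y)| <= c) ->
  (j < l)%N -> `|if j == i then 0 else (label S j w : Y)| <= c.
Proof. by move=> yc jl; case: ifP => _; rewrite ?normr0//; exact: yc. Qed.

Let fit_without_le i w : (forall j, (j < l)%N -> `|(label S j w : Y)| <= c) ->
  `|fit_without i w| <= r.
Proof.
move=> yc; apply: (ridge_bounded B0 fB lambda0 _ c0) => j jl; exact: label_without.
Qed.

Let fit_without_close (i : 'I_l) w : (forall j, (j < l)%N -> `|(label S j w : Y)| <= c) ->
  `|fit w - fit_without i w| <= 4 * B * D / (lambda * l%:R).
Proof.
move=> yc; apply: (ridge_stability B0 fB lambda0 (j := i)) => //.
  by move=> j jl; exact: label_without.
by move=> j /negPf ji; rewrite -!val_eqE/= in ji *; rewrite ji.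
Qed.

Let risk_stable (i : 'I_l) w : (forall j, (j < l)%N -> `|(label S j w : Y)| <= c) ->
  real_risk (fit w) <= real_risk (fit_without i w) + beta.
Proof.
move=> yc; apply: le_trans (real_risk_lipschitz (fit_le yc) (fit_without_le i yc)) _.
by rewrite lerD2l ler_wpM2r ?mulr_ge0// ler_wpM2l// fit_without_close.
Qed.

Let loss_stable (i : 'I_l) w (p : X * Y) : (forall j, (j < l)%N -> `|(label S j w : Y)| <= c) ->
  `|p.2| <= c -> loss (fit_without i w) p <= loss (fit w) p + beta.
Proof.
move=> yc pc.
have := loss_lipschitz_fun B0 fB (fit_without_le i yc) (fit_le yc) pc.
move=> /ler_normlP[_]; rewrite lerBlDl => h'; apply: le_trans h' _.
by rewrite lerD2l ler_wpM2r ?mulr_ge0// ler_wpM2l// distrC fit_without_close.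
Qed.

(** Stability is used twice, once to pass from the risk of the fit to the risk
    without an observation and once to restore that observation in the losses;
    the Hoelder terms pay for the two exchanges of embeddings. *)
Lemma expected_risk_le (q : HK) :
  (\int[P]_w (real_risk (fit w))%:E <=
   (real_risk q + lambda * `|q| ^+ 2 + 2 * beta +
    L * (r * (2 * D) + `|q| * (2 * (B * `|q| + c))) *
      Num.sqrt (N%:R^-1) `^ h * (1 + 4 * Bk))%:E)%E.
Proof.
set kap := L * _; set sh := _ `^ h.
have q0 : 0 <= `|q| * (2 * (B * `|q| + c)) by rewrite !mulr_ge0// addr_ge0// mulr_ge0.
have kap0 : 0 <= kap by rewrite mulr_ge0 ?(ltW L0)// addr_ge0// mulr_ge0// mulr_ge0.
have sh0 : 0 <= sh by exact: powR_ge0.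
have NR : 0 < (N%:R : R) by rewrite ltr0n.
have lR : 0 < (l%:R : R) by rewrite ltr0n.
have s0 : 0 < Num.sqrt (N%:R^-1 : R) by rewrite sqrtr_gt0 invr_gt0.
have gap_le i w : gap i w `^ h <= sh * (1 + N%:R * gap i w ^+ 2).
  apply: le_trans (powR_le_quadratic h0 h1 s0 (normr_ge0 _)) _.
  by rewrite sqr_sqrtr ?invr_ge0 ?ler0n// invrK (mulrC N%:R).
apply: (@le_trans _ _ (real_risk q + (kap * sh * N%:R * (4 * Bk / N%:R) +
    (lambda * `|q| ^+ 2 + beta + kap * sh)) + beta)%:E).
  apply: (@integral_average_le R _ Om P l (fun w => real_risk (fit w))
    (fun i w => real_risk (fit_without i w))
    (fun i w => loss (fit_without i w) (embed_pair (sample_pair (S := S) i w)))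
    (fun i w => loss q (embed_pair (sample_pair (S := S) i w)))
    (fun i w => gap i w ^+ 2)).
  - exact: l0.
  - exact: estimator_risk_measurable.
  - by move=> w; exact: real_risk_ge0.
  - by move=> i; apply/measurable_EFinP; exact: real_risk_fit_without_measurable.
  - by move=> i w; exact: real_risk_ge0.
  - move=> i; apply/measurable_EFinP.
    have mp : measurable_fun setT (fun w : Om => ((w : others S i), sample_pair (S := S) i w)).
      apply: measurable_fun_pair; last exact: sample_pair_measurable.
      exact: measurable_id_others.
    exact: (measurableT_comp (loss_fit_without_measurable (ltn_ord i)) mp).
  - by move=> i w; exact: loss_ge0.
  - move=> i; apply: (measurableT_comp (loss_measurable q)).
    exact: (measurableT_comp embed_pair_measurable (sample_pair_measurable (ltn_ord i))).
  - by move=> i w; exact: loss_ge0.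
  - by move=> i; apply: measurable_funX; exact: gap_measurable.
  - by move=> i w; exact: sqr_ge0.
  - exact: (mulr_ge0 (mulr_ge0 kap0 sh0) (ltW NR)).
  - exact: (addr_ge0 (addr_ge0 (mulr_ge0 (ltW lambda0) (sqr_ge0 _)) beta0) (mulr_ge0 kap0 sh0)).
  - exact: beta0.
  - apply: filterS ae_label => w yc.
    rewrite mulr_natl -[X in _ *+ X](card_ord l) -sumr_const mulr_natl.
    rewrite -[X in _ *+ X](card_ord l) -sumr_const -big_split/=.
    by apply: ler_sum => i _; exact: risk_stable.
  - by move=> i; rewrite (integral_leave_one_out (ltn_ord i)).
  - apply: filterS ae_label => w yc.
    have yi (i : 'I_l) := yc i (ltn_ord i).
    (* restore the observation, then replace the true embedding by the empirical one *)
    have step1 (i : 'I_l) : loss (fit_without i w) (embed_pair (sample_pair (S := S) i w)) <=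
        loss (fit w) (observation i w) + (beta + L * r * (2 * D) * gap i w `^ h).
      apply: le_trans (loss_stable i (p := embed_pair (sample_pair (S := S) i w)) yc (yi i)) _.
      have /ler_normlP[] := loss_gap (fit_le yc) (yi i).
      rewrite -/D; set t := gap i w `^ h.
      rewrite (_ : L * t * r * (2 * D) = L * r * (2 * D) * t); last by ring.
      by move=> u1 _; lra.
    (* back to the true embedding, for the competitor *)
    have step2 (i : 'I_l) : loss q (observation i w) <=
        loss q (embed_pair (sample_pair (S := S) i w)) +
        L * (`|q| * (2 * (B * `|q| + c))) * gap i w `^ h.
      have /ler_normlP[_] := loss_gap (lexx `|q|) (yi i).
      set t := gap i w `^ h.
      rewrite (_ : L * t * `|q| * _ = L * (`|q| * (2 * (B * `|q| + c))) * t); last by ring.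
      by move=> u1; lra.
    have fitq : \sum_(i < l) loss (fit w) (observation i w) <=
        \sum_(i < l) (loss q (observation i w) + lambda * `|q| ^+ 2).
      have := ridge_min B0 fB lambda0 l (bag_embed ^~ w) (label S ^~ w) q.
      rewrite !objectiveE -/(fit w) => J.
      rewrite big_split/= sumr_const card_ord -mulr_natl.
      rewrite -(ler_pM2l (x := l%:R^-1)) ?invr_gt0// mulrDr mulKf ?gt_eqF//.
      apply: le_trans J; by rewrite lerDl mulr_ge0 ?sqr_ge0 ?(ltW lambda0).
    apply: (@le_trans _ _ (\sum_(i < l) (loss (fit w) (observation i w) +
        (beta + L * r * (2 * D) * gap i w `^ h)))).
      by apply: ler_sum => i _; exact: step1.
    rewrite big_split/=.
    apply: le_trans (lerD fitq (lexx _)) _; rewrite -big_split/=.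
    apply: ler_sum => i _.
    have gi := gap_le i w; have s2 := step2 i.
    have kg : kap * gap i w `^ h <= kap * (sh * (1 + N%:R * gap i w ^+ 2)) by rewrite ler_wpM2l.
    rewrite {1}/kap mulrDr mulrDl mulrA in kg.
    move: kg s2; set t1 := _ * gap i w `^ h; set t2 := _ * gap i w `^ h.
    rewrite (_ : kap * (sh * _) = kap * sh * N%:R * gap i w ^+ 2 + kap * sh); last by ring.
    by lra.
  - move=> i; rewrite real_riskE risk_embed.
    rewrite (integral_sample_pair S (ltn_ord i) (F := fun p => (loss q (embed_pair p))%:E))//.
      apply/measurable_EFinP; exact: (measurableT_comp (loss_measurable q) embed_pair_measurable).
    by move=> p; rewrite lee_fin loss_ge0.
  - by move=> i; exact: (bag_mean_variance sepT kc kB H S (ltn_ord i) N0).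
rewrite lee_fin (_ : _ * (4 * Bk / _) = kap * sh * (4 * Bk)); last first.
  by rewrite -(mulrA _ N%:R) (mulrCA N%:R) mulfV ?mulr1// gt_eqF.
by lra.
Qed.

End sample.

End expected_risk.

(** * Rates and conclusion *)

(** The logarithm is at least one as soon as [l] exceeds Euler's number. *)
Lemma bag_size_ge (R : realType) (h : R) l : 0 < h -> (1 <= l)%N -> expR 1 <= (l%:R : R) ->
  (l%:R : R) <= (bag_size h l)%:R `^ h.
Proof.
move=> h0 l1 el; have lR : 1 <= (l%:R : R) by rewrite ler1n.
have ln1 : 1 <= ln (l%:R : R).
  by rewrite -[leLHS](expRK 1) ler_ln ?posrE ?expR_gt0// (lt_le_trans ltr01).
have p0 : 0 <= (l%:R : R) `^ h^-1 by exact: powR_ge0.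
have bl : (l%:R : R) `^ h^-1 <= (bag_size h l)%:R.
  apply: (@le_trans _ _ ((l%:R : R) `^ h^-1 * ln (l%:R : R))); first by rewrite ler_peMr.
  have ge0 : 0 <= (l%:R : R) `^ h^-1 * ln (l%:R : R) by rewrite mulr_ge0// (le_trans ler01).
  rewrite /bag_size natr_absz ger0_norm; first exact: ceil_ge.
  by rewrite ceil_ge0 (lt_le_trans _ ge0)// oppr_lt0.
have {1}-> : (l%:R : R) = (l%:R `^ h^-1) `^ h.
  by rewrite -powRrM mulVf ?lt0r_neq0// powRr1// (le_trans ler01).
by apply: ge0_ler_powR => //; rewrite ?nnegrE// ltW.
Qed.

(** In terms of [u = 1 / (lambda sqrt l)], the stability terms are of order
    [u ^+ 2] and the cost of the finite bags is of order [u], because the bag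
    size brings the power [h] of the deviation [N ^ (- 1 / 2)] below
    [1 / sqrt l]. *)
Lemma excess_bound (R : realType) (B c L h Bk Q lambda : R) (l N : nat) :
  0 <= B -> 0 <= c -> 0 <= L -> 0 <= Bk -> 0 <= Q -> 0 < lambda -> lambda <= 1 ->
  (0 < l)%N -> (0 < N)%N -> (l%:R : R) <= N%:R `^ h ->
  forall r D u : R, r = c / Num.sqrt lambda -> D = B * r + c ->
    u = (lambda * Num.sqrt l%:R)^-1 ->
  lambda * Q ^+ 2 + 2 * (B * (4 * B * D / (lambda * l%:R)) * (2 * D)) +
    L * (r * (2 * D) + Q * (2 * (B * Q + c))) * Num.sqrt (N%:R^-1) `^ h * (1 + 4 * Bk)
  <= lambda * Q ^+ 2 + 16 * B ^+ 2 * (B + 1) ^+ 2 * c ^+ 2 * u ^+ 2 +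
     L * (2 * (B + 1) * c ^+ 2 + 2 * Q * (B * Q + c)) * (1 + 4 * Bk) * u.
Proof.
move=> B0 c0 L0 Bk0 Q0 la0 la1 l0 N0 lN r D u rE DE uE.
have lR : 0 < (l%:R : R) by rewrite ltr0n.
have NR : 0 < (N%:R : R) by rewrite ltr0n.
have sl0 : 0 < Num.sqrt (l%:R : R) by rewrite sqrtr_gt0.
have sa0 : 0 < Num.sqrt lambda by rewrite sqrtr_gt0.
have sa1 : Num.sqrt lambda <= 1 by rewrite -sqrtr1 ler_sqrt.
have r0 : 0 <= r by rewrite rE divr_ge0// ltW.
have cr : c <= r by rewrite rE ler_pdivlMr// ler_piMr.
have r2 : r ^+ 2 = c ^+ 2 / lambda by rewrite rE expr_div_n sqr_sqrtr// ltW.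
have D0 : 0 <= D by rewrite DE addr_ge0// mulr_ge0.
have Dr : D <= (B + 1) * r by rewrite DE mulrDl mul1r lerD2l.
have u2 : u ^+ 2 = (lambda ^+ 2 * l%:R)^-1 by rewrite uE exprVn exprMn sqr_sqrtr// ltW.
have D2 : D ^+ 2 <= (B + 1) ^+ 2 * c ^+ 2 / lambda.
  rewrite -mulrA -r2 -exprMn lerXn2r ?nnegrE// mulr_ge0// addr_ge0//.
have rD : r * D <= (B + 1) * c ^+ 2 / lambda.
  by rewrite -mulrA -r2 expr2 mulrCA ler_wpM2l.
have la1V : 1 <= lambda^-1 by rewrite invf_ge1.
have e1 : 2 * (B * (4 * B * D / (lambda * l%:R)) * (2 * D)) <=
    16 * B ^+ 2 * (B + 1) ^+ 2 * c ^+ 2 * u ^+ 2.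
  rewrite [leLHS](_ : _ = 16 * B ^+ 2 / (lambda * l%:R) * D ^+ 2); last by ring.
  apply: (@le_trans _ _ (16 * B ^+ 2 / (lambda * l%:R) * ((B + 1) ^+ 2 * c ^+ 2 / lambda))).
    by rewrite ler_wpM2l// divr_ge0 ?mulr_ge0 ?sqr_ge0 ?(ltW la0).
  rewrite u2 le_eqVlt; apply/orP; left; apply/eqP; field.
  by rewrite !gt_eqF.
have sh : Num.sqrt (N%:R^-1) `^ h <= (Num.sqrt l%:R)^-1.
  rewrite -(@ler_pXn2r _ 2)// ?nnegrE ?powR_ge0 ?invr_ge0 ?sqrtr_ge0//.
  rewrite exprVn sqr_sqrtr ?(ltW lR)// -powR_mulrn ?powR_ge0//.
  rewrite -powRrM mulrC powRrM powR_mulrn ?sqrtr_ge0// sqr_sqrtr ?invr_ge0 ?(ltW NR)//.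
  rewrite -powR_inv1 ?(ltW NR)// -powRrM mulN1r powRN.
  by rewrite lef_pV2 ?posrE ?(lt_le_trans lR).
have e2 : L * (r * (2 * D) + Q * (2 * (B * Q + c))) * Num.sqrt (N%:R^-1) `^ h * (1 + 4 * Bk) <=
    L * (2 * (B + 1) * c ^+ 2 + 2 * Q * (B * Q + c)) * (1 + 4 * Bk) * u.
  rewrite [leRHS]mulrAC ler_wpM2r ?addr_ge0 ?mulr_ge0//.
  have q0 : 0 <= 2 * Q * (B * Q + c) by rewrite !mulr_ge0// addr_ge0// mulr_ge0.
  rewrite uE invfM [leRHS]mulrA; apply: ler_pM => //.
  - rewrite mulr_ge0// addr_ge0// ?mulr_ge0// addr_ge0// mulr_ge0//.
  - rewrite -[leRHS]mulrA ler_wpM2l// [leRHS]mulrDl lerD//.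
      by rewrite mulrCA -[2 * (B + 1) * _]mulrA -[leRHS]mulrA ler_wpM2l.
    rewrite [leLHS](_ : _ = 2 * Q * (B * Q + c)); last by ring.
    by rewrite ler_peMr.
by lra.
Qed.

Lemma excess_bound_cvg0 (R : realType) (lambda u : nat -> R) (a b d e : R) :
  lambda @ \oo --> 0 -> u @ \oo --> 0 -> 0 < e ->
  \forall l \near \oo, lambda l * a + b * u l ^+ 2 + d * u l < e.
Proof.
move=> la0 u0 e0.
have : (fun l => lambda l * a + b * u l ^+ 2 + d * u l) @ \oo --> 0.
  rewrite (_ : 0 = 0 * a + b * 0 ^+ 2 + d * 0); last by rewrite expr2 !(mulr0, mul0r) !addr0.
  apply: cvgD; [apply: cvgD|].
  - by apply: cvgM => //; exact: cvg_cst.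
  - by apply: cvgM; [exact: cvg_cst|rewrite expr2; under eq_fun do rewrite expr2; exact: cvgM].
  - by apply: cvgM => //; exact: cvg_cst.
move=> /cvgr0Pnorm_lt/(_ _ e0); apply: filterS => l.
exact: le_lt_trans (ler_norm _).
Qed.

Theorem mainTheorem6 (R : realType)
  (T : ptopologicalType) (sepT : separable T)
  (k : T -> T -> R) (k_continuous : continuous (fun p : T * T => k p.1 p.2))
  (Bk : R) (k_bounded : forall u, k u u <= Bk)
  (H : rkhs k)
  (Y : hilbertType R) (sepY : separable Y)
  (K : embeddings H -> embeddings H -> {linear Y -> Y})
  (K_bounded : forall a b, continuous (K a b))
  (HK : vrkhs K)
  (BK : R)
  (K_trace : forall a : embeddings H,
    (trace (adjoint (vrkhs_section HK a) \o vrkhs_section HK a) <= BK%:E)%E)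
  (L h : R) (L_gt0 : 0 < L) (h_gt0 : 0 < h) (h_le1 : h <= 1)
  (K_holder : forall a b : embeddings H,
    opnorm (fun y => vrkhs_section HK a y - vrkhs_section HK b y)
    <= L * `|val a - val b| `^ h)
  (M : probability (borel (measures R T) * borel Y)%type R)
  (C : R) (y_bounded : {ae M, forall p, `|(p.2 : Y)| <= C})
  (rho : probability (borel (embeddings H) * borel Y)%type R)
  (rho_law : is_law rho M (fun p => (embed H p.1, p.2)))
  (rhoX : probability (borel (embeddings H)) R)
  (rhoX_marginal : is_law rhoX rho fst)
  (kappa : R.-pker (borel (embeddings H)) ~> (borel Y))
  (kappa_conditional : is_conditional rho rhoX kappa)
  (lambda : nat -> R) (lambda_gt0 : forall l, 0 < lambda l)
  (lambda_cvg0 : lambda @ \oo --> 0)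
  (lambda_sqrt : (fun l => lambda l * Num.sqrt (l%:R : R)) @ \oo --> +oo)
  (S : forall l, two_stage_sample M l (bag_size h l)) :
  forall eps : R, 0 < eps ->
    (fun l => sample_prob (S l)
      [set w | (eps%:E <=
        `| excess_risk rho (vrkhs_fun (estimator HK (lambda l) w))
             (regression kappa)
           - sq_approx_error HK rhoX (regression kappa) |)%E])
    @ \oo --> 0%E.
Proof.
move=> eps eps0.
have [e' de'] := separable_dense_seq sepY.
pose c := `|C|; have c0 : 0 <= c by exact: normr_ge0.
have mlabel d (Z : measurableType d) : measurable [set p : Z * borel Y | c < `|(p.2 : Y)|].
  apply: (@measurable_norm_gt R _ (Z * borel Y)%type Y snd).
  exact: (norm_measurable_comp (@norm_measurable_id R Y) measurable_snd).
have Mc : M [set p | c < `|(p.2 : Y)|] = 0%E.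
  have [A [mA A0 sA]] := y_bounded.
  apply: (@subset_measure0 _ _ _ M _ A (mlabel _ _) mA _ A0) => p /= cp; apply: sA => /= pC.
  by move: cp; rewrite ltNge (le_trans pC)// ler_norm.
have rhoc : rho [set p | c < `|(p.2 : Y)|] = 0%E by rewrite rho_law; [exact: Mc|exact: mlabel].
have fL (f : HK) (a b : embeddings H) :
    `|vrkhs_fun f a - vrkhs_fun f b| <= L * `|val a - val b| `^ h * `|f|.
  exact: (vrkhs_fun_holder (iota := fun a : embeddings H => val a) K_bounded L_gt0 K_holder).
have [B B0 fB] := vrkhs_fun_bounded (iota := fun a : embeddings H => val a) K_bounded h_gt0
  L_gt0 (norm_val_embeddings sepT k_continuous k_bounded (H := H)) K_holder (point : embeddings H).
have mf (f : HK) : @norm_measurable R _ (borel (embeddings H)) Y (vrkhs_fun f).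
  exact: (norm_measurable_vrkhs_fun sepT k_continuous de' L_gt0 h_gt0 fL).
have [iota [iota_le iota_approx gapE]] :=
  excess_risk_gap de' c0 rhoX_marginal kappa_conditional rhoc fB mf.
pose rr (f : HK) := real_risk rho f.
have rrE (f : HK) : (rr f)%:E = risk rho (vrkhs_fun f) 
  by exact: (real_riskE sepT k_continuous de' fB L_gt0 h_gt0 fL c0 Mc rho_law).
have iota_rr f : iota <= rr f by rewrite -lee_fin rrE.
have iota0 : 0 <= iota.
  apply/ler_addgt0Pr => r r0; have [f] := iota_approx r r0.
  by rewrite -rrE lte_fin => /ltW; apply: le_trans; rewrite -lee_fin rrE risk_ge0.
have Bk0 : 0 <= Bk := kernel_bound_ge0 k_bounded H.
pose u l := (lambda l * Num.sqrt (l%:R : R))^-1.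
have u0 : u @ \oo --> 0.
  apply/gtr0_cvgV0 => //; near=> l; rewrite mulr_gt0// sqrtr_gt0 ltr0n.
  by near: l; exists 1%N.
have setE l : [set w | (eps%:E <= `| excess_risk rho (vrkhs_fun (estimator HK (lambda l) w))
      (regression kappa) - sq_approx_error HK rhoX (regression kappa) |)%E] =
    [set w : sample_space (S l) | eps <= rr (estimator HK (lambda l) w) - iota].
  by apply/seteqP; split => w /=; rewrite gapE -rrE -EFinB abse_EFin lee_fin ger0_norm ?subr_ge0 ?iota_rr.
pose p l : \bar R := sample_prob (S l) [set w | eps <= rr (estimator HK (lambda l) w) - iota].
suff small : forall e : R, 0 < e -> \forall l \near \oo, (p l < e%:E)%E.
  have : p @ \oo --> (0 : R)%:E.
    have fin (e : R) l : (p l < e%:E)%E -> p l \is a fin_num.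
      by move=> ple; rewrite ge0_fin_numE ?measure_ge0// (lt_trans ple)// ltry.
    apply/fine_cvgP; split; first by apply: filterS (small 1 ltr01) => l; exact: fin.
    apply/cvgr0Pnorm_lt => e e0; apply: filterS (small e e0) => l ple.
    rewrite /= ger0_norm; first by rewrite -lte_fin fineK ?(fin e).
    by rewrite fine_ge0// measure_ge0.
  by under [in X in _ -> X]eq_fun do rewrite setE.
move=> e e0.
(* half of [e * eps] for the risk of [q], half for the vanishing terms *)
have ee0 : 0 < e * eps / 2 by rewrite divr_gt0// mulr_gt0.
have [q] := iota_approx _ ee0; rewrite -rrE lte_fin => q_lt.
near=> l.
have l0 : (0 < l)%N by near: l; exists 1%N.
have le1 : expR 1 <= (l%:R : R) by near: l; exact: nbhs_infty_ger.
have lN := bag_size_ge h_gt0 l0 le1.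
have N0 : (0 < bag_size h l)%N.
  rewrite lt0n; apply/eqP => N0; move: lN; rewrite N0 powR0 ?gt_eqF//.
  by rewrite leNgt ltr0n l0.
have la1 : lambda l <= 1.
  near: l; have /cvgr0Pnorm_lt/(_ _ ltr01) := lambda_cvg0; apply: filterS => l.
  by move=> /ltW; apply: le_trans; exact: ler_norm.
have := expected_risk_le sepT k_continuous k_bounded de' B0 fB L_gt0 h_gt0 h_le1 fL c0 Mc
  rho_law N0 l0 (S l) (lambda_gt0 l) q.
rewrite -/(rr q) => Ele.
have Emeas := estimator_risk_measurable sepT k_continuous k_bounded de' B0 fB L_gt0 h_gt0 fL c0 Mc
  rho_law N0 (S := S l) (lambda_gt0 l).
have := probability_gap_le (sample_prob (S l)) Emeas iota0 eps0 (fun w => iota_rr _).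
move=> /le_trans/(_ Ele){Ele}.
rewrite -/(p l).
have pfin : p l \is a fin_num.
  apply: fin_num_measure.
  rewrite (_ : [set w | _] = (fun w => rr (estimator HK (lambda l) w) - iota) @^-1`
      `[eps, +oo[%classic); last by apply/seteqP; split => w /=; rewrite in_itv/= andbT.
  by rewrite -[X in measurable X]setTI; apply: measurable_funB.
rewrite -(fineK pfin) -EFinM -EFinD !lte_fin lee_fin => ple.
have := excess_bound B0 c0 (ltW L_gt0) Bk0 (normr_ge0 q) (lambda_gt0 l) la1 l0 N0 lN erefl erefl erefl.
rewrite -/(u l).
have : lambda l * `|q| ^+ 2 + 16 * B ^+ 2 * (B + 1) ^+ 2 * c ^+ 2 * u l ^+ 2 +
     L * (2 * (B + 1) * c ^+ 2 + 2 * `|q| * (B * `|q| + c)) * (1 + 4 * Bk) * u l < e * eps / 2.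
  by near: l; exact: excess_bound_cvg0.
move: ple; rewrite -(ltr_pM2l eps0); set z := fine (p l).
by lra.
Unshelve. all: by end_near.
Qed.
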